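(* Let $\mathcal A$ be a special biserial (or gentle, or string) category from a thread quiver $(Q,\mathcal P)$ where $Q$ is a biserial quiver. Then $\mathcal A$ is virtually tame.
   Context: $k$ is an algebraically closed field. A thread quiver $(Q,\mathcal P)$ consists of a quiver $Q=(Q_0,Q_1,s,t)$ and, for every arrow $\alpha$, a (possibly empty) linearly ordered set $\mathcal P_\alpha$; $\overline{\mathcal P}_\alpha=\mathcal P_\alpha\sqcup\{\min(\alpha),\max(\alpha)\}$ is obtained by adding a new least element $\min(\alpha)$ and a new greatest element $\max(\alpha)$. Its path category $\mathcal C$ is the $k$-linear category with object set $Q_0\sqcup\bigsqcup_\alpha\mathcal P_\alpha$, where $\min(\alpha),\max(\alpha)$ are viewed as the objects $s(\alpha),t(\alpha)$ (they remain distinct elements of $\overline{\mathcal P}_\alpha$ even if $\alpha$ is a loop). For $x\le y$ in $\overline{\mathcal P}_\alpha$ there is a morphism $\eta_{y,x}=\eta_{yx}:x\to y$, with $\eta_{xx}=e_x$ the identity, $\eta_{zy}\eta_{yx}=\eta_{zx}$ for $x\le y\le z$, and $\eta_{\max(\alpha),\min(\alpha)}=\alpha$; write $\eta_{t(\alpha),x}:=\eta_{\max(\alpha),x}$ and $\eta_{x,s(\alpha)}:=\eta_{x,\min(\alpha)}$. The space $\mathrm{Hom}_{\mathcal C}(x,y)$ has as $k$-basis the distinct path-like elements from $x$ to $y$: the identities $e_x$, the $\eta_{yx}$, and the elements $\eta_{y,s(\beta)}\,p\,\eta_{t(\alpha),x}$ with $x\in\overline{\mathcal P}_\alpha$, $y\in\overline{\mathcal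 P}_\beta$ and $p$ a (possibly trivial) path of $Q$ from $t(\alpha)$ to $s(\beta)$. Composition is induced by concatenation of paths in $Q$ together with the relations $\eta_{zy}\eta_{yx}=\eta_{zx}$ for $x\le y\le z$ in $\overline{\mathcal P}_\alpha$ and $\eta_{\max(\alpha),\min(\alpha)}=\alpha$, for every arrow $\alpha$. An ideal $\mathcal I$ of $\mathcal C$, with $\mathcal A=\mathcal C/\mathcal I$, is weakly admissible if (i) all $\mathrm{End}_{\mathcal A}(x)$ are local; (ii) all $\mathrm{Hom}_{\mathcal A}(x,y)$ are finite-dimensional; (iii) $\mathcal I$ is generated by elements of $\mathcal J$, the ideal of $\mathcal C$ generated by all path-like elements different from the $e_x$. Quadratic families. (I) For arrows $\alpha,\beta$ with $x=t(\alpha)=s(\beta)\in Q_0$, the quadratic family associated to $\beta\alpha$ is $\{\eta_{zx}\eta_{xy}\}_{y,z}$ with $y\in\mathcal P_\alpha\cup\{s(\alpha)\}$, $z\in\mathcal P_\beta\cup\{t(\beta)\}$, where $\eta_{xy}$ is taken along $\alpha$ (with $\eta_{x,s(\alpha)}=\alpha$, also if $\alpha$ is a loop) and $\eta_{zx}$ along $\beta$ (with $\eta_{t(\beta),x}=\beta$, also if $\beta$ is a loop). (II) For $x\in\mathcal P_\alpha$, the quadratic family associated to $x$ is $\{\eta_{zx}\eta_{xy}\}_{y,z}$ with $y<x<z$, $y,z\in\overline{\mathcal P}_\alpha$. A biserial quiver is a finite quiver with at most two arrows leaving and at most two arrows entering each vertex. For a thread quiver on a biserial quiver $Q$, a special biserial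 category is $\mathcal A=\mathcal C/\mathcal I$ with $\mathcal I$ weakly admissible such that: (SB1) for $\alpha,\beta,\gamma\in Q_1$ with $t(\alpha)=s(\beta)=s(\gamma)$ and $\beta\ne\gamma$, $\mathcal I$ contains at least one of the quadratic families associated to $\beta\alpha$ and to $\gamma\alpha$; (SB2) for $\alpha,\beta,\gamma\in Q_1$ with $t(\alpha)=t(\beta)=s(\gamma)$ and $\alpha\neq\beta$, $\mathcal I$ contains at least one of the quadratic families associated to $\gamma\alpha$ and to $\gamma\beta$. A gentle category is defined by replacing ''at least one'' by ''exactly one'' in (SB1) and (SB2) and requiring that any other (family of) relations in $\mathcal I$ be quadratic (of type (I) or (II)), i.e. $\mathcal I$ is generated by quadratic families. A string category is a special biserial category for which moreover $\mathcal I$ is generated by nontrivial path-like elements. An interval of a linearly ordered set is a nonempty subset $I$ such that $x<z<y$ with $x,y\in I$ implies $z\in I$. A valid partition $\mathfrak P$ is a partition of the objects of $\mathcal C$ such that $\{x\}$ is a cell for each $x\in Q_0$, and each $\mathcal P_\alpha$ is a union of finitely many cells that are intervals. A sample $\mathcal M$ of $\mathfrak P$ is a set of objects containing exactly one element of each cell. Morphisms $f_1:x_1\to y_1$, $f_2:x_2\to y_2$ of $\mathcal C$ with $x_1,x_2$ in one cell $X$ and $y_1,y_2$ in one cell $Y$ are $\mathfrak P$-equivalent if there are $z\in X$, $w\in Y$ with $\eta_{wy_1}f_1\eta_{x_1z}=\eta_{wy_2}f_2\eta_{x_2z}$. The $\mathfrak P$-completion $\overline{\mathcal I}^{\mathfrak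 P}$ is the ideal of $\mathcal C$ generated by all $f$ that are $\mathfrak P$-equivalent to some $g\in\mathcal I$; $\overline{\mathcal A}^{\mathfrak P}=\mathcal C/\overline{\mathcal I}^{\mathfrak P}$, and $\overline{\mathcal A}^{\mathfrak P}(\mathcal M)$ is its full subcategory on $\mathcal M$ (equivalent to a finite-dimensional algebra here). $\mathcal A$ is virtually tame if for every valid partition $\mathfrak P$ with sample $\mathcal M$, $\overline{\mathcal A}^{\mathfrak P}(\mathcal M)$ is of tame representation type (in the classical sense, finite type included). *)

(* Defs.v *)
From HB Require Import structures.
From mathcomp Require Import all_boot all_order all_algebra finmap.
From mathcomp Require Import generic_quotient ring_quotient.
From mathcomp Require Import boolp classical_sets cardinality.
From mathcomp Require Import ssrcomplements monalg.

Set Implicit Arguments.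
Unset Strict Implicit.
Unset Printing Implicit Defensive.

Import Order.TTheory GRing.Theory.
Local Open Scope ring_scope.
Local Open Scope quotient_scope.
Local Open Scope classical_set_scope.

(* Composition is written as for functions: [comp g f] is "first f, then g". *)
Record lincat (k : fieldType) (O : Type) := LinCat {
  hom : O -> O -> lmodType k;
  idm : forall x, hom x x;
  comp : forall x y z, hom y z -> hom x y -> hom x z;
  comp_linl : forall x y z (f : hom x y) a (g g' : hom y z),
    comp (a *: g + g') f = a *: comp g f + comp g' f;
  comp_linr : forall x y z (g : hom y z) a (f f' : hom x y),
    comp g (a *: f + f') = a *: comp g f + comp g f';
  compA : forall x y z w (h : hom z w) (g : hom y z) (f : hom x y),
    comp h (comp g f) = comp (comp h g) f;
  comp1l : forall x y (f : hom x y), comp (idm y) f = f;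
  comp1r : forall x y (f : hom x y), comp f (idm x) = f
}.

Definition family (k : fieldType) (O : Type) (C : lincat k O) :=
  forall x y, set (hom C x y).

Definition subfamily (k : fieldType) (O : Type) (C : lincat k O)
  (F G : family C) := forall x y, F x y `<=` G x y.

Record ideal (k : fieldType) (O : Type) (C : lincat k O) := Ideal {
  carrier :> forall x y, set (hom C x y);
  ideal0 : forall x y, carrier (0 : hom C x y);
  ideal_lin : forall x y a (f g : hom C x y),
    carrier f -> carrier g -> carrier (a *: f + g);
  idealMl : forall x y z (g : hom C y z) (f : hom C x y),
    carrier f -> carrier (comp g f);
  idealMr : forall x y z (g : hom C y z) (f : hom C x y),
    carrier g -> carrier (comp g f)
}.

Section IdealGen.
Variables (k : fieldType) (O : Type) (C : lincat k O) (S : family C).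

Definition gen_carrier : family C :=
  fun x y f => forall I : ideal C, subfamily S I -> I x y f.

Fact gen0 x y : gen_carrier (0 : hom C x y).
Proof. by move=> I _; apply: ideal0. Qed.

Fact gen_lin x y a (f g : hom C x y) :
  gen_carrier f -> gen_carrier g -> gen_carrier (a *: f + g).
Proof. by move=> If Ig I SI; apply: ideal_lin; [apply: If|apply: Ig]. Qed.

Fact genMl x y z (g : hom C y z) (f : hom C x y) :
  gen_carrier f -> gen_carrier (comp g f).
Proof. by move=> If I SI; apply/idealMl/If. Qed.

Fact genMr x y z (g : hom C y z) (f : hom C x y) :
  gen_carrier g -> gen_carrier (comp g f).
Proof. by move=> Ig I SI; apply/idealMr/Ig. Qed.

Definition ideal_gen : ideal C := Ideal gen0 gen_lin genMl genMr.

End IdealGen.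

Definition generated_by (k : fieldType) (O : Type) (C : lincat k O)
  (I : ideal C) (S : family C) := forall x y, I x y = ideal_gen S x y.

Section QuotHom.
Variables (k : fieldType) (O : Type) (C : lincat k O) (I : ideal C).
Variables (x y : O).

Definition ideal_pred := [pred f : hom C x y | `[< I x y f >]].

Fact ideal_pred_zmod : zmod_closed ideal_pred.
Proof.
split=> [|f g]; rewrite !inE; first exact: ideal0.
move=> If Ig.
by rewrite addrC -scaleN1r; apply: ideal_lin.
Qed.

HB.instance Definition _ := GRing.isZmodClosed.Build (hom C x y) ideal_pred
  ideal_pred_zmod.

Definition quot_hom : Type := Quotient.quot ideal_pred.

HB.instance Definition _ := GRing.Zmodule.on quot_hom.

Definition quot_pi (f : hom C x y) : quot_hom :=
  \pi_(Quotient.quot ideal_pred) f.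
Definition quot_repr (u : quot_hom) : hom C x y :=
  repr (u : Quotient.quot ideal_pred).

Fact quot_reprK u : quot_pi (quot_repr u) = u.
Proof. exact: reprK. Qed.

Fact quot_piP f g : quot_pi f = quot_pi g <-> I x y (f - g).
Proof.
split=> [/eqP|If]; last first.
  by apply/eqP; rewrite -Quotient.idealrBE inE.
by rewrite -Quotient.idealrBE inE.
Qed.

Fact quot_piB f g : quot_pi (f - g) = quot_pi f - quot_pi g.
Proof. exact: raddfB. Qed.

Fact quot_piD f g : quot_pi (f + g) = quot_pi f + quot_pi g.
Proof. exact: raddfD. Qed.

Definition quot_scale (a : k) (u : quot_hom) := quot_pi (a *: quot_repr u).

Fact quot_piZ a f : quot_pi (a *: f) = quot_scale a (quot_pi f).
Proof.
apply/quot_piP; rewrite -scalerBr -[_ *: _]addr0.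
by apply: ideal_lin (ideal0 _ _ _); apply/quot_piP; rewrite quot_reprK.
Qed.

Fact quot_scaleA a b u : quot_scale a (quot_scale b u) = quot_scale (a * b) u.
Proof. by rewrite -[u]quot_reprK -!quot_piZ scalerA. Qed.

Fact quot_scale1 : left_id 1 quot_scale.
Proof. by move=> u; rewrite -[u]quot_reprK -!quot_piZ scale1r. Qed.

Fact quot_scaleDr : right_distributive quot_scale +%R.
Proof.
move=> a u v; rewrite -[u]quot_reprK -[v]quot_reprK -quot_piD -!quot_piZ.
by rewrite scalerDr quot_piD.
Qed.

Fact quot_scaleDl u : {morph quot_scale^~ u : a b / a + b}.
Proof.
by move=> a b; rewrite -[u]quot_reprK -!quot_piZ scalerDl quot_piD.
Qed.

HB.instance Definition _ := GRing.Zmodule_isLmodule.Build k quot_hom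
  quot_scaleA quot_scale1 quot_scaleDr quot_scaleDl.

Fact quot_pi_lin a f g : quot_pi (a *: f + g) = a *: quot_pi f + quot_pi g.
Proof. by rewrite quot_piD quot_piZ. Qed.

End QuotHom.

Section QuotCat.
Variables (k : fieldType) (O : Type) (C : lincat k O) (I : ideal C).

Definition quot_comp x y z (g : quot_hom I y z) (f : quot_hom I x y) :
    quot_hom I x z :=
  quot_pi I (comp (quot_repr g) (quot_repr f)).

Fact comp_subl x y z (f : hom C x y) (g g' : hom C y z) :
  comp (g - g') f = comp g f - comp g' f.
Proof. by rewrite addrC -scaleN1r comp_linl scaleN1r addrC. Qed.

Fact comp_subr x y z (f f' : hom C x y) (g : hom C y z) :
  comp g (f - f') = comp g f - comp g f'.
Proof. by rewrite addrC -scaleN1r comp_linr scaleN1r addrC. Qed.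

Fact quot_pi_comp x y z (g : hom C y z) (f : hom C x y) :
  quot_pi I (comp g f) = quot_comp (quot_pi I g) (quot_pi I f).
Proof.
have sound u v (h : hom C u v) : I _ _ (h - quot_repr (quot_pi I h)).
  by apply/quot_piP; rewrite quot_reprK.
set g' := quot_repr (quot_pi I g); set f' := quot_repr (quot_pi I f).
transitivity (quot_pi I (comp g' f)); apply/quot_piP.
  by rewrite -comp_subl; apply/idealMr/sound.
by rewrite -comp_subr; apply/idealMl/sound.
Qed.

Fact quot_comp_linl x y z (f : quot_hom I x y) a (g g' : quot_hom I y z) :
  quot_comp (a *: g + g') f = a *: quot_comp g f + quot_comp g' f.
Proof.
rewrite -[f]quot_reprK -[g]quot_reprK -[g']quot_reprK.
by rewrite -quot_pi_lin -!quot_pi_comp comp_linl quot_pi_lin.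
Qed.

Fact quot_comp_linr x y z (g : quot_hom I y z) a (f f' : quot_hom I x y) :
  quot_comp g (a *: f + f') = a *: quot_comp g f + quot_comp g f'.
Proof.
rewrite -[f]quot_reprK -[g]quot_reprK -[f']quot_reprK.
by rewrite -quot_pi_lin -!quot_pi_comp comp_linr quot_pi_lin.
Qed.

Fact quot_compA x y z w
    (h : quot_hom I z w) (g : quot_hom I y z) (f : quot_hom I x y) :
  quot_comp h (quot_comp g f) = quot_comp (quot_comp h g) f.
Proof.
rewrite -[h]quot_reprK -[g]quot_reprK -[f]quot_reprK.
by rewrite -!quot_pi_comp compA.
Qed.

Fact quot_comp1l x y (f : quot_hom I x y) :
  quot_comp (quot_pi I (idm C y)) f = f.
Proof. by rewrite -[f]quot_reprK -quot_pi_comp comp1l. Qed.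

Fact quot_comp1r x y (f : quot_hom I x y) :
  quot_comp f (quot_pi I (idm C x)) = f.
Proof. by rewrite -[f]quot_reprK -quot_pi_comp comp1r. Qed.

Definition quot_cat : lincat k O :=
  @LinCat k O (fun x y => quot_hom I x y) (fun x => quot_pi I (idm C x))
    quot_comp quot_comp_linl quot_comp_linr quot_compA quot_comp1l quot_comp1r.

End QuotCat.

Definition full_subcat (k : fieldType) (O : choiceType) (A : lincat k O)
    (M : {fset O}) : lincat k M :=
  @LinCat k M (fun x y => hom A (val x) (val y)) (fun x => idm A (val x))
    (fun x y z => @comp k O A (val x) (val y) (val z))
    (fun x y z => @comp_linl k O A (val x) (val y) (val z))
    (fun x y z => @comp_linr k O A (val x) (val y) (val z))
    (fun x y z w => @compA k O A (val x) (val y) (val z) (val w))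
    (fun x y => @comp1l k O A (val x) (val y))
    (fun x y => @comp1r k O A (val x) (val y)).

Section LinCatProperties.
Variables (k : fieldType) (O : Type) (A : lincat k O).

Definition iso_endo x (f : hom A x x) :=
  exists g, comp g f = idm A x /\ comp f g = idm A x.

(* A ring is local if it is nonzero and its non-units are closed under sum. *)
Definition local_end x :=
  idm A x <> 0 /\
  forall f g : hom A x x,
    ~ iso_endo f -> ~ iso_endo g -> ~ iso_endo (f + g).

Definition findim_hom x y :=
  exists n (b : 'I_n -> hom A x y),
    forall f, exists c : 'I_n -> k, f = \sum_i c i *: b i.

End LinCatProperties.

(* k-linear functors from [A] to finitely generated free R-modules, where R
   is a k-algebra via [phi]; dimension vectors and matrices acting on columns.
   For R = k these are the finite-dimensional modules.  For R = k[X] and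
   finitely many objects they are the bimodules that are free of finite rank
   over k[X]: such a bimodule is the direct sum of its values, which are free
   because k[X] is a principal ideal domain. *)
Record rep (k : fieldType) (O : Type) (A : lincat k O) (R : comNzRingType)
    (phi : {rmorphism k -> R}) := Rep {
  dimv : O -> nat;
  act : forall x y, hom A x y -> 'M[R]_(dimv y, dimv x);
  act_lin : forall x y a (f g : hom A x y),
    act (a *: f + g) = phi a *: act f + act g;
  act_id : forall x, act (idm A x) = 1%:M;
  act_comp : forall x y z (g : hom A y z) (f : hom A x y),
    act (comp g f) = act g *m act f
}.

Section Representations.
Variables (k : fieldType) (O : Type) (A : lincat k O).

Definition frep := rep A (idfun : {rmorphism k -> k}).
Definition polyrep := rep A (polyC : {rmorphism k -> {poly k}}).

Definition isorep (V W : frep) :=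
  exists (F : forall x, 'M[k]_(dimv W x, dimv V x))
         (G : forall x, 'M[k]_(dimv V x, dimv W x)),
    (forall x, F x *m G x = 1%:M /\ G x *m F x = 1%:M) /\
    (forall x y (f : hom A x y), F y *m act V f = act W f *m F x).

Section DirectSum.
Variables V W : frep.

Definition dsum_act x y (f : hom A x y) :
    'M[k]_(dimv V y + dimv W y, dimv V x + dimv W x) :=
  block_mx (act V f) 0 0 (act W f).

Fact dsum_act_lin x y a (f g : hom A x y) :
  dsum_act (a *: f + g) = idfun a *: dsum_act f + dsum_act g.
Proof.
by rewrite /dsum_act !act_lin scale_block_mx add_block_mx !scaler0 !addr0.
Qed.

Fact dsum_act_id x : dsum_act (idm A x) = 1%:M.
Proof. by rewrite /dsum_act !act_id -scalar_mx_block. Qed.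

Fact dsum_act_comp x y z (g : hom A y z) (f : hom A x y) :
  dsum_act (comp g f) = dsum_act g *m dsum_act f.
Proof.
by rewrite /dsum_act !act_comp mulmx_block !mul0mx !mulmx0 !addr0 !add0r.
Qed.

Definition dsum : frep :=
  @Rep _ _ A _ idfun (fun x => (dimv V x + dimv W x)%N)
    dsum_act dsum_act_lin dsum_act_id dsum_act_comp.

End DirectSum.

(* The module N (x)_{k[X]} k[X]/(X - lam). *)
Section Specialize.
Variables (N : polyrep) (lam : k).

Definition spec_act x y (f : hom A x y) : 'M[k]_(dimv N y, dimv N x) :=
  map_mx (horner_eval lam) (act N f).

Fact spec_act_lin x y a (f g : hom A x y) :
  spec_act (a *: f + g) = idfun a *: spec_act f + spec_act g.
Proof.
by rewrite /spec_act act_lin map_mxD map_mxZ /= /horner_eval hornerC.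
Qed.

Fact spec_act_id x : spec_act (idm A x) = 1%:M.
Proof. by rewrite /spec_act act_id map_mx1. Qed.

Fact spec_act_comp x y z (g : hom A y z) (f : hom A x y) :
  spec_act (comp g f) = spec_act g *m spec_act f.
Proof. by rewrite /spec_act act_comp map_mxM. Qed.

Definition specialize : frep :=
  @Rep _ _ A _ idfun (dimv N) spec_act spec_act_lin spec_act_id spec_act_comp.

End Specialize.

End Representations.

Section Tame.
Variables (k : fieldType) (O : finType) (A : lincat k O).

Definition rdim (V : frep A) : nat := (\sum_(x : O) dimv V x)%N.

Definition indecomposable (V : frep A) :=
  (0 < rdim V)%N /\
  forall V1 V2 : frep A, isorep V (dsum V1 V2) ->
    rdim V1 = 0%N \/ rdim V2 = 0%N.

Definition tame :=
  forall d : nat,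
    exists (n : nat) (N : 'I_n -> polyrep A) (m : nat) (E : 'I_m -> frep A),
      forall V : frep A, indecomposable V -> rdim V = d ->
        (exists i lam, isorep V (specialize (N i) lam)) \/
        (exists j, isorep V (E j)).

End Tame.

Record quiver := Quiver {
  vertex : finType;
  arrow : finType;
  src : arrow -> vertex;
  tgt : arrow -> vertex
}.

Definition biserial_quiver (Q : quiver) :=
  forall x : vertex Q,
    (#|[pred a : arrow Q | src a == x]| <= 2)%N /\
    (#|[pred a : arrow Q | tgt a == x]| <= 2)%N.

Record thread_quiver (d : Order.disp_t) := ThreadQuiver {
  base :> quiver;
  thread : arrow base -> orderType d
}.

Section PathCategory.
Variables (k : fieldType) (d : Order.disp_t) (T : thread_quiver d).

Definition obj : choiceType := (vertex T + {a : arrow T & thread a})%type.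

Definition vtx (x : vertex T) : obj := inl x.
Definition pt (a : arrow T) (x : thread a) : obj :=
  inr (Tagged (fun a => thread a : Type) x).

Definition obj_exit (u : obj) : vertex T :=
  match u with inl x => x | inr p => tgt (tag p) end.
Definition obj_entry (u : obj) : vertex T :=
  match u with inl x => x | inr p => src (tag p) end.

Definition thread_le (u v : obj) : bool :=
  match u, v with
  | inr p, inr q => (tag p == tag q) && (tagged p <= tagged_as p q)%O
  | _, _ => false
  end.

(* Paths of the quiver list their arrows in the order of travel. *)
Fixpoint qpath (x : vertex T) (p : seq (arrow T)) (y : vertex T) : bool :=
  if p is a :: p' then (src a == x) && qpath (tgt a) p' y else x == y.

(* Each path-like element from u to v is encoded exactly once:
   - [None] is eta_{vu}, for u <= v in the same thread (the identity if u = v);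
   - [Some p] is the path p of Q, running from the end of the thread of u (or
     from u itself if u is a vertex) to the start of the thread of v (or to v),
     pre- and postcomposed with eta_{t(alpha),u} and eta_{v,s(beta)}. *)
Definition plike_valid (u v : obj) (b : option (seq (arrow T))) : bool :=
  if b is Some p then qpath (obj_exit u) p (obj_entry v) else thread_le u v.

Definition plike (u v : obj) : choiceType :=
  {b : option (seq (arrow T)) | plike_valid u v b}.

Definition id_body (u : obj) : option (seq (arrow T)) :=
  if u is inl _ then Some [::] else None.

(* The order inside a cell: equality on vertices, the order on threads. *)
Definition obj_le (u v : obj) : bool :=
  match u, v with
  | inl x, inl y => x == y
  | inr _, inr _ => thread_le u v
  | _, _ => false
  end.

Fact id_body_valid u v : obj_le u v -> plike_valid u v (id_body u).
Proof. by case: u v => [x|p] [y|q]. Qed.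

Fact obj_le_refl u : obj_le u u.
Proof. by case: u => [x|[a x]] /=; rewrite eqxx ?tagged_asE /=. Qed.

Definition plike_eta u v (uv : obj_le u v) : plike u v :=
  exist _ (id_body u) (id_body_valid uv).

Definition plike_id u : plike u u := plike_eta (obj_le_refl u).

Definition nontrivial u v (p : plike u v) : bool :=
  ~~ ((u == v) && (val p == id_body u)).

(* Passing through an interior point of the thread of alpha composes
   eta_{t(alpha),v} and eta_{v,s(alpha)} to alpha. *)
Definition through (v : obj) (q : seq (arrow T)) : seq (arrow T) :=
  if v is inr p then tag p :: q else q.

Definition comp_body (v : obj) (q p : option (seq (arrow T))) :=
  match p, q with
  | Some p, Some q => Some (p ++ through v q)
  | Some p, None => Some p
  | None, _ => q
  end.

Fact qpath_cat x p y q z : qpath x p y -> qpath y q z -> qpath x (p ++ q) z.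
Proof.
by elim: p x => [|a p IHp] x /= => [/eqP->|/andP[-> /IHp]].
Qed.

Fact thread_le_tag u v : thread_le u v ->
  [/\ obj_exit u = obj_exit v, obj_entry u = obj_entry v
    & through u = through v].
Proof.
by case: u v => [x|p] [y|q] //= /andP[/eqP pq _]; rewrite /through pq.
Qed.

Fact thread_le_trans u v w : thread_le u v -> thread_le v w -> thread_le u w.
Proof.
case: u v w => [x|[a x]] [y|[b y]] [z|[c z]] //=.
move=> /andP[/eqP ab +] /andP[/eqP bc]; case: _ / bc z => z.
case: _ / ab y z => y z; rewrite !tagged_asE eqxx /=; exact: le_trans.
Qed.

Fact through_valid v q w :
  qpath (obj_exit v) q w -> qpath (obj_entry v) (through v q) w.
Proof. by case: v => //= p ->; rewrite eqxx. Qed.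

Fact comp_body_valid u v w q p : plike_valid v w q -> plike_valid u v p ->
  plike_valid u w (comp_body v q p).
Proof.
case: q p => [q|] [p|] //=.
- by move=> vq pv; apply/(qpath_cat pv)/through_valid.
- by move=> + /thread_le_tag[-> _ _].
- by move=> /thread_le_tag[_ -> _].
- by move=> vw uv; apply: thread_le_trans vw.
Qed.

Definition plike_comp u v w (q : plike v w) (p : plike u v) : plike u w :=
  exist _ (comp_body v (val q) (val p)) (comp_body_valid (valP q) (valP p)).

Fact plike_compA u v w z (r : plike w z) (q : plike v w) (p : plike u v) :
  plike_comp r (plike_comp q p) = plike_comp (plike_comp r q) p.
Proof.
apply: val_inj; case: r q p => [[r|] rP] [[q|] qP] [[p|] pP] //=.
  by rewrite -catA; congr (Some (_ ++ _)); case: (v).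
by have [_ _ ->] := thread_le_tag qP.
Qed.

Fact plike_comp1l u v (p : plike u v) : plike_comp (plike_id v) p = p.
Proof.
apply: val_inj; case: v p => [x|a] [[p|] pP] //=; first by rewrite cats0.
by case: u pP.
Qed.

Fact plike_comp1r u v (p : plike u v) : plike_comp p (plike_id u) = p.
Proof. by apply: val_inj; case: u p => [x|a] [[p|] pP]. Qed.

Definition lin_ext (K : choiceType) (V : lmodType k) (e : K -> V)
  (g : {malg k[K]}) : V := \sum_(b <- msupp g) g@_b *: e b.

Definition path_hom (u v : obj) : lmodType k := {malg k[plike u v]}.

Definition path_comp u v w (g : path_hom v w) (f : path_hom u v) :
    path_hom u w :=
  lin_ext (fun q => lin_ext (fun p => << plike_comp q p >> : path_hom u w) f) g.

Section LinExt.
Variables (K : choiceType) (V : lmodType k).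
Implicit Types (e : K -> V) (g : {malg k[K]}).

Fact lin_extw e g (D : {fset K}) : (msupp g `<=` D)%fset ->
  lin_ext e g = \sum_(b <- D) g@_b *: e b.
Proof.
move=> gD; rewrite /lin_ext (big_fset_incl _ gD) // => b _ bg.
by rewrite mcoeff_outdom // scale0r.
Qed.

Fact lin_ext_lin e a g h :
  lin_ext e (a *: g + h) = a *: lin_ext e g + lin_ext e h.
Proof.
set D := (msupp g `|` msupp h `|` msupp (a *: g + h))%fset.
have gD : (msupp g `<=` D)%fset by rewrite /D -fsetUA fsubsetUl.
have hD : (msupp h `<=` D)%fset by rewrite /D fsetUAC fsubsetUr.
have sD : (msupp (a *: g + h) `<=` D)%fset by rewrite /D fsubsetUr.
rewrite (lin_extw e gD) (lin_extw e hD) (lin_extw e sD) scaler_sumr -big_split.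
by apply: eq_bigr => b _ /=; rewrite mcoeffD mcoeffZ scalerDl scalerA.
Qed.

Fact lin_ext_basis e b : lin_ext e << b >> = e b.
Proof.
by rewrite /lin_ext msuppU oner_eq0 big_seq_fset1 mcoeffUU scale1r.
Qed.

Fact eq_lin_ext e e' g : e =1 e' -> lin_ext e g = lin_ext e' g.
Proof. by move=> ee'; apply: eq_bigr => b _; rewrite ee'. Qed.

Fact lin_ext_comb e e' a g :
  lin_ext (fun b => a *: e b + e' b) g = a *: lin_ext e g + lin_ext e' g.
Proof.
rewrite /lin_ext scaler_sumr -big_split; apply: eq_bigr => b _ /=.
by rewrite scalerDr !scalerA mulrC.
Qed.

Fact malg_lin_eq (phi psi : {malg k[K]} -> V) :
  (forall a g h, phi (a *: g + h) = a *: phi g + phi h) ->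
  (forall a g h, psi (a *: g + h) = a *: psi g + psi h) ->
  (forall b, phi << b >> = psi << b >>) -> forall g, phi g = psi g.
Proof.
move=> phiL psiL eqU g.
have lin0 (f : {malg k[K]} -> V) :
    (forall a g h, f (a *: g + h) = a *: f g + f h) -> f 0 = 0.
  by move=> fL; have := fL (-1) 0 0; rewrite scaler0 addr0 scaleN1r addNr.
rewrite [g]monalgE; elim/big_ind: _ => [|x y Ex Ey|b _].
- by rewrite !lin0.
- by rewrite -[x]scale1r phiL psiL Ex Ey.
have -> : << g@_b *g b >> = g@_b *: << b >> + 0 :> {malg k[K]}.
  by apply/malgP => c; rewrite addr0 mcoeffZ !mcoeffU mulrnAr mulr1.
by rewrite phiL psiL eqU !lin0.
Qed.

End LinExt.

Fact path_comp_linl u v w (f : path_hom u v) a (g g' : path_hom v w) :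
  path_comp (a *: g + g') f = a *: path_comp g f + path_comp g' f.
Proof. exact: lin_ext_lin. Qed.

Fact path_comp_linr u v w (g : path_hom v w) a (f f' : path_hom u v) :
  path_comp g (a *: f + f') = a *: path_comp g f + path_comp g f'.
Proof.
rewrite /path_comp -lin_ext_comb; apply: eq_lin_ext => q.
exact: lin_ext_lin.
Qed.

Fact path_compU u v w (q : plike v w) (p : plike u v) :
  path_comp << q >> << p >> = << plike_comp q p >>.
Proof. by rewrite /path_comp !lin_ext_basis. Qed.

Fact path_compA u v w z (h : path_hom w z) (g : path_hom v w)
    (f : path_hom u v) :
  path_comp h (path_comp g f) = path_comp (path_comp h g) f.
Proof.
apply: (malg_lin_eq (phi := fun h => path_comp h (path_comp g f))
                    (psi := fun h => path_comp (path_comp h g) f))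
  => [a h1 h2|a h1 h2|r].
- exact: path_comp_linl.
- by rewrite !path_comp_linl.
apply: (malg_lin_eq (phi := fun g => path_comp << r >> (path_comp g f))
                    (psi := fun g => path_comp (path_comp << r >> g) f))
  => [a g1 g2|a g1 g2|q].
- by rewrite path_comp_linl path_comp_linr.
- by rewrite path_comp_linr path_comp_linl.
apply: (malg_lin_eq (phi := fun f => path_comp << r >> (path_comp << q >> f))
                    (psi := path_comp (path_comp << r >> << q >>)))
  => [a f1 f2|a f1 f2|p].
- by rewrite !path_comp_linr.
- exact: path_comp_linr.
by rewrite !path_compU plike_compA.
Qed.

Fact path_comp1l u v (f : path_hom u v) : path_comp << plike_id v >> f = f.
Proof.
apply: (malg_lin_eq (phi := path_comp << plike_id v >>) (psi := id))
  => // [a f1 f2|p].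
  exact: path_comp_linr.
by rewrite path_compU plike_comp1l.
Qed.

Fact path_comp1r u v (f : path_hom u v) : path_comp f << plike_id u >> = f.
Proof.
apply: (malg_lin_eq (phi := fun f => path_comp f << plike_id u >>) (psi := id))
  => // [a f1 f2|p].
  exact: path_comp_linl.
by rewrite path_compU plike_comp1r.
Qed.

Definition path_cat : lincat k obj :=
  @LinCat k obj path_hom (fun u => << plike_id u >>) path_comp
    path_comp_linl path_comp_linr path_compA path_comp1l path_comp1r.

End PathCategory.

Arguments vtx {d T} x.
Arguments pt {d T a} x.

Section Bar.
Variables (k : fieldType) (d : Order.disp_t) (T : thread_quiver d).
Local Notation C := (path_cat k T).

Variant bar (a : arrow T) := bmin | bmid of thread a | bmax.
Arguments bmin {a}.
Arguments bmid {a} x.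
Arguments bmax {a}.

Definition ble a (x y : bar a) : bool :=
  match x, y with
  | bmin, _ | _, bmax => true
  | bmid x, bmid y => (x <= y)%O
  | _, _ => false
  end.

Definition bobj a (x : bar a) : obj T :=
  match x with
  | bmin => vtx (src a)
  | bmid x => pt x
  | bmax => vtx (tgt a)
  end.

Definition eta_body a (x y : bar a) : option (seq (arrow T)) :=
  match x, y with
  | bmid _, bmid _ => None
  | bmin, bmax => Some [:: a]
  | _, _ => Some [::]
  end.

Fact eta_body_valid a (x y : bar a) :
  ble x y -> plike_valid (bobj x) (bobj y) (eta_body x y).
Proof.
by case: x y => [|x|] [|y|] //=; rewrite ?eqxx // tagged_asE.
Qed.

Definition eta a (x y : bar a) (xy : ble x y) : hom C (bobj x) (bobj y) :=
  << exist _ (eta_body x y) (eta_body_valid xy) : plike (bobj x) (bobj y) >>.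

Fact ble_refl a (x : bar a) : ble x x.
Proof. by case: x => [|x|] /=. Qed.

Fact ble_trans a (x y z : bar a) : ble x y -> ble y z -> ble x z.
Proof. by case: x y z => [|x|] [|y|] [|z|] //=; apply: le_trans. Qed.

Fact eta_id a (x : bar a) (xx : ble x x) : eta xx = idm C (bobj x).
Proof.
by rewrite /eta /=; congr (<< _ >>); apply: val_inj => /=; case: x xx.
Qed.

Fact eta_comp a (x y z : bar a) (xy : ble x y) (yz : ble y z) (xz : ble x z) :
  comp (eta yz) (eta xy) = eta xz.
Proof.
rewrite /= path_compU; congr (<< _ >>); apply: val_inj => /=.
by case: x y z xy yz xz => [|x|] [|y|] [|z|].
Qed.

Fact ble_min a (x : bar a) : ble bmin x. Proof. by []. Qed.
Fact ble_max a (x : bar a) : ble x bmax. Proof. by case: x. Qed.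

(* The cast along [e : tgt a = src b] identifies max(a) and min(b). *)
Inductive quadI (a b : arrow T) (e : tgt a = src b) :
    forall u v, hom C u v -> Prop :=
  QuadI (y : bar a) (z : bar b) of y <> bmax & z <> bmin :
    quadI e (comp (ecast x (hom C (vtx x) (bobj z)) (esym e) (eta (ble_min z)))
                  (eta (ble_max y))).

Inductive quadII (a : arrow T) (x : thread a) :
    forall u v, hom C u v -> Prop :=
  QuadII (y z : bar a) (yx : ble y (bmid x)) (xz : ble (bmid x) z)
    of y <> bmid x & z <> bmid x :
    quadII x (comp (eta xz) (eta yx)).

Variant quadratic : family C -> Prop :=
| QuadraticI a b (e : tgt a = src b) : quadratic (quadI e)
| QuadraticII a (x : thread a) : quadratic (@quadII a x).

Definition nontrivial_pathlike : family C :=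
  fun u v f => exists2 p : plike u v, nontrivial p & f = << p >>.

Definition weakly_admissible (I : ideal C) :=
  [/\ forall u, local_end (quot_cat I) u,
      forall u v, findim_hom (quot_cat I) u v
    & exists2 S : family C,
        subfamily S (ideal_gen nontrivial_pathlike) & generated_by I S].

Definition at_least_one (A B : Prop) := A \/ B.
Definition exactly_one (A B : Prop) := (A /\ ~ B) \/ (~ A /\ B).

Definition SB1 (cond : Prop -> Prop -> Prop) (I : ideal C) :=
  forall (a b c : arrow T) (eb : tgt a = src b) (ec : tgt a = src c),
    b <> c -> cond (subfamily (quadI eb) I) (subfamily (quadI ec) I).

Definition SB2 (cond : Prop -> Prop -> Prop) (I : ideal C) :=
  forall (a b c : arrow T) (ea : tgt a = src c) (eb : tgt b = src c),
    a <> b -> cond (subfamily (quadI ea) I) (subfamily (quadI eb) I).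

Definition special_biserial (I : ideal C) :=
  [/\ weakly_admissible I, SB1 at_least_one I & SB2 at_least_one I].

Definition gentle (I : ideal C) :=
  [/\ weakly_admissible I, SB1 exactly_one I, SB2 exactly_one I
    & exists2 S : family C -> Prop, (forall F, S F -> quadratic F) &
        generated_by I (fun u v f => exists2 F, S F & F u v f)].

Definition string_category (I : ideal C) :=
  special_biserial I /\
  exists2 S : family C, subfamily S nontrivial_pathlike & generated_by I S.

Definition interval (a : arrow T) (J : set (thread a)) :=
  J !=set0 /\
  forall x y z, J x -> J y -> (x < z)%O -> (z < y)%O -> J z.

Definition valid_partition (cells : set (set (obj T))) :=
  [/\ partition cells id [set: obj T],
      forall x : vertex T, cells [set vtx x]
    & forall a : arrow T, exists F : set (set (thread a)),
        [/\ finite_set F,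
            forall J, F J -> interval J /\ cells [set pt x | x in J]
          & \bigcup_(J in F) J = [set: thread a]]].

(* Samples of valid partitions are finite because Q is and each thread is cut
   into finitely many cells, so taking M in {fset obj T} loses none of them. *)
Definition sample (cells : set (set (obj T))) (M : {fset obj T}) :=
  forall X, cells X -> exists! x, x \in M /\ X x.

(* eta_{vu} for u <= v in one cell; an identity if the cell is a vertex. *)
Definition cell_eta (u v : obj T) (uv : obj_le u v) : hom C u v :=
  << plike_eta uv >>.

Definition pequiv (cells : set (set (obj T)))
    x1 y1 (f1 : hom C x1 y1) x2 y2 (f2 : hom C x2 y2) :=
  exists X Y : set (obj T),
    [/\ cells X /\ cells Y, X x1 /\ X x2, Y y1 /\ Y y2
      & exists z w (zx1 : obj_le z x1) (zx2 : obj_le z x2)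
               (y1w : obj_le y1 w) (y2w : obj_le y2 w),
          [/\ X z, Y w
            & comp (cell_eta y1w) (comp f1 (cell_eta zx1)) =
              comp (cell_eta y2w) (comp f2 (cell_eta zx2))]].

Definition completion (cells : set (set (obj T))) (I : ideal C) : ideal C :=
  ideal_gen (fun u v f =>
    exists x y (g : hom C x y), I x y g /\ pequiv cells f g).

Definition virtually_tame (I : ideal C) :=
  forall (cells : set (set (obj T))) (M : {fset obj T}),
    valid_partition cells -> sample cells M ->
    tame (full_subcat (quot_cat (completion cells I)) M).

End Bar.

(* Main.v *)
(** A quotient of a tame category is tame, because a matrix over k[X] that satisfies
    the additional relations for infinitely many values of X satisfies them
    identically.  Hence only the zero relations of (SB1) and (SB2) matter.  They allow
    to give every vertex two slots, each with at most one incoming and one outgoing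
    arrow, the composite of these two being zero; a representation becomes a
    square-zero operator [a] on two copies of its total space, that is, two flags
    given by the image and the kernel of [a] on every space, with isomorphisms between
    some of their subquotients.

    Such a bunch of chains is reduced as follows: by Bruhat decomposition every space
    has a basis adapted to both flags, and the identified subquotients are taken as new
    spaces, with the flags induced from the opposite sides.  Normal forms of the new
    problem lift to the old one.  Each step decreases the dimension or refines the
    decomposition, until all flags are trivial; then only cycles of isomorphisms
    remain, and the Jordan form of their monodromies applies.

    The outcome is a basis in which the arrows have entries p(x), with p in a finite set
    of polynomials depending on the dimension only and x a label of the basis vectors
    that the arrows preserve.  An indecomposable representation has only one label, so
    it belongs to one of finitely many one-parameter families. *)

Require Import Defs.
From HB Require Import structures.
From mathcomp Require Import all_boot all_order all_algebra.

Set Implicit Arguments.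
Unset Strict Implicit.
Unset Printing Implicit Defensive.

Import Order.TTheory GRing.Theory.
Local Open Scope ring_scope.

(** * Triangular supports and Levi parts *)

(** The obstacle is to keep entries polynomial in the labels. A change of basis that is its own
    inverse contains every block together with the inverse block, and inverses of Jordan blocks
    involve inverses of eigenvalues. Therefore one flag of every space is marked by [b], and only
    the marked columns are claimed to be values of the chosen polynomials. Each step needs a new
    marking, compatible with the old one in such a way that pulling back multiplies controlled
    entries only.

    The set of polynomials stays finite because a step pulls back by sums of [n] products of two
    entries, [n] is kept constant, and the number of steps is bounded in terms of [n].

    A step exchanges the roles of the two data: the change of basis, once a permutation, yields the
    new matching, and the old matching, read in the adapted bases, is the new change of basis. A
    solution of the new problem prescribes only diagonal blocks of a change of basis for the old
    one. Lifting works because a triangular matrix with invertible diagonal blocks is invertible. *)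

Section Support.
Variables (k : fieldType) (n : nat).
Implicit Types (r e : rel 'I_n) (A B : 'M[k]_n).

Definition supp r A := forall x y, A x y != 0 -> r x y.
(** For a preorder [r], the block-diagonal part of a matrix supported on [r]. Taking it is
    multiplicative, as for the Levi quotient of a parabolic subgroup. *)
Definition levi r A : 'M[k]_n := \matrix_(x, y) (if r y x then A x y else 0).
Definition sym_part r : rel 'I_n := fun x y => r x y && r y x.

Lemma supp0E r A x y : supp r A -> ~~ r x y -> A x y = 0.
Proof. by move=> rA; case: (eqVneq (A x y) 0) => // /rA ->. Qed.

Lemma sum_neq0 (I : finType) (F : I -> k) :
  \sum_i F i != 0 -> exists i, F i != 0.
Proof.
move=> H; apply/existsP; apply: contraNT H.
by rewrite negb_exists => /forallP F0; rewrite big1 // => i _; apply/eqP; have := F0 i; rewrite negbK.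
Qed.

Lemma mulmx_neq0 p q s (A : 'M[k]_(p, q)) (B : 'M_(q, s)) x y :
  (A *m B) x y != 0 -> exists2 z, A x z != 0 & B z y != 0.
Proof.
rewrite mxE => /sum_neq0[z]; rewrite mulf_eq0 negb_or => /andP[Az Bz].
by exists z.
Qed.

Lemma supp1 r : reflexive r -> supp r 1%:M.
Proof. by move=> rr x y; rewrite mxE; case: (eqVneq x y) => [->|]; rewrite ?eqxx ?rr. Qed.

Lemma suppM r A B : transitive r -> supp r A -> supp r B -> supp r (A *m B).
Proof. by move=> tr rA rB x y /mulmx_neq0[z /rA xz /rB]; apply: tr. Qed.

Lemma suppD r A B : supp r A -> supp r B -> supp r (A + B).
Proof.
move=> rA rB x y; rewrite mxE; have [->|/rA//] := eqVneq (A x y) 0.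
by rewrite add0r => /rB.
Qed.

Lemma suppZ r a A : supp r A -> supp r (a *: A).
Proof. by move=> rA x y; rewrite mxE mulf_eq0 negb_or => /andP[_ /rA]. Qed.

Lemma sub_supp r e A : subrel r e -> supp r A -> supp e A.
Proof. by move=> re rA x y /rA/re. Qed.

Lemma levi_sup r A : supp r A -> supp (sym_part r) (levi r A).
Proof.
by move=> rA x y; rewrite mxE; case: ifP => [ryx /rA rxy|]; rewrite ?eqxx // /sym_part rxy.
Qed.

End Support.

(** Matrices supported on a preorder form an algebra, and by Cayley-Hamilton the inverse is a
    polynomial in the matrix. For singular [A] the default value [invmx A = A] makes the claim
    trivial. *)
Lemma supp_inv (k : fieldType) n (r : rel 'I_n) (A : 'M[k]_n) :
  reflexive r -> transitive r -> supp r A -> supp r (invmx A).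
Proof.
case: n r A => [|n] r A rr tr rA; first by move=> [].
have [uA|nuA] := boolP (A \in unitmx); last by rewrite /invmx (negPf nuA).
have suppP p : supp r (horner_mx A p).
  elim/poly_ind: p => [|p c IHp].
    by rewrite rmorph0 => x y; rewrite mxE eqxx.
  rewrite rmorphD rmorphM /= horner_mx_X horner_mx_C.
  apply: suppD; first exact: suppM.
  by rewrite -scalemx1; apply/suppZ/supp1.
set p := char_poly A; set c := p`_0.
have c0 : c != 0.
  rewrite /c /p char_poly_det mulf_neq0 //; first by rewrite signr_eq0.
  by rewrite -unitfE -unitmxE.
have E : A *m horner_mx A (drop_poly 1 p) = - c%:M.
  apply/eqP; rewrite -subr_eq0 opprK; apply/eqP.
  rewrite -(Cayley_Hamilton A) -/p -[in RHS](poly_take_drop 1 p) rmorphD rmorphM /=.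
  rewrite expr1 horner_mx_X addrC; congr (_ + _).
    by rewrite [take_poly 1 p]size1_polyC ?size_take_poly // horner_mx_C coef_take_poly.
  exact: (comm_mx_horner _ (erefl _)).
have -> : invmx A = (- c^-1) *: horner_mx A (drop_poly 1 p).
  rewrite -[RHS](mulKmx uA) -scalemxAr E scalerN scaleNr opprK.
  by rewrite scale_scalar_mx mulVf // mulmx1.
exact: suppZ.
Qed.

Section Levi.
Variables (k : fieldType) (n : nat) (r : rel 'I_n).
Hypotheses (rr : reflexive r) (tr : transitive r).
Implicit Types (A B : 'M[k]_n).

Lemma sym_part_refl : reflexive (sym_part r).
Proof. by move=> x; rewrite /sym_part rr. Qed.

Lemma sym_part_trans : transitive (sym_part r).
Proof.
move=> y x z /andP[xy yx] /andP[yz zy]; apply/andP.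
by split; [apply: tr yz|apply: tr yx].
Qed.

Lemma leviM A B : supp r A -> supp r B -> levi r (A *m B) = levi r A *m levi r B.
Proof.
move=> rA rB; apply/matrixP => x y; rewrite !mxE; case: ifP => yx.
  apply: eq_bigr => z _; rewrite !mxE.
  have [->|/rA xz] := eqVneq (A x z) 0; first by case: ifP; rewrite !mul0r.
  have [->|/rB zy] := eqVneq (B z y) 0; first by case: ifP; case: ifP; rewrite !mulr0.
  by rewrite (tr zy yx) (tr yx xz).
rewrite big1 // => z _; rewrite !mxE; case: ifP => zx; last by rewrite mul0r.
case: ifP => yz; last by rewrite mulr0.
by rewrite (tr yz zx) in yx.
Qed.

Lemma levi1 : levi r (1%:M : 'M[k]_n) = 1%:M.
Proof.
apply/matrixP => x y; rewrite !mxE; case: (eqVneq x y) => [->|]; first by rewrite rr.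
by case: ifP.
Qed.

Lemma levi_unit A : supp r A -> A \in unitmx -> levi r A \in unitmx.
Proof.
move=> rA uA; apply: (proj1 (mulmx1_unit (B := levi r (invmx A)) _)).
by rewrite -leviM ?mulmxV ?levi1 //; apply: supp_inv.
Qed.

(** Dividing by the diagonal blocks leaves [1 + N] with [N] strictly triangular. A nonzero kernel
    vector is refuted at a nonzero entry whose index has the fewest predecessors. *)
Lemma unit_levi A : supp r A -> levi r A \in unitmx -> A \in unitmx.
Proof.
move=> rA uL; set L := levi r A in uL *.
have sL : supp (sym_part r) (invmx L).
  by apply: supp_inv; [exact: sym_part_refl|exact: sym_part_trans|exact: levi_sup].
rewrite unitmxE unitfE; apply/det0P => -[v v0 vA].
pose N := (A - L) *m invmx L.
have EN : A *m invmx L = 1%:M + N.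
  by rewrite /N mulmxBl mulmxV // addrC subrK.
have sN x y : N x y != 0 -> r x y && ~~ r y x.
  case/mulmx_neq0 => z; rewrite !mxE; case: ifP => [_|zx]; first by rewrite subrr eqxx.
  rewrite subr0 => /rA xz /sL/andP[zy yz]; rewrite (tr xz zy) /=.
  by apply/negP => yx; rewrite (tr zy yx) in zx.
pose h y := #|[pred z | r z y]|.
have hN x y : N x y != 0 -> (h x < h y)%N.
  case/sN/andP=> xy yx; apply: proper_card; apply/properP; split.
    by apply/subsetP => z; rewrite !inE => zx; apply: tr xy.
  by exists y; rewrite !inE.
have [y0 vy0] : exists y, v 0 y != 0.
  apply/existsP; apply: contraNT v0; rewrite negb_exists => /forallP v0.
  by apply/eqP/rowP => y; rewrite mxE; apply/eqP; have := v0 y; rewrite negbK.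
case: (arg_minnP (P := fun y => v 0 y != 0) h vy0) => y vy ymin.
move/negP: vy; apply; apply/eqP.
have : (v *m A *m invmx L) 0 y = 0 by rewrite vA mul0mx mxE.
rewrite -mulmxA EN mulmxDr mulmx1 mxE.
suff -> : (v *m N) 0 y = 0 by rewrite addr0.
apply/eqP; apply/negPn/negP => /mulmx_neq0[x vx /hN].
by rewrite ltnNge ymin.
Qed.

End Levi.

(** * Bruhat decomposition and graded square-zero matrices *)

Lemma col_mulmx (R : comNzRingType) p q s (A : 'M[R]_(p, q)) (B : 'M_(q, s)) j :
  col j (A *m B) = A *m col j B.
Proof. by rewrite !colE mulmxA. Qed.

Section Pivot.
Variables (k : fieldType) (n : nat) (N : 'M[k]_n) (c r : 'I_n).
Hypotheses (rc : r != c) (Nrc : N r c != 0).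

(** The basis change of one elimination step: basis vector [r] is replaced by the image of vector
    [c] under [N], and multiples of vector [c] are subtracted from the others to clear row [r] of
    [N]. It serves involutions and square-zero operators alike. *)
Definition pivot : 'M[k]_n := \matrix_(x, y)
  if y == r then N x c
  else (x == y)%:R - (if (x == c) && (y != c) then N r y / N r c else 0).

Local Notation A := pivot.
Local Notation N' := (invmx A *m N *m A).

Lemma pivot_unit : A \in unitmx.
Proof.
rewrite unitmxE unitfE; apply/det0P => -[v v0 vA].
have E y : \sum_x v 0 x * A x y = 0.
  by have /rowP/(_ y) := vA; rewrite !mxE.
have vc : v 0 c = 0.
  rewrite -(E c) (bigD1 c) //= mxE eq_sym (negPf rc) eqxx /= subr0 mulr1.
  rewrite big1 ?addr0 // => x xc; rewrite mxE eq_sym (negPf rc) (negPf xc) /= subr0 mulr0 //.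
have vy y : y != r -> v 0 y = 0.
  move=> yr; have [->//|yc] := eqVneq y c.
  rewrite -(E y) (bigD1 y) //= mxE (negPf yr) eqxx (negPf yc) /= subr0 mulr1.
  rewrite big1 ?addr0 // => x xy; rewrite mxE (negPf yr) (negPf xy) sub0r.
  by case: eqP => [->|]; rewrite ?vc ?mul0r // oppr0 mulr0.
have vr : v 0 r = 0.
  have := E r; rewrite (bigD1 r) //= mxE eqxx big1 ?addr0 => [/eqP|x xr].
    by rewrite mulf_eq0 (negPf Nrc) orbF => /eqP.
  by rewrite vy ?mul0r.
case/eqP: v0; apply/rowP => y; rewrite mxE.
by have [->|/vy] := eqVneq y r.
Qed.

Lemma pivot_colc : col c A = delta_mx c 0.
Proof.
apply/colP => x; rewrite !mxE eq_sym (negPf rc) eqxx andbF subr0 andbT.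
by [].
Qed.

Lemma pivot_colr : col r A = col c N.
Proof. by apply/colP => x; rewrite !mxE eqxx. Qed.

Lemma pivot_col y : y != r -> y != c -> N r y = 0 -> col y A = delta_mx y 0.
Proof.
move=> yr yc Nry; apply/colP => x; rewrite !mxE (negPf yr) Nry mul0r.
by case: ifP; rewrite subr0 andbT.
Qed.

Lemma pivot_rowr : row r A = N r c *: delta_mx 0 r.
Proof.
apply/rowP => y; rewrite !mxE (negPf rc) /= subr0.
by case: (eqVneq y r) => _ /=; rewrite ?mulr1 ?mulr0 // eq_sym.
Qed.

Lemma pivot_row x : x != c -> N x c = 0 -> row x A = delta_mx 0 x.
Proof.
move=> xc Nxc; apply/rowP => y; rewrite !mxE (negPf xc) Nxc subr0 eqxx /= [in RHS]eq_sym.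
case: (eqVneq y r) => [->|//]; case: (eqVneq x r) => [xr|//].
by case/eqP: Nrc; rewrite -xr.
Qed.

Lemma invA_row x (a : k) : a != 0 -> row x A = a *: delta_mx 0 x ->
  row x (invmx A) = a^-1 *: delta_mx 0 x.
Proof.
move=> a0 rA; rewrite rowE.
have E : (delta_mx 0 x : 'rV[k]_n) = (a^-1 *: delta_mx 0 x) *m A.
  by rewrite -scalemxAl -rowE rA scalerA mulVf // scale1r.
by rewrite {1}E mulmxK // pivot_unit.
Qed.

Lemma invA_col x : col x A = delta_mx x 0 -> col x (invmx A) = delta_mx x 0.
Proof.
by move=> cA; rewrite colE -{1}cA colE mulKmx // pivot_unit.
Qed.

Lemma pivot_conj_colc : col c N' = delta_mx r 0.
Proof.
rewrite colE -mulmxA -colE pivot_colc -mulmxA -colE -pivot_colr colE.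
by rewrite mulKmx // pivot_unit.
Qed.

Lemma pivot_conj_col y : y != r -> y != c -> N r y = 0 ->
  col y N' = invmx A *m col y N.
Proof.
by move=> yr yc Nry; rewrite colE -mulmxA -colE pivot_col // -mulmxA -colE.
Qed.

(** Row [r] was cleared away from [c] and [r], and its entry at [r] is a multiple of [(N *m N) r c].
    This vanishes if [N] squares to 0, and also if it squares to 1, since [r != c]. *)
Lemma pivot_conj_rowr : (N *m N) r c = 0 -> row r N' = delta_mx 0 c.
Proof.
move=> NN; rewrite !row_mul (invA_row Nrc pivot_rowr) -scalemxAl -rowE.
rewrite -scalemxAl; apply/rowP => y; rewrite !mxE eqxx /=.
have [->|yr] := eqVneq y r.
  rewrite (negPf rc); apply/eqP; rewrite mulf_eq0 invr_eq0 (negPf Nrc) /=.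
  rewrite -[X in _ == X]NN mxE; apply/eqP; apply: eq_bigr => x _; rewrite !mxE eqxx //.
rewrite (bigD1 y) //= !mxE (negPf yr) eqxx.
have [yc|yc] := eqVneq y c.
  rewrite andbF subr0 mulr1 yc big1 ?addr0 ?mulVf // => x xc.
  by rewrite !mxE eq_sym (negPf rc) (negPf xc) /= subr0 mulr0.
rewrite /= subr0 mulr1 (bigD1 c) //=; last by rewrite eq_sym.
rewrite !mxE (negPf yr) eqxx eq_sym (negPf yc) /= sub0r mulrN mulrCA mulfV // mulr1.
rewrite addrA subrr add0r big1 ?mulr0 // => x /andP[xy xc].
by rewrite !mxE (negPf yr) (negPf xy) (negPf xc) /= subr0 mulr0.
Qed.

Lemma pivot_conj_row x : x != c -> N x c = 0 -> row x N' = row x N *m A.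
Proof.
move=> xc Nxc; rewrite !row_mul.
rewrite (@invA_row x 1) ?oner_neq0 ?scale1r ?pivot_row //.
by rewrite invr1 scale1r -rowE.
Qed.

End Pivot.

Definition perm_mat (k : fieldType) n (w : 'I_n -> 'I_n) : 'M[k]_n :=
  \matrix_(x, y) (x == w y)%:R.

Section Conj.
Variables (k : fieldType) (n : nat).
Implicit Types A B N : 'M[k]_n.

Definition conj_mx A N := invmx A *m N *m A.

Lemma conj_mxM A B N : A \in unitmx -> B \in unitmx ->
  conj_mx (A *m B) N = conj_mx B (conj_mx A N).
Proof.
move=> uA uB; rewrite /conj_mx; suff -> : invmx (A *m B) = invmx B *m invmx A by rewrite !mulmxA.
have uAB : A *m B \in unitmx by rewrite unitmx_mul uA.
rewrite -[RHS](mulKmx uAB) -[A *m B *m _]mulmxA mulKVmx // mulmxV // mulmx1 //.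
Qed.

Lemma conj_mx1 N : conj_mx 1%:M N = N.
Proof. by rewrite /conj_mx invmx1 mul1mx mulmx1. Qed.

Lemma conj_mx_mul A N N' : A \in unitmx ->
  conj_mx A (N *m N') = conj_mx A N *m conj_mx A N'.
Proof. by move=> uA; rewrite /conj_mx !mulmxA mulmxK. Qed.

Lemma conj_mx_one A : A \in unitmx -> conj_mx A 1%:M = 1%:M.
Proof. by move=> uA; rewrite /conj_mx mulmx1 mulVmx. Qed.

Lemma mul_conj_mx A N : A \in unitmx -> A *m conj_mx A N = N *m A.
Proof. by move=> uA; rewrite /conj_mx !mulmxA mulmxV // mul1mx. Qed.

Lemma conj_mxE A N N' : A \in unitmx -> A *m N' = N *m A -> conj_mx A N = N'.
Proof. by move=> uA E; rewrite /conj_mx -mulmxA -E mulKmx. Qed.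

End Conj.

(** * Bruhat normal form of an involutive change between flags *)

Section Bruhat.
Variables (k : fieldType) (n : nat) (K : eqType).
Variables (kap : 'I_n -> K) (rho : 'I_n -> nat) (th : 'I_n -> 'I_n).
Hypothesis th_kap : forall x y, kap x = kap y -> kap (th x) = kap (th y).
Hypothesis thth : forall x, kap (th (th x)) = kap x.

Definition chain_le : rel 'I_n := fun x y => (kap x == kap y) && (rho x <= rho y)%N.

Lemma chain_le_refl : reflexive chain_le.
Proof. by move=> x; rewrite /chain_le eqxx leqnn. Qed.

Lemma chain_le_trans : transitive chain_le.
Proof.
move=> y x z /andP[/eqP xy xyr] /andP[/eqP yz yzr].
by rewrite /chain_le xy yz eqxx (leq_trans xyr).
Qed.

Definition links (t : 'M[k]_n) := forall x y, t x y != 0 -> kap y = kap (th x).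

Lemma conj_links A t : A \in unitmx -> supp chain_le A -> links t ->
  links (conj_mx A t).
Proof.
move=> uA sA lt x y; rewrite /conj_mx => /mulmx_neq0[z /mulmx_neq0[z' iA tz] /sA/andP[/eqP zy _]].
have /andP[/eqP xz' _] := supp_inv chain_le_refl chain_le_trans sA iA.
by rewrite -zy (lt _ _ tz); apply: th_kap.
Qed.

Let bruhat_inv (t : 'M[k]_n) (P : {set 'I_n}) (w : 'I_n -> 'I_n) :=
  forall x, x \in P -> [/\ w x \in P, w (w x) = x,
     row x t = delta_mx 0 (w x) & col x t = delta_mx (w x) 0].

Lemma bruhat_rec j (t : 'M[k]_n) (P : {set 'I_n}) (w : 'I_n -> 'I_n) :
  (#|~: P| <= j)%N -> t *m t = 1%:M -> links t ->
  (forall x, x \notin P -> kap (th x) <> kap x) -> bruhat_inv t P w ->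
  exists A w', [/\ A \in unitmx, supp chain_le A, involutive w'
                 & conj_mx A t = perm_mat k w'].
Proof.
elim: j t P w => [|j IHj] t P w Pj tt lt live invt.
  have PT x : x \in P.
    by move: Pj; rewrite leqn0 cards_eq0 => /eqP P0; rewrite -[P]setCK P0 setC0 inE.
  exists 1%:M, w; split; [exact: unitmx1|exact/supp1/chain_le_refl|by move=> x; have [] := invt x (PT x)|].
  rewrite conj_mx1; apply/matrixP => x y; have [_ _ _ /colP/(_ x)] := invt y (PT y).
  by rewrite !mxE andbT.
(* [c] is minimal among the unprocessed indices and [r] is maximal in its column:
   this makes the pivot matrix triangular. *)
have [P0|[c0]] := set_0Vmem (~: P).
  by apply: (IHj t P w) => //; rewrite P0 cards0.
rewrite inE => c0P.
case: (arg_minnP (P := fun c => c \notin P) rho c0P) => c cP cmin.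
have [r0 r0c] : exists r, t r c != 0.
  have : (t *m t) c c != 0 by rewrite tt mxE eqxx oner_neq0.
  by case/mulmx_neq0 => r _ rc; exists r.
case: (arg_maxnP (P := fun r => t r c != 0) rho r0c) => r trc rmax.
have rc : r != c.
  by apply/eqP => rc; have := lt _ _ trc; rewrite rc => /esym/(live c cP).
have rP : r \notin P.
  apply/negP => rP; have [wr _ /rowP/(_ c) + _] := invt r rP; rewrite !mxE eqxx /=.
  case: eqP => [cw|_ t0]; last by rewrite t0 eqxx in trc.
  by move=> _; rewrite cw wr in cP.
have tPc x : x \in P -> t x c = 0.
  move=> xP; have [wx _ /rowP/(_ c) + _] := invt x xP; rewrite !mxE eqxx /=.
  by case: eqP => [cw|//]; rewrite cw wx in cP.
have tPr x : x \in P -> t r x = 0.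
  move=> xP; have [wx _ _ /colP/(_ r)] := invt x xP; rewrite !mxE andbT.
  by case: eqP => [cw|//]; rewrite cw wx in rP.
pose A := pivot t c r; pose t' := conj_mx A t.
have uA : A \in unitmx by apply: pivot_unit.
have sA : supp chain_le A.
  move=> x y; rewrite mxE; case: (y =P r) => [->|_] H.
    have xr : (rho x <= rho r)%N by apply: rmax.
    rewrite /chain_le xr andbT -(thth x) -(thth r); apply/eqP.
    by apply: th_kap; rewrite -(lt _ _ H) -(lt _ _ trc).
  have [->|xy] := eqVneq x y; first exact: chain_le_refl.
  move: H; rewrite (negPf xy) sub0r oppr_eq0; case: ifP; last by rewrite eqxx.
  case/andP=> /eqP-> yc; rewrite mulf_eq0 negb_or => /andP[ty _].
  rewrite /chain_le (lt _ _ ty) (lt _ _ trc) eqxx cmin //.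
  by apply: contra ty => /tPr->.
pose w' x := if x == c then r else if x == r then c else w x.
have t't' : t' *m t' = 1%:M by rewrite -conj_mx_mul // tt conj_mx_one.
have colc : col c t' = delta_mx r 0 by apply: pivot_conj_colc.
have rowr : row r t' = delta_mx 0 c.
  by apply: pivot_conj_rowr => //; rewrite tt mxE (negPf rc).
have neqP x : x \in P -> (x != c) && (x != r).
  by move=> xP; apply/andP; split; apply/eqP => xE; rewrite -xE xP in cP rP.
have invt' : bruhat_inv t' (c |: (r |: P)) w'.
  move=> x; rewrite !inE /w' => /or3P[/eqP->|/eqP->|xP].
  - rewrite eqxx (negPf rc) !eqxx orbT; split=> //.
    by rewrite rowE -rowr -row_mul t't' row1.
  - rewrite (negPf rc) !eqxx; split=> //.
    by rewrite colE -colc -col_mulmx t't' (colE _ 1%:M) mul1mx.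
  - have [wP wwx rx cx] := invt x xP.
    have /andP[/negPf xc /negPf xr] := neqP _ xP.
    have /andP[/negPf wc /negPf wr] := neqP _ wP.
    rewrite xc xr wc wr wP !orbT; split=> //.
        have -> : row x t' = row x t *m A by apply: pivot_conj_row => //; [rewrite xc|apply: tPc].
      by rewrite rx -rowE pivot_row // ?wc // tPc.
    have -> : col x t' = invmx A *m col x t by apply: pivot_conj_col => //; [rewrite xr|rewrite xc|apply: tPr].
    by rewrite cx -colE invA_col // pivot_col // ?wc ?wr // tPr.
have [|||B [w'' [uB sB ww'' E]]] := IHj t' (c |: (r |: P)) w' _ t't' _ _ invt'.
- rewrite -ltnS; apply: leq_trans Pj; apply: proper_card; apply/properP; split.
    by apply/subsetP => x; rewrite !inE !negb_or => /and3P[].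
  by exists c; rewrite !inE ?eqxx.
- exact: conj_links.
- by move=> x; rewrite !inE !negb_or => /and3P[_ _ /live].
exists (A *m B), w''; split=> //; first by rewrite unitmx_mul uA.
  exact: suppM chain_le_trans _ _.
by rewrite conj_mxM.
Qed.

(** On the two flags of a space this is the Bruhat decomposition: [w] matches each vector of a basis
    adapted to one flag with the same vector as a member of a basis adapted to the other. The
    recursion starts from the discarded indices, where [t] is already the identity. *)
Lemma bruhat (t : 'M[k]_n) (D : {set 'I_n}) :
  t *m t = 1%:M -> links t ->
  (forall x, x \in D -> kap (th x) <> kap x) ->
  (forall x, x \notin D -> row x t = delta_mx 0 x /\ col x t = delta_mx x 0) ->
  exists A w, [/\ A \in unitmx, supp chain_le A, involutive w,
                 conj_mx A t = perm_mat k w & forall x, kap (w x) = kap (th x)].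
Proof.
move=> tt lt live dead.
have [||A [w [uA sA ww E]]] := @bruhat_rec _ t (~: D) id (leqnn _) tt lt.
- by move=> x; rewrite inE negbK; apply: live.
- by move=> x; rewrite inE => xD; have [rx cx] := dead x xD; split; rewrite ?inE.
exists A, w; split=> // x; have := conj_links uA sA lt; rewrite E; apply.
by rewrite mxE ww eqxx oner_neq0.
Qed.

End Bruhat.

(** * Square-zero operators that match classes with classes *)

Section SquareZero.
Variables (k : fieldType) (n : nat) (K : eqType) (kap : 'I_n -> K).

Definition kap_eq : rel 'I_n := fun x y => kap x == kap y.

Lemma kap_eq_refl : reflexive kap_eq. Proof. by move=> x; apply/eqP. Qed.
Lemma kap_eq_trans : transitive kap_eq.
Proof. by move=> y x z /eqP xy /eqP yz; apply/eqP; rewrite xy. Qed.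

(** Such an operator maps each class into at most one class, and no two classes into the same one.
    Nonzero entries in one row or column therefore have indices in one class, so elimination never
    mixes classes. *)
Definition graded (N : 'M[k]_n) := forall x y x' y',
  N x y != 0 -> N x' y' != 0 -> (kap x == kap x') = (kap y == kap y').

Lemma conj_graded A N : supp kap_eq A -> graded N -> graded (conj_mx A N).
Proof.
move=> sA gN x y x' y'.
have iA := supp_inv kap_eq_refl kap_eq_trans sA.
case/mulmx_neq0 => z /mulmx_neq0[u /iA/eqP-> +] /sA/eqP<-.
move=> Nz /mulmx_neq0[z' /mulmx_neq0[u' /iA/eqP-> Nz'] /sA/eqP<-].
exact: gN.
Qed.

Let sq_inv (N : 'M[k]_n) (P : {set 'I_n}) (m : 'I_n -> 'I_n) (t : pred 'I_n) :=
  forall x, x \in P -> [/\ m x \in P, m (m x) = x, t (m x) = ~~ t x &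
     if t x then row x N = 0 /\ col x N = delta_mx (m x) 0
     else row x N = delta_mx 0 (m x) /\ col x N = 0].

Lemma square_zero_rec j (N : 'M[k]_n) (P : {set 'I_n}) m (t : pred 'I_n) :
  (#|~: P| <= j)%N -> N *m N = 0 -> graded N -> sq_inv N P m t ->
  exists A (m' : 'I_n -> 'I_n) (t' : pred 'I_n),
    [/\ A \in unitmx, supp kap_eq A, involutive m',
        forall x, m' x != x -> t' (m' x) = ~~ t' x &
        conj_mx A N = \matrix_(x, y) ((m' y != y) && t' y && (x == m' y))%:R].
Proof.
elim: j N P m t => [|j IHj] N P m t Pj NN gN invN.
  have PT x : x \in P.
    by move: Pj; rewrite leqn0 cards_eq0 => /eqP P0; rewrite -[P]setCK P0 setC0 inE.
  exists 1%:M, m, t; split; [exact: unitmx1|exact/supp1/kap_eq_refl| | |].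
  - by move=> x; have [] := invN x (PT x).
  - by move=> x; have [] := invN x (PT x).
  rewrite conj_mx1; apply/matrixP => x y; rewrite mxE; have [_ _ tm] := invN y (PT y).
  have -> : m y != y by apply/eqP => E; move: tm; rewrite E; case: (t y).
  by case: ifP => ty [_ /colP/(_ x)]; rewrite !mxE ?andbT.
have [/existsP[c /existsP[r0 /and3P[cP r0P Nr0]]]|none] :=
  boolP [exists c, exists r, [&& c \notin P, r \notin P & N r c != 0]]; last first.
  (* No entry is left among the unprocessed vectors: they represent the homology and become fixed
     points of the matching. *)
  pose m' x := if x \in P then m x else x.
  exists 1%:M, m', t; split; [exact: unitmx1|exact/supp1/kap_eq_refl| | |].
  - move=> x; rewrite /m'; case: (boolP (x \in P)) => [xP|/negPf->//].
    by have [-> ->] := invN x xP.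
  - move=> x; rewrite /m'; case: ifP => [xP _|]; last by rewrite eqxx.
    by have [] := invN x xP.
  rewrite conj_mx1; apply/matrixP => x y; rewrite mxE /m'; case: ifP => yP.
    have [_ _ tm] := invN y yP.
    have -> : m y != y by apply/eqP => E; move: tm; rewrite E; case: (t y).
    by case: ifP => ty [_ /colP/(_ x)]; rewrite !mxE ?andbT.
  rewrite eqxx /=; have [xP|xP] := boolP (x \in P).
    have [mP _ _] := invN x xP; case: ifP => _ [/rowP/(_ y) + _]; rewrite !mxE ?eqxx //=.
    by case: (y =P m x) => [yE|//]; rewrite -yE yP in mP.
  move: none; rewrite negb_exists => /forallP/(_ y); rewrite negb_exists => /forallP/(_ x).
  by rewrite xP yP /= negbK => /eqP.
(* The pivot must lie off the diagonal. If [N c c] is nonzero, then [(N *m N) c c = 0] forces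
   another nonzero entry in column [c]. *)
have [r rc Nrc] : exists2 r, r != c & N r c != 0.
  have [r0c|] := eqVneq r0 c; last by exists r0.
  rewrite r0c in Nr0; have [/existsP[r /andP[]]|nex] := boolP [exists r, (r != c) && (N r c != 0)].
    by exists r.
  have /matrixP/(_ c c) := NN; rewrite !mxE (bigD1 c) //= big1 => [/eqP|x xc].
    by rewrite addr0 mulf_eq0 orbb (negPf Nr0).
  move: nex; rewrite negb_exists => /forallP/(_ x); rewrite xc /= negbK => /eqP->.
  by rewrite mulr0.
have NPc x : x \in P -> N x c = 0.
  move=> xP; have [mP _ _] := invN x xP; case: ifP => _ [/rowP/(_ c) + _]; rewrite !mxE // eqxx /=.
  by case: eqP => [cE|//]; rewrite cE mP in cP.
have rP : r \notin P by apply/negP => /NPc E; rewrite E eqxx in Nrc.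
have NPr x : x \in P -> N r x = 0.
  move=> xP; have [mP _ _] := invN x xP; case: ifP => _ [_ /colP/(_ r)]; rewrite !mxE // andbT.
  by case: eqP => [cE|//]; rewrite cE mP in rP.
pose A := pivot N c r; pose N' := conj_mx A N.
have uA : A \in unitmx by apply: pivot_unit.
have sA : supp kap_eq A.
  move=> x y; rewrite mxE; case: (y =P r) => [->|_] H.
    by rewrite /kap_eq (gN _ _ _ _ H Nrc).
  have [->|xy] := eqVneq x y; first exact: kap_eq_refl.
  move: H; rewrite (negPf xy) sub0r oppr_eq0; case: ifP; last by rewrite eqxx.
  case/andP=> /eqP-> yc; rewrite mulf_eq0 negb_or => /andP[ty _].
  by rewrite /kap_eq -(gN _ _ _ _ Nrc ty).
pose m' x := if x == c then r else if x == r then c else m x.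
pose t' x := if x == c then true else if x == r then false else t x.
have N'N' : N' *m N' = 0 by rewrite -conj_mx_mul // NN /conj_mx mulmx0 mul0mx.
have colc : col c N' = delta_mx r 0 by apply: pivot_conj_colc.
have rowr : row r N' = delta_mx 0 c by apply: pivot_conj_rowr; rewrite // NN mxE.
have neqP x : x \in P -> (x != c) && (x != r).
  by move=> xP; apply/andP; split; apply/eqP => xE; rewrite -xE xP in cP rP.
have invN' : sq_inv N' (c |: (r |: P)) m' t'.
  move=> x; rewrite !inE /m' /t' => /or3P[/eqP->|/eqP->|xP].
  - rewrite eqxx (negPf rc) !eqxx orbT; split=> //; split=> //.
    by rewrite rowE -rowr -row_mul N'N' row0.
  - rewrite (negPf rc) !eqxx; split=> //; split=> //.
    by rewrite colE -colc -col_mulmx N'N' (colE _ 0) mul0mx.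
  - have [mP mmx tm NE] := invN x xP.
    have /andP[/negPf xc /negPf xr] := neqP _ xP.
    have /andP[/negPf wc /negPf wr] := neqP _ mP.
    rewrite xc xr wc wr mP !orbT; split=> //.
    have rN : row x N' = row x N *m A by apply: pivot_conj_row => //; [rewrite xc|apply: NPc].
    have cN : col x N' = invmx A *m col x N by apply: pivot_conj_col => //; [rewrite xr|rewrite xc|apply: NPr].
    rewrite rN cN; case: ifP NE => _ [-> ->]; rewrite ?mul0mx ?mulmx0; split=> //.
      by rewrite -colE invA_col // pivot_col // ?wc ?wr // NPr.
    by rewrite -rowE pivot_row // ?wc // NPc.
have [||B [m'' [t'' [uB sB mm'' tt'' E]]]] := IHj N' (c |: (r |: P)) m' t' _ N'N' _ invN'.
- rewrite -ltnS; apply: leq_trans Pj; apply: proper_card; apply/properP; split.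
    by apply/subsetP => x; rewrite !inE !negb_or => /and3P[].
  by exists c; rewrite !inE ?eqxx.
- exact: conj_graded.
exists (A *m B), m'', t''; split=> //; first by rewrite unitmx_mul uA.
  exact: suppM kap_eq_trans _ _.
by rewrite conj_mxM.
Qed.

Lemma square_zero (N : 'M[k]_n) : N *m N = 0 -> graded N ->
  exists A (m : 'I_n -> 'I_n) (t : pred 'I_n),
    [/\ A \in unitmx, supp kap_eq A, involutive m,
        forall x, m x != x -> t (m x) = ~~ t x &
        conj_mx A N = \matrix_(x, y) ((m y != y) && t y && (x == m y))%:R].
Proof.
move=> NN gN; apply: (@square_zero_rec _ N set0 id xpred0 (leqnn _) NN gN).
by move=> x; rewrite inE.
Qed.

End SquareZero.

(** * Bunches of chains and their reduction *)

Definition piece n (K : eqType) (kap : 'I_n -> K) (rho : 'I_n -> nat) : rel 'I_n :=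
  fun x y => (kap x == kap y) && (rho x == rho y).

Section Piece.
Variables (k : fieldType) (n : nat) (K : eqType) (kap : 'I_n -> K) (rho : 'I_n -> nat).
Local Notation pc := (piece kap rho).
Local Notation le := (chain_le kap rho).

Lemma pieceP x y : reflect (kap x = kap y /\ rho x = rho y) (pc x y).
Proof. by apply: (iffP andP) => -[/eqP ? /eqP ?]. Qed.

Lemma piece_refl x : pc x x. Proof. exact/pieceP. Qed.
Lemma piece_sym x y : pc x y = pc y x.
Proof. by rewrite /piece eq_sym [X in _ && X]eq_sym. Qed.
Lemma piece_trans : transitive pc.
Proof. by move=> y x z /pieceP[xy xy'] /pieceP[yz yz']; apply/pieceP; rewrite xy xy'. Qed.

Lemma sym_part_chain x y : sym_part le x y = pc x y.
Proof.
rewrite /sym_part /chain_le /piece eqn_leq (eq_sym (kap y)).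
by case: eqP => //=.
Qed.

Lemma levi_chainE (A : 'M[k]_n) x y : supp le A ->
  levi le A x y = if pc x y then A x y else 0.
Proof.
move=> sA; rewrite mxE -sym_part_chain /sym_part.
by have [->|/sA->//] := eqVneq (A x y) 0; rewrite !if_same.
Qed.

End Piece.

Section PermMat.
Variables (k : fieldType) (n : nat) (w : 'I_n -> 'I_n).
Hypothesis ww : involutive w.

Lemma mul_perm_mat (A : 'M[k]_n) x y : (A *m perm_mat k w) x y = A x (w y).
Proof.
rewrite mxE (bigD1 (w y)) //= mxE eqxx mulr1 big1 ?addr0 // => z zy.
by rewrite mxE (negPf zy) mulr0.
Qed.

Lemma perm_mat_mul (A : 'M[k]_n) x y : (perm_mat k w *m A) x y = A (w x) y.
Proof.
rewrite mxE (bigD1 (w x)) //= mxE ww eqxx mul1r big1 ?addr0 // => z zy.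
by rewrite mxE -[x]ww (inj_eq (can_inj ww)) eq_sym (negPf zy) mul0r.
Qed.

Lemma perm_mat_sq : perm_mat k w *m perm_mat k w = 1%:M.
Proof. by apply/matrixP => x y; rewrite perm_mat_mul !mxE (inj_eq (can_inj ww)). Qed.

End PermMat.

(* A bunch of chains: spaces carrying two flags each, with isomorphisms between
   some subquotients.  The indices are the vectors of two bases of every space,
   one adapted to each flag: [kap] gives the flag, [rho] the position in it,
   [th] exchanges the two flags of a space, and [t] is the change of basis in both
   directions.  [m] matches the basis vectors of identified subquotients (its
   fixed points are unmatched) and [b] distinguishes the two flags of a space.
   Indices outside [D] are discarded; they remain only to keep [n] constant. *)
Record problem (k : fieldType) n (K : eqType) (kap : 'I_n -> K) (rho : 'I_n -> nat)
    (m th : 'I_n -> 'I_n) (D : {set 'I_n}) (t : 'M[k]_n) (b : 'I_n -> bool) : Prop := Problem {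
  pb_mK : involutive m;
  pb_mpc : forall x y, piece kap rho x y -> piece kap rho (m x) (m y);
  pb_mfree : forall x, m x != x -> ~~ piece kap rho x (m x);
  pb_mdead : forall x, x \notin D -> m x = x;
  pb_thkap : forall x y, kap x = kap y -> kap (th x) = kap (th y);
  pb_thth : forall x, kap (th (th x)) = kap x;
  pb_thdead : forall x, x \notin D -> kap (th x) = kap x;
  pb_bth : forall x, x \in D -> b (th x) = ~~ b x;
  pb_bkap : forall x y, kap x = kap y -> b x = b y;
  pb_dead : forall x y, x \notin D -> kap x = kap y -> x = y;
  pb_tt : t *m t = 1%:M;
  pb_links : links kap th t;
  pb_t1 : forall x, x \notin D -> t x x = 1 }.

Section ProblemTheory.
Variables (k : fieldType) (n : nat) (K : eqType) (kap : 'I_n -> K) (rho : 'I_n -> nat).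
Variables (m th : 'I_n -> 'I_n) (D : {set 'I_n}) (t : 'M[k]_n) (b : 'I_n -> bool).
Hypothesis Hp : problem kap rho m th D t b.
Local Notation le := (chain_le kap rho).

Lemma pb_live x : x \in D -> kap (th x) <> kap x.
Proof. by move=> xD /(pb_bkap Hp); rewrite (pb_bth Hp) //; case: (b x). Qed.

Lemma pb_D x y : kap x = kap y -> (x \in D) = (y \in D).
Proof.
move=> xy; apply/idP/idP => [xD|yD]; apply: contraT => nD.
  by have yx := pb_dead Hp nD (esym xy); rewrite yx xD in nD.
by have yx := pb_dead Hp nD xy; rewrite yx yD in nD.
Qed.

Lemma links_dead (u : 'M[k]_n) x y : links kap th u -> x \notin D -> u x y != 0 -> x = y.
Proof. by move=> lu xD /lu E; apply: (pb_dead Hp) => //; rewrite E (pb_thdead Hp). Qed.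

Lemma links_dead_col (u : 'M[k]_n) x y : links kap th u -> x \notin D -> u y x != 0 -> x = y.
Proof.
move=> lu xD /lu E; apply: (pb_dead Hp) => //.
by rewrite -(pb_thth Hp y) -(pb_thdead Hp xD); apply: (pb_thkap Hp).
Qed.

Lemma pb_dead_row x y : x \notin D -> t x y = (x == y)%:R.
Proof.
move=> xD; have [<-|xy] := eqVneq x y; first exact: (pb_t1 Hp).
apply/eqP/negPn/negP => /(links_dead (pb_links Hp) xD) E; by rewrite E eqxx in xy.
Qed.

Lemma pb_dead_rowcol x : x \notin D -> row x t = delta_mx 0 x /\ col x t = delta_mx x 0.
Proof.
move=> xD; split; first by apply/rowP => y; rewrite !mxE pb_dead_row // eqxx eq_sym.
apply/colP => y; rewrite !mxE andbT; have [->|xy] := eqVneq y x; first by rewrite (pb_t1 Hp).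
apply/eqP/negPn/negP => /(links_dead_col (pb_links Hp) xD) E; by rewrite E eqxx in xy.
Qed.

Lemma supp_dead (A : 'M[k]_n) x y : supp le A -> x \notin D -> A x y != 0 -> x = y.
Proof. by move=> sA xD /sA/andP[/eqP E _]; apply: (pb_dead Hp). Qed.

Lemma unit_dead (A : 'M[k]_n) x : supp le A -> A \in unitmx -> x \notin D -> A x x != 0.
Proof.
move=> sA uA xD; apply/eqP => A0.
have : (A *m invmx A) x x != 0 by rewrite mulmxV // mxE eqxx oner_neq0.
case/mulmx_neq0 => z Axz; move: (Axz); rewrite -(supp_dead sA xD Axz) A0 eqxx.
by [].
Qed.

Lemma conj_dead A x y : A \in unitmx -> supp le A -> x \notin D ->
  conj_mx A t x y = (x == y)%:R.
Proof.
move=> uA sA xD; have lc := conj_links (pb_thkap Hp) uA sA (pb_links Hp).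
have [<-|xy] := eqVneq x y; last first.
  by apply/eqP/negPn/negP => /(links_dead lc xD) E; rewrite E eqxx in xy.
have E1 : (A *m conj_mx A t) x x = A x x * conj_mx A t x x.
  rewrite mxE (bigD1 x) //= big1 ?addr0 // => z zx.
  have [->|/(supp_dead sA xD) E] := eqVneq (A x z) 0; first by rewrite mul0r.
  by rewrite E eqxx in zx.
have E2 : (t *m A) x x = A x x.
  rewrite mxE (bigD1 x) //= big1 ?addr0 ?(pb_t1 Hp) ?mul1r // => z zx.
  by rewrite pb_dead_row // eq_sym (negPf zx) mul0r.
by apply: (mulfI (unit_dead sA uA xD)); rewrite mulr1 -E1 mul_conj_mx.
Qed.

End ProblemTheory.

(** * One reduction step and the lifting of its solutions *)

Section Step.
Variables (k : fieldType) (n : nat) (K : eqType) (kap : 'I_n -> K) (rho : 'I_n -> nat).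
Variables (m th : 'I_n -> 'I_n) (D : {set 'I_n}) (t : 'M[k]_n) (b : 'I_n -> bool).
Hypothesis Hp : problem kap rho m th D t b.
Variables (A0 : 'M[k]_n) (w : 'I_n -> 'I_n).
Hypotheses (uA0 : A0 \in unitmx) (sA0 : supp (chain_le kap rho) A0).
Hypotheses (ww : involutive w) (E0 : conj_mx A0 t = perm_mat k w).
Hypothesis wth : forall x, kap (w x) = kap (th x).
Variable b' : 'I_n -> bool.
Hypothesis b'pc : forall x y, piece kap rho x y -> b' x = b' y.
Hypothesis b'm : forall x, m x != x -> b' (m x) = ~~ b' x.

Local Notation le := (chain_le kap rho).
Local Notation pc := (piece kap rho).

(* The matched subquotients are the new spaces; the two flags of such a space are
   induced by the flags opposite to the two identified subquotients. *)
Definition step_D : {set 'I_n} := [set x | m x != x].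
Definition step_kap (x : 'I_n) : (K * nat + 'I_n)%type :=
  if x \in step_D then inl (kap x, rho x) else inr x.
Definition step_rho (x : 'I_n) : nat := rho (w x).
(** A vector that survives in matched subquotients of both flags occurs in two of the new spaces.
    The new matching identifies these two occurrences. *)
Definition step_m (x : 'I_n) : 'I_n :=
  if (x \in step_D) && (w x \in step_D) then w x else x.
(** The old matching read in the new bases: a triangular matrix acts on subquotients through its
    diagonal blocks, hence the Levi part. *)
Definition step_t : 'M[k]_n := conj_mx (levi le A0) (perm_mat k m).

Local Notation D' := step_D.
Local Notation le' := (chain_le step_kap step_rho).
Local Notation pc' := (piece step_kap step_rho).

Let le_refl := chain_le_refl kap rho.
Let le_trans := @chain_le_trans n K kap rho.
Let le'_refl := chain_le_refl step_kap step_rho.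
Let le'_trans := @chain_le_trans n _ step_kap step_rho.

Lemma wkap x y : kap x = kap y -> kap (w x) = kap (w y).
Proof. by move=> xy; rewrite !wth; apply: (pb_thkap Hp). Qed.

Lemma step_D_pc x y : pc x y -> (x \in D') = (y \in D').
Proof.
have aux u v : pc u v -> u \in D' -> v \in D'.
  rewrite !inE => uv mu; apply: contraNneq (pb_mfree Hp mu) => mv.
  by have := pb_mpc Hp uv; rewrite mv piece_sym; apply: piece_trans uv.
by move=> xy; apply/idP/idP; apply: aux => //; rewrite piece_sym.
Qed.

Lemma step_D_m x : (m x \in D') = (x \in D').
Proof. by rewrite !inE (pb_mK Hp) eq_sym. Qed.

Lemma step_m_id x : x \notin D' -> m x = x.
Proof. by rewrite inE negbK => /eqP. Qed.

Lemma step_D_sub x : x \in D' -> x \in D.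
Proof. by rewrite inE; apply: contraR => /(pb_mdead Hp)->. Qed.

Lemma step_kapP x y : step_kap x = step_kap y ->
  (x \in D') = (y \in D') /\ if x \in D' then pc x y else x == y.
Proof.
rewrite /step_kap; case: ifP => xD; case: ifP => yD //.
  by move=> [xy xy']; split=> //; apply/pieceP.
by move=> [->].
Qed.

Lemma step_kap_pc x y : step_kap x = step_kap y -> pc x y.
Proof. by case/step_kapP => _; case: ifP => // _ /eqP->; apply: piece_refl. Qed.

Lemma pc_step_kap x y : x \in D' -> pc x y -> step_kap x = step_kap y.
Proof.
move=> xD xy; rewrite /step_kap xD -(step_D_pc xy) xD.
by have /pieceP[-> ->] := xy.
Qed.

Lemma L0_pc x y : levi le A0 x y != 0 -> pc x y.
Proof. by rewrite levi_chainE //; case: ifP; rewrite ?eqxx. Qed.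

Lemma uL0 : levi le A0 \in unitmx.
Proof. exact: levi_unit. Qed.

Lemma iL0_pc x y : invmx (levi le A0) x y != 0 -> pc x y.
Proof.
apply: supp_inv => [z|z u v|]; first exact: piece_refl.
  exact: piece_trans.
by move=> z u; apply: L0_pc.
Qed.

Lemma step_t_dead x y : x \notin D' -> step_t x y = (x == y)%:R.
Proof.
move=> xD; have <- : (invmx (levi le A0) *m levi le A0) x y = (x == y)%:R.
  by rewrite mulVmx ?uL0 // mxE.
rewrite /step_t /conj_mx [LHS]mxE [RHS]mxE; apply: eq_bigr => z _; congr (_ * _).
rewrite mul_perm_mat; have [zD|zD] := boolP (z \in D'); last by rewrite step_m_id.
have mz u : u \in D' -> invmx (levi le A0) x u = 0.
  by move=> uD; apply/eqP/negPn/negP => /iL0_pc/step_D_pc; rewrite (negPf xD) uD.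
by rewrite !mz // step_D_m.
Qed.

Lemma step_problem : problem step_kap step_rho step_m m D' step_t b'.
Proof.
split.
- move=> x; rewrite {2}/step_m; case: ifP => [/andP[xD wD]|E].
    by rewrite /step_m ww wD xD.
  by rewrite /step_m E.
- move=> x y /pieceP[/step_kapP[xyD xy] rxy].
  have [xD|xD] := boolP (x \in D'); last first.
    by move: xy; rewrite (negPf xD) => /eqP->; apply: piece_refl.
  rewrite xD in xy; have pw : pc (w x) (w y).
    by have /pieceP[/wkap kxy _] := xy; apply/pieceP.
  rewrite /step_m -xyD -(step_D_pc pw) xD /=.
  case: ifP => wD; apply/pieceP; split; rewrite ?(pc_step_kap _ xy) ?(pc_step_kap _ pw) //.
  by rewrite /step_rho !ww; have /pieceP[] := xy.
- move=> x; rewrite /step_m; case: ifP => [/andP[xD wD]|]; last by rewrite eqxx.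
  move=> _; apply/pieceP => -[/step_kap_pc/pieceP[E _] _].
  by apply: (pb_live Hp (step_D_sub xD)); rewrite -wth.
- by move=> x xD; rewrite /step_m (negPf xD).
- move=> x y /step_kapP[xyD]; have [xD|xD] := boolP (x \in D'); last by move=> /eqP->.
  by move=> xy; apply: pc_step_kap; rewrite ?step_D_m // (pb_mpc Hp).
- by move=> x; rewrite (pb_mK Hp).
- by move=> x /step_m_id->.
- by move=> x; rewrite inE => /b'm.
- by move=> x y /step_kap_pc/b'pc.
- by move=> x y xD /step_kapP[_]; rewrite (negPf xD) => /eqP.
- by rewrite -conj_mx_mul ?uL0 // perm_mat_sq ?conj_mx_one ?uL0 //; apply: (pb_mK Hp).
- move=> x y; have [xD|xD] := boolP (x \in D'); last first.
    rewrite step_t_dead // step_m_id //.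
    by have [->|] := eqVneq x y; rewrite ?eqxx.
  case/mulmx_neq0 => u /mulmx_neq0[z /iL0_pc xz]; rewrite mxE.
  case: (z =P m u) => [zu _ /L0_pc uy|_]; last by rewrite eqxx.
  apply/esym/pc_step_kap; first by rewrite step_D_m.
  apply: piece_trans uy; rewrite -[u](pb_mK Hp) -zu.
  exact: (pb_mpc Hp).
- by move=> x xD; rewrite step_t_dead // eqxx.
Qed.

Section Lift.
Variable A' : 'M[k]_n.
Hypotheses (uA' : A' \in unitmx) (sA' : supp le' A').
Hypothesis mA' : forall x y, pc' x y -> A' (step_m x) (step_m y) = A' x y.

(* [A'] prescribes the diagonal blocks for both flags; the two prescriptions agree
   on common entries because [A'] is compatible with [step_m]. *)
Let lift : 'M[k]_n := \matrix_(x, y)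
  if pc x y && (x \in D') then A' x y
  else if pc (w x) (w y) && (w x \in D') then A' (w x) (w y) else (x == y)%:R.

Let A'le x y : A' x y != 0 -> pc x y /\ (rho (w x) <= rho (w y))%N.
Proof. by move=> /sA'/andP[/eqP/step_kap_pc]. Qed.

Let pc'E x y : x \in D' -> pc' x y = pc x y && pc (w x) (w y).
Proof.
move=> xD; apply/pieceP/andP => [[/step_kap_pc xy rw]|[xy pw]].
  by split=> //; have /pieceP[/wkap kxy _] := xy; apply/pieceP.
by split; [apply: pc_step_kap|have /pieceP[]:= pw].
Qed.

Let lift_w x y : lift (w x) (w y) = lift x y.
Proof.
rewrite !mxE !ww (inj_eq (can_inj ww)).
case: ifP => [/andP[pw wD]|_]; case: ifP => // /andP[xy xD].
rewrite -mA' ?pc'E ?ww ?xy ?pw //.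
rewrite /step_m !ww wD xD /=.
by rewrite -(step_D_pc pw) wD -(step_D_pc xy) xD.
Qed.

(** Triangularity for both flags at once. The diagonal blocks of [lift] for this finer preorder come
    from those of [A'] alone, so [unit_levi] applies to it. *)
Let le2 : rel 'I_n := fun x y => le x y && le (w x) (w y).

Let lift_le2 : supp le2 lift.
Proof.
have pcle x y : pc x y -> le x y by rewrite -sym_part_chain => /andP[].
have wk x y : kap x = kap y -> kap (w x) == kap (w y) by move/wkap->.
move=> x y; rewrite mxE; case: ifP => [/andP[xy xD] /A'le[_ rxy]|_].
  by rewrite /le2 pcle //= /chain_le rxy andbT wk //; have /pieceP[] := xy.
case: ifP => [/andP[xy xD] /A'le[_]|_].
  rewrite !ww /le2 (pcle (w x)) // andbT /chain_le => ->.
  by have /pieceP[/wkap + _] := xy; rewrite !ww => ->; rewrite eqxx.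
by case: (eqVneq x y) => [->|]; rewrite ?eqxx // /le2 !le_refl.
Qed.

Let le2_refl : reflexive le2.
Proof. by move=> x; rewrite /le2 !le_refl. Qed.

Let le2_trans : transitive le2.
Proof.
by move=> y x z /andP[xy xy'] /andP[/(le_trans xy) xz /(le_trans xy') xz']; apply/andP.
Qed.

(** Carries block matrices of the new spaces to the old ones: an index outside [D'] is read through
    its opposite [w x], and is fixed if that is outside too. It is multiplicative on block-diagonal
    matrices, so it preserves invertibility. *)
Let F (L : 'M[k]_n) : 'M[k]_n := \matrix_(x, y)
  if x \in D' then L x y else if w x \in D' then L (w x) (w y) else (x == y)%:R.

Let F_mul (L L' : 'M[k]_n) : supp pc' L -> F L *m F L' = F (L *m L').
Proof.
move=> sL; apply/matrixP => x y; rewrite mxE [RHS]mxE.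
case: ifP => xD.
  rewrite mxE; apply: eq_bigr => z _; rewrite !mxE xD.
  have [->|/sL/pieceP[/step_kapP[+ _] _]] := eqVneq (L x z) 0; first by rewrite !mul0r.
  by rewrite xD => <-.
case: ifP => wD.
  rewrite mxE (reindex_inj (can_inj ww)) /=; apply: eq_bigr => z _; rewrite !mxE xD wD ww.
  have [->|/sL] := eqVneq (L (w x) z) 0; first by rewrite !mul0r.
  rewrite pc'E // ww => /andP[/step_D_pc + /step_D_pc].
  by rewrite xD wD => <- <-.
rewrite (bigD1 x) //= big1 ?addr0 => [|z zx]; first by rewrite !mxE xD wD eqxx mul1r.
by rewrite !mxE xD wD eq_sym (negPf zx) mul0r.
Qed.

Let levi_lift : levi le2 lift = F (levi le' A').
Proof.
apply/matrixP => x y; have [E|nz] := eqVneq (lift x y) 0.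
  rewrite mxE E if_same mxE; apply/esym; move: E; rewrite mxE !levi_chainE //.
  case: (boolP (x \in D')) => xD.
    by rewrite andbT pc'E //; case: ifP => //= _ ->; rewrite if_same.
  rewrite andbF; case: (boolP (w x \in D')) => wD; last by rewrite andbF.
  by rewrite andbT pc'E // ww; case: ifP => //= _ ->; rewrite if_same.
have l2 := lift_le2 nz; rewrite [LHS]mxE.
have -> : le2 y x = pc x y && pc (w x) (w y).
  rewrite -!sym_part_chain /sym_part /le2.
  by have /andP[-> ->] := l2.
rewrite [F _ _ _]mxE !levi_chainE //; case: ifP => [/andP[xy wxy]|Epc].
  rewrite mxE xy wxy /=; case: (boolP (x \in D')) => xD; first by rewrite pc'E // xy wxy.
  by case: (boolP (w x \in D')) => // wD; rewrite pc'E // !ww xy wxy.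
case: (boolP (x \in D')) => xD; first by rewrite pc'E // Epc.
case: (boolP (w x \in D')) => wD; first by rewrite pc'E // !ww andbC Epc.
by case: (eqVneq x y) Epc => // ->; rewrite !piece_refl.
Qed.

Let lift_unit : lift \in unitmx.
Proof.
apply: (unit_levi le2_refl le2_trans lift_le2); rewrite levi_lift.
apply: (proj1 (mulmx1_unit (B := F (levi le' (invmx A'))) _)).
rewrite F_mul; last first.
  by move=> x y; rewrite levi_chainE //; case: ifP; rewrite ?eqxx.
rewrite -leviM //; last exact: supp_inv.
rewrite mulmxV // levi1 //; apply/matrixP => x y; rewrite !mxE (inj_eq (can_inj ww)).
by rewrite !if_same.
Qed.

Let lift_le : supp le lift.
Proof. by apply: sub_supp lift_le2 => x y /andP[]. Qed.

(** The factor [lift] commutes with [w], so it preserves the normal form of [t]. Its diagonal blocks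
    on the matched pieces are those of [A'], so it conjugates the matching as [A'] does. *)
Lemma step_lift : exists A, [/\ A \in unitmx, supp le A, conj_mx A t = perm_mat k w
  & conj_mx (levi le A) (perm_mat k m) = conj_mx A' step_t].
Proof.
exists (A0 *m lift); split; first by rewrite unitmx_mul uA0 lift_unit.
- exact: suppM.
- rewrite conj_mxM ?lift_unit // E0; apply: conj_mxE; first exact: lift_unit.
  apply/matrixP => x y; rewrite mul_perm_mat perm_mat_mul //.
  by rewrite -[in RHS](ww y) lift_w.
rewrite leviM // conj_mxM ?uL0 //; last exact: levi_unit lift_unit.
rewrite -/step_t; apply: conj_mxE; first exact: levi_unit lift_unit.
set L := levi le lift; set t'' := conj_mx A' step_t.
have Hp' := step_problem.
have LD x y : x \in D' -> L x y = A' x y.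
  move=> xD; rewrite levi_chainE // mxE xD andbT; case: ifP => [->//|npc].
  by apply/esym/eqP; apply: (contraFT _ npc) => /A'le[].
apply/matrixP => x y; have [xD|xD] := boolP (x \in D').
  have /matrixP/(_ x y) := mul_conj_mx step_t uA'; rewrite !mxE => E.
  transitivity (\sum_j A' x j * conj_mx A' step_t j y).
    by apply: eq_bigr => z _; rewrite LD.
  rewrite E; apply: eq_bigr => z _; have [->|/(pb_links Hp')] := eqVneq (step_t x z) 0.
    by rewrite !mul0r.
  by case/step_kapP => zD _; rewrite LD // zD step_D_m.
transitivity (L x y).
  rewrite mxE (bigD1 y) //= big1 ?addr0 => [|z zy].
    have [->|] := eqVneq (L x y) 0; first by rewrite mul0r.
    rewrite levi_chainE //; case: ifP => [xy _|]; last by rewrite eqxx.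
    by rewrite (conj_dead Hp') // ?eqxx ?mulr1 // -(step_D_pc xy).
  have [->|] := eqVneq (L x z) 0; first by rewrite mul0r.
  rewrite levi_chainE //; case: ifP => [xz _|]; last by rewrite eqxx.
  by rewrite (conj_dead Hp') // -?(step_D_pc xz) // (negPf zy) mulr0.
rewrite [RHS]mxE (bigD1 x) //= big1 ?addr0 => [|z zx].
  by rewrite step_t_dead // eqxx mul1r.
by rewrite step_t_dead // eq_sym (negPf zx) mul0r.
Qed.

End Lift.

End Step.

(* Only the columns with [b y] are controlled: as [t] is its own inverse, the others
   contain inverses of these blocks, which need not be polynomial in the labels. *)
Definition nice (k : fieldType) n (S : seq {poly k}) (K : eqType) (kap : 'I_n -> K)
    (rho : 'I_n -> nat) (m : 'I_n -> 'I_n) (D : {set 'I_n}) (t : 'M[k]_n) (b : 'I_n -> bool) :=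
  exists (A : 'M[k]_n) (l : 'I_n -> k),
    [/\ A \in unitmx, supp (chain_le kap rho) A,
        forall x y, piece kap rho x y -> A (m x) (m y) = A x y &
    [/\ forall x y, conj_mx A t x y != 0 -> l x = l y,
        forall x, l (m x) = l x &
        forall x y, y \in D -> b y -> exists2 p, p \in S & conj_mx A t x y = p.[l y]]].

Definition sumprod_closed (k : fieldType) n (S S' : seq {poly k}) :=
  forall f g : 'I_n -> {poly k}, (forall i, f i \in S) -> (forall i, g i \in S) ->
    \sum_i f i * g i \in S'.

Lemma sumprod_closure (k : fieldType) n (S : seq {poly k}) :
  exists S', sumprod_closed n S S'.
Proof.
exists [seq \sum_i S`_(f i).1 * S`_(f i).2 | f : {ffun 'I_n -> 'I_(size S) * 'I_(size S)}].
move=> f g Sf Sg; have hi (h : 'I_n -> {poly k}) : (forall i, h i \in S) ->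
    forall i, (index (h i) S < size S)%N by move=> Sh i; rewrite index_mem.
apply/imageP; exists [ffun i => (Ordinal (hi f Sf i), Ordinal (hi g Sg i))] => //.
by apply: eq_bigr => i _; rewrite ffunE /= !nth_index.
Qed.

Section Orientation.
Variables (k : fieldType) (n : nat) (K : eqType) (kap : 'I_n -> K) (rho : 'I_n -> nat).
Variables (m th : 'I_n -> 'I_n) (D : {set 'I_n}) (t : 'M[k]_n) (b : 'I_n -> bool).
Hypothesis Hp : problem kap rho m th D t b.
Local Notation pc := (piece kap rho).

Let f x := find (pc x) (enum 'I_n).

Let f_pc x y : pc x y -> f x = f y.
Proof.
move=> xy; apply: eq_find => z; apply/idP/idP; last exact: piece_trans.
by apply: piece_trans; rewrite piece_sym.
Qed.

Let f_inj x y : f x = f y -> pc x y.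
Proof.
have fP z : pc z (nth z (enum 'I_n) (f z)).
  by apply: nth_find; apply/hasP; exists z; rewrite ?mem_enum ?piece_refl.
have fs z : (f z < size (enum 'I_n))%N.
  by rewrite -has_find; apply/hasP; exists z; rewrite ?mem_enum ?piece_refl.
move=> E; have := fP y; rewrite -E (set_nth_default x) ?fs // piece_sym.
by apply: piece_trans.
Qed.

(* The last condition keeps inverses out of the controlled columns in [step_nice]. *)
Lemma orientation : exists b' : 'I_n -> bool,
  [/\ forall x y, pc x y -> b' x = b' y, forall x, m x != x -> b' (m x) = ~~ b' x
    & forall x, b' x -> b x -> b (m x)].
Proof.
(* Where [m] joins different sides, the last condition forces [b'] to mark the side unmarked by [b].
   Where it joins equal sides any choice works, and the two pieces are compared by the position [f]
   of their first index. *)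
exists (fun x => if b x == b (m x) then (f x < f (m x))%N else ~~ b x); split.
- move=> x y xy; have mxy := pb_mpc Hp xy.
  rewrite (f_pc xy) (f_pc mxy) (pb_bkap Hp (y := y)) ?(pb_bkap Hp (x := m x) (y := m y)) //.
    by have /pieceP[] := mxy.
  by have /pieceP[] := xy.
- move=> x mx; rewrite (pb_mK Hp) eq_sym; case: ifP => [_|].
    rewrite -leqNgt ltn_neqAle andb_idl // => _.
    by apply/eqP => /f_inj E; have := pb_mfree Hp mx; rewrite piece_sym E.
  by case: (b x); case: (b (m x)).
- by move=> x; case: ifP => [/eqP<-//|_ /negPf->].
Qed.

End Orientation.

(** * Pulling normal forms back through a step *)

Section Back.
Variables (k : fieldType) (n : nat) (K : eqType) (kap : 'I_n -> K) (rho : 'I_n -> nat).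
Variables (m th : 'I_n -> 'I_n) (D : {set 'I_n}) (t : 'M[k]_n) (b : 'I_n -> bool).
Hypothesis Hp : problem kap rho m th D t b.
Variables (A0 : 'M[k]_n) (w : 'I_n -> 'I_n).
Hypotheses (uA0 : A0 \in unitmx) (sA0 : supp (chain_le kap rho) A0).
Hypotheses (ww : involutive w) (E0 : conj_mx A0 t = perm_mat k w).
Hypothesis wth : forall x, kap (w x) = kap (th x).
Variable b' : 'I_n -> bool.
Hypothesis b'pc : forall x y, piece kap rho x y -> b' x = b' y.
Hypothesis b'm : forall x, m x != x -> b' (m x) = ~~ b' x.

Local Notation le := (chain_le kap rho).
Local Notation pc := (piece kap rho).
Local Notation D' := (step_D m).
Local Notation kap' := (step_kap kap rho m).
Local Notation rho' := (step_rho rho w).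
Local Notation m' := (step_m m w).
Local Notation t' := (step_t kap rho m A0).

Let le_refl := chain_le_refl kap rho.
Let le_trans := @chain_le_trans n K kap rho.
Let Hp' := step_problem Hp uA0 sA0 ww wth b'pc b'm.

(** Labels outside [D'] can be reassigned: such an index takes the label of its opposite [w x],
    which makes labels constant along [w] as well. *)
Lemma step_label (l : 'I_n -> k) (t'' : 'M[k]_n) : links kap' m t'' ->
  (forall x y, t'' x y != 0 -> l x = l y) ->
  (forall x, l (m' x) = l x) ->
  exists l1 : 'I_n -> k,
    [/\ forall x, x \in D' -> l1 x = l x, forall x, l1 (w x) = l1 x &
        forall x y, t'' x y != 0 -> l1 x = l1 y].
Proof.
move=> lt tl lm.
pose l1 x := if x \in D' then l x else if w x \in D' then l (w x) else 0.
exists l1; split=> [x xD|x|x y txy].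
- by rewrite /l1 xD.
- have [xD|xD] := boolP (x \in D'); have [wD|wD] := boolP (w x \in D').
  + by rewrite /l1 xD wD -[RHS]lm /step_m xD wD.
  + by rewrite /l1 xD (negPf wD) ww xD.
  + by rewrite /l1 (negPf xD) wD.
  + by rewrite /l1 ww (negPf xD) (negPf wD).
have [xD|xD] := boolP (x \in D'); last by rewrite (links_dead Hp' lt xD txy).
have /(step_kapP) [yD _] := lt _ _ txy; rewrite (step_D_m Hp) xD in yD.
by rewrite /l1 xD yD; apply: tl.
Qed.

Hypothesis b'or : forall x, b' x -> b x -> b (m x).
Variables S S' : seq {poly k}.
Hypotheses (S0 : 0 \in S) (S1 : 1 \in S) (SS' : sumprod_closed n S S').

(** In the lifted basis [t] is the permutation [w], but the matching reads [t''] instead of [m]. One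
    end of each matched pair is replaced by the transport of the other along [t'']. This restores
    [m] and surrounds [w] by two factors with entries from [t''], whence the sums of products. *)
Lemma step_nice : nice S kap' rho' m' D' t' b' -> nice S' kap rho m D t b.
Proof.
case=> A' [l [uA' sA' mA' [tl lm tS]]].
have [A [uA sA At AM]] := step_lift Hp uA0 sA0 ww E0 wth b'pc b'm uA' sA' mA'.
have [t'' Et] : exists t'', t'' = conj_mx A' t' by exists (conj_mx A' t').
rewrite -Et in tl tS AM.
have mK := pb_mK Hp.
have lt'' : links kap' m t''.
  rewrite Et; exact: (conj_links (pb_thkap Hp') uA' sA' (pb_links Hp')).
have tt'' : t'' *m t'' = 1%:M by rewrite Et -conj_mx_mul // (pb_tt Hp') conj_mx_one.
have [l1 [l1D l1w l1t]] := step_label lt'' tl lm.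
(* [Z] picks the end to be replaced, exactly one of [y] and [m y]: the end unmarked by [b'] if [b]
   marks it, otherwise the other end. Together with [b'or] this ensures that all columns of [t'']
   entering a column marked by [b] are marked by [b']. *)
pose Z := [set y | (m y != y) && (~~ b' y && b y || b' y && ~~ b (m y))].
have ZD y : y \in Z -> y \in D' by rewrite !inE => /andP[].
have Zm y : y \in D' -> (m y \in Z) = (y \notin Z).
  rewrite !inE mK [y == m y]eq_sym => my; rewrite my b'm //=.
  by case: (b' y); case: (b y); case: (b (m y)).
have Zpc : forall x y, pc x y -> (x \in Z) = (y \in Z).
  move=> x y xy; have mxy := pb_mpc Hp xy.
  have := step_D_pc Hp xy; rewrite !inE (b'pc xy) => ->.
  rewrite (pb_bkap Hp (y := y)) ?(pb_bkap Hp (x := m x) (y := m y)) //.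
    by have /pieceP[] := mxy.
  by have /pieceP[] := xy.
have t''pc x y : t'' x (m y) != 0 -> pc x y.
  move=> /lt'' /(pb_thkap Hp') ; rewrite !mK => /step_kap_pc.
  by rewrite piece_sym.
have t''pc' x y : t'' (m x) y != 0 -> pc x y.
  by move=> /lt''; rewrite mK => /step_kap_pc; rewrite piece_sym.
pose N : 'M[k]_n := \matrix_(x, y) if y \in Z then t'' x (m y) else (x == y)%:R.
pose Ni : 'M[k]_n := \matrix_(x, y) if y \in Z then t'' (m x) y else (x == y)%:R.
have Npc x y : N x y != 0 -> pc x y.
  rewrite mxE; case: ifP => _; first exact: t''pc.
  by case: (eqVneq x y) => [->|]; rewrite ?eqxx ?piece_refl.
have NNi : N *m Ni = 1%:M.
  apply/matrixP => x y; rewrite mxE; have [yZ|yZ] := boolP (y \in Z); last first.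
    rewrite (bigD1 y) //= !mxE (negPf yZ) eqxx mulr1 big1 ?addr0 // => z zy.
    by rewrite !mxE (negPf yZ) (negPf zy) mulr0.
  rewrite -tt'' mxE [RHS](reindex_inj (can_inj mK)) /=; apply: eq_bigr => z _.
  rewrite !mxE yZ; have [->|tz] := eqVneq (t'' (m z) y) 0; first by rewrite !mulr0.
  by rewrite (Zpc _ _ (t''pc' _ _ tz)) yZ.
have [uN uNi] := mulmx1_unit NNi.
have iN : invmx N = Ni by rewrite -[LHS]mulmx1 -NNi mulKmx.
have levN : levi le N = N.
  apply/matrixP => x y; rewrite levi_chainE; last first.
    by move=> u v /Npc; rewrite -sym_part_chain => /andP[].
  by case: ifP => // npc; apply/esym/eqP; apply: (contraFT _ npc) => /Npc.
have sN : supp le N by move=> x y /Npc; rewrite -sym_part_chain => /andP[].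
have tN : t'' *m N = N *m perm_mat k m.
  apply/matrixP => x y; rewrite mul_perm_mat mxE [RHS]mxE.
  have [yD|yD] := boolP (y \in D'); last first.
    have mymy := step_m_id yD; have yZ : y \notin Z by apply: contra yD => /ZD.
    rewrite mymy (negPf yZ) (bigD1 y) //= mxE (negPf yZ) eqxx mulr1 big1 ?addr0 => [|z zy].
      have [->|xy] := eqVneq x y; first by rewrite Et (conj_dead Hp') ?eqxx.
      apply/eqP/negPn/negP => /(links_dead_col Hp' lt'' yD) E.
      by rewrite E eqxx in xy.
    by rewrite mxE (negPf yZ) (negPf zy) mulr0.
  rewrite Zm //; have [yZ|yZ] := boolP (y \in Z).
    transitivity ((t'' *m t'') x (m y)); last by rewrite tt'' mxE.
    by rewrite mxE; apply: eq_bigr => z _; rewrite mxE yZ.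
  rewrite mK (bigD1 y) //= mxE (negPf yZ) eqxx mulr1 big1 ?addr0 // => z zy.
  by rewrite mxE (negPf yZ) (negPf zy) mulr0.
pose lo y := if y \in Z then l1 (m y) else l1 y.
have loN z y : N z y != 0 -> l1 z = lo y.
  rewrite mxE /lo; case: ifP => _; first exact: l1t.
  by case: (eqVneq z y) => [->|]; rewrite ?eqxx.
have loNi x u : Ni x u != 0 -> lo x = l1 u.
  rewrite mxE /lo; case: ifP => uZ.
    by move=> tx; rewrite (Zpc _ _ (t''pc' _ _ tx)) uZ; apply: l1t.
  by case: (eqVneq x u) => [->|]; rewrite ?eqxx // uZ.
have T x y : conj_mx (A *m N) t x y = \sum_z Ni x (w z) * N z y.
  by rewrite conj_mxM // At /conj_mx iN mxE; apply: eq_bigr => z _; rewrite mul_perm_mat.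
exists (A *m N), lo; split.
- by rewrite unitmx_mul uA.
- exact: suppM.
- move=> x y xy; set Q := levi le (A *m N).
  have QE u v : pc u v -> (A *m N) u v = Q u v.
    by move=> uv; rewrite /Q levi_chainE ?uv //; apply: suppM.
  rewrite !QE ?(pb_mpc Hp) //.
  have MQ : perm_mat k m *m Q = Q *m perm_mat k m.
    rewrite /Q leviM // levN mulmxA -(mul_conj_mx (perm_mat k m) (levi_unit le_refl le_trans sA uA)).
    by rewrite AM -!mulmxA tN.
  by have /matrixP/(_ x (m y)) := MQ; rewrite perm_mat_mul // mul_perm_mat mK.
split.
- move=> x y; rewrite T => /sum_neq0[z]; rewrite mulf_eq0 negb_or => /andP[/loNi-> /loN<-].
  exact: l1w.
- move=> x; have [xD|xD] := boolP (x \in D'); last by rewrite step_m_id.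
  rewrite /lo Zm // mK; by case: (x \in Z).
move=> x y yD yb.
have delta u v : exists2 p, p \in S & (u == v :> 'I_n)%:R = p.[lo y] :> k.
  by case: (u == v); [exists 1|exists 0]; rewrite ?hornerC.
have Nv z : exists2 p, p \in S & N z y = p.[lo y].
  rewrite mxE /lo; case: ifP => yZ; last by have := delta z y; rewrite /lo yZ.
  have yD' := ZD _ yZ; have mD : m y \in D' by rewrite (step_D_m Hp).
  rewrite l1D //; apply: tS => //; rewrite b'm; last by rewrite inE in yD'.
  move: yZ; rewrite inE => /andP[_ /orP[/andP[]//|/andP[b'y bm]]].
  by rewrite b'or in bm.
have Niv z : exists2 p, p \in S & Ni x (w z) * N z y = p.[lo y] * N z y.
  have [->|Nz] := eqVneq (N z y) 0; first by exists 0; rewrite ?mulr0.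
  have zy := Npc _ _ Nz; have /pieceP[kzy _] := zy.
  have zD : z \in D by rewrite (pb_D Hp kzy).
  (* [w] leads to the opposite flag, so [w z] can be in [Z] only by the second alternative, and
     there it is marked by [b']. *)
  have bw : ~~ b (w z).
    by rewrite (pb_bkap Hp (wth z)) (pb_bth Hp) // (pb_bkap Hp kzy) yb.
  rewrite mxE; case: ifP => uZ; last by have [p Sp ->] := delta x (w z); exists p.
  have [|p Sp ->] := tS (m x) (w z) (ZD _ uZ).
    by move: uZ; rewrite inE => /andP[_ /orP[/andP[_]|/andP[]//]]; rewrite (negPf bw).
  by exists p => //; rewrite -l1D ?ZD // l1w (loN _ _ Nz).
have [F SF EF] := fin_all_exists2 Niv; have [G SG EG] := fin_all_exists2 Nv.
exists (\sum_z F z * G z); first exact: SS'.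
by rewrite T horner_sum; apply: eq_bigr => z _; rewrite hornerM EF -EG.
Qed.

End Back.

(** * Jordan form *)

Section Jordan.
Variable k : closedFieldType.

(** Records only what survives of a Jordan form in the labels and the list of possible entries,
    which makes it visibly stable under isomorphisms and direct sums. *)
Definition jordan_like n (Z : 'M[k]_n) := exists (A : 'M[k]_n) (l : 'I_n -> k),
  [/\ A \in unitmx, forall x y, conj_mx A Z x y != 0 -> l x = l y &
      forall x y, exists2 p, p \in [:: 0; 1; 'X] & conj_mx A Z x y = p.[l y]].

Lemma jordan_like_conj n (B Z : 'M[k]_n) : B \in unitmx ->
  jordan_like (conj_mx B Z) -> jordan_like Z.
Proof.
move=> uB [A [l [uA lA eA]]]; exists (B *m A), l.
by rewrite unitmx_mul uB uA; split=> // x y; rewrite conj_mxM //; by [apply: lA|apply: eA].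
Qed.

Lemma jordan_like_iso p n (E : p = n) (B : 'M[k]_(p, n)) (Z : 'M_n) (J : 'M_p) :
  row_free B -> B *m Z = J *m B -> jordan_like J -> jordan_like Z.
Proof.
case: n / E B Z => B Z; rewrite row_free_unit => uB BZ JJ.
apply: (@jordan_like_conj _ (invmx B)); first by rewrite unitmx_inv.
by rewrite /conj_mx invmxK BZ mulmxK.
Qed.

Lemma jordan_like_block p q (Z1 : 'M[k]_p) (Z2 : 'M[k]_q) :
  jordan_like Z1 -> jordan_like Z2 -> jordan_like (block_mx Z1 0 0 Z2).
Proof.
move=> [A1 [l1 [u1 L1 e1]]] [A2 [l2 [u2 L2 e2]]].
have uA : block_mx A1 0 0 A2 \in unitmx by rewrite unitmxE det_ublock unitrM -!unitmxE u1.
have E : conj_mx (block_mx A1 0 0 A2) (block_mx Z1 0 0 Z2) =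
         block_mx (conj_mx A1 Z1) 0 0 (conj_mx A2 Z2).
  apply: conj_mxE => //; rewrite !mulmx_block !mulmx0 !mul0mx !addr0 !add0r.
  by rewrite !mul_conj_mx.
exists (block_mx A1 0 0 A2), (fun x => match split x with inl i => l1 i | inr j => l2 j end).
have zero u : exists2 p0, p0 \in [:: 0; 1; 'X] & 0 = p0.[u] :> k.
  by exists 0; rewrite ?horner0 // inE eqxx.
have mx0E p' q' i j : (0 : 'M[k]_(p', q')) i j = 0 by rewrite mxE.
split=> // x y; rewrite E; case: (split_ordP x) => i ->; case: (split_ordP y) => j ->;
  rewrite ?block_mxEul ?block_mxEur ?block_mxEdl ?block_mxEdr ?mx0E ?eqxx
    ?(unsplitK (inl _)) ?(unsplitK (inr _)) //.
- exact: L1.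
- exact: L2.
Qed.

Lemma jordan_like_sum p q n (E : (p + q)%N = n) (U : 'M[k]_(p, n)) (W : 'M_(q, n))
    (Z : 'M_n) (Z1 : 'M_p) (Z2 : 'M_q) :
  row_free (col_mx U W) -> U *m Z = Z1 *m U -> W *m Z = Z2 *m W ->
  jordan_like Z1 -> jordan_like Z2 -> jordan_like Z.
Proof.
move=> fr UZ WZ J1 J2; apply: (jordan_like_iso E fr _ (jordan_like_block J1 J2)).
by rewrite mul_col_mx mul_block_col !mul0mx addr0 add0r UZ WZ.
Qed.

Lemma stable_restr n (V Z : 'M[k]_n) : (V *m Z <= V)%MS ->
  exists Z', row_base V *m Z = Z' *m row_base V.
Proof.
move=> VZ; have /submxP[Z' ->] : (row_base V *m Z <= row_base V)%MS; last by exists Z'.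
by rewrite eq_row_base (eqmxMr _ (eq_row_base V)).
Qed.

Lemma row_free_col_mx p q n (U : 'M[k]_(p, n)) (W : 'M_(q, n)) :
  row_free U -> row_free W -> (U :&: W = 0)%MS -> row_free (col_mx U W).
Proof.
move=> fU fW UW; rewrite /row_free -addsmxE mxrank_disjoint_sum //.
by rewrite (eqP fU) (eqP fW).
Qed.

Lemma jordan_block n (a : k) (Z : 'M[k]_n) :
  (forall x y, Z x y = if x == y then a else (x.+1 == y :> nat)%:R) -> jordan_like Z.
Proof.
move=> ZE; exists 1%:M, (fun=> a); split=> // [|x y]; first exact: unitmx1.
rewrite conj_mx1 ZE; case: ifP => _; first by exists 'X; rewrite ?hornerX // !inE eqxx !orbT.
case: eqP => _; [exists 1|exists 0]; rewrite ?hornerC ?inE ?eqxx ?orbT //.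
Qed.

Lemma expmx_eq0_le n (N : 'M[k]_n.+1) i j : (i <= j)%N -> N ^+ i = 0 -> N ^+ j = 0.
Proof. by move=> ij N0; rewrite -(subnK ij) exprD N0 mulr0. Qed.

(** A longest Jordan chain splits off. Choose a nonzero entry of the last nonvanishing power of
    [Z - a%:M]: the rows of the powers through it span the chain, and the common left kernel of the
    columns through it is a stable complement, left to the induction. *)
Lemma jordan_like_nilp n (Z : 'M[k]_n.+1) (a : k) r :
  (forall q (Z' : 'M[k]_q), (q < n.+1)%N -> jordan_like Z') ->
  (Z - a%:M) ^+ r.+1 = 0 -> (Z - a%:M) ^+ r != 0 -> jordan_like Z.
Proof.
set N := Z - a%:M => IH N0 Nr.
have /existsP[i0 /existsP[j0 Nij]] : [exists i, exists j, (N ^+ r) i j != 0].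
  apply: contraNT Nr; rewrite negb_exists => /forallP H.
  apply/eqP/matrixP => i j; rewrite mxE; apply/eqP; have := H i.
  by apply: contraR => Hij; apply/existsP; exists j.
pose h s := (N ^+ s) i0 j0.
have h0 s : (r < s)%N -> h s = 0.
  by move=> rs; rewrite /h (expmx_eq0_le rs N0) mxE.
(* The Hankel matrix [U *m P] is antitriangular, hence the cyclic subspace [U] has
   the stable complement [kermx P]. *)
pose U : 'M[k]_(r.+1, n.+1) := \matrix_(i, y) (N ^+ i) i0 y.
pose P : 'M[k]_(n.+1, r.+1) := \matrix_(x, j) (N ^+ j) x j0.
have UP : U *m P = \matrix_(i, j) h (i + j)%N.
  apply/matrixP => i j; rewrite !mxE /h exprD [in RHS]mxE.
  by apply: eq_bigr => z _; rewrite !mxE.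
have uUP : U *m P \in unitmx.
  rewrite unitmxE unitfE; apply/det0P => -[v v0 vG].
  have [i1 vi1] : exists i, v 0 i != 0.
    apply/existsP; apply: contraNT v0; rewrite negb_exists => /forallP H.
    by apply/eqP/rowP => i; rewrite mxE; apply/eqP; have := H i; rewrite negbK.
  case: (arg_minnP (P := fun i => v 0 i != 0) (@nat_of_ord _) vi1) => i vi imin.
  have /rowP/(_ (rev_ord i)) := vG; rewrite mxE (bigD1 i) //= big1 ?addr0.
    move/eqP; rewrite UP !mxE /= mulf_eq0 (negPf vi) /= subSS subnKC; last by rewrite -ltnS.
    by rewrite (negPf Nij).
  move=> j ji; have [->|vj] := eqVneq (v 0 j) 0; first by rewrite mul0r.
  rewrite UP !mxE h0 ?mulr0 //= subSS.
  have ij : (i < j)%N by rewrite ltn_neqAle imin // andbT eq_sym.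
  by rewrite -{1}(@subnKC i r) ?ltn_add2r // -ltnS.
have fU : row_free U.
  apply/row_freeP; exists (P *m invmx (U *m P)); by rewrite mulmxA mulmxV.
pose W := kermx P.
have rP : \rank P = r.+1.
  apply/eqP; rewrite eqn_leq rank_leq_col /=.
  by apply: leq_trans (mxrankM_maxr U P); rewrite mxrank_unit.
have UW : (U :&: row_base W = 0)%MS.
  apply/eqP/rowV0P => x; rewrite sub_capmx eq_row_base => /andP[/submxP[c ->]].
  move=> /sub_kermxP; rewrite -mulmxA => /(congr1 (mulmx^~ (invmx (U *m P)))).
  by rewrite mulmxK // mul0mx => ->; rewrite mul0mx.
have WN : (W *m N <= W)%MS.
  apply/sub_kermxP; apply/matrixP => x j; rewrite [RHS]mxE.
  have WP y s : \sum_z W y z * (N ^+ s) z j0 = 0.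
    have [sr|rs] := ltnP s r.+1.
      have /matrixP/(_ y (Ordinal sr)) := mulmx_ker P; rewrite !mxE => E.
      by rewrite -[RHS]E; apply: eq_bigr => z _; rewrite !mxE.
    by rewrite (expmx_eq0_le rs N0) big1 // => z _; rewrite [X in _ * X]mxE mulr0.
  rewrite -[RHS](WP x j.+1) exprS.
  transitivity ((W *m N *m (N ^+ j)) x j0); last by rewrite -mulmxA mxE.
  rewrite [LHS]mxE [RHS]mxE; apply: eq_bigr => z _; congr (_ * _).
  by rewrite mxE.
have ZN : Z = N + a%:M by rewrite subrK.
have WZ : (W *m Z <= W)%MS.
  by rewrite ZN mulmxDr addmx_sub // mul_mx_scalar scalemx_sub.
have [Z2 Z2E] := stable_restr WZ.
have rW : \rank W = (n.+1 - r.+1)%N by rewrite mxrank_ker rP.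
have rn : (r.+1 <= n.+1)%N by rewrite -rP rank_leq_row.
pose J : 'M[k]_r.+1 := \matrix_(x, y) if x == y then a else (x.+1 == y :> nat)%:R.
apply: (@jordan_like_sum _ _ _ _ U (row_base W) Z J Z2).
- by rewrite rW subnKC.
- by apply: row_free_col_mx => //; apply: row_base_free.
- apply/matrixP => x y; rewrite ZN mulmxDr mul_mx_scalar !mxE.
  transitivity ((N ^+ x.+1) i0 y + a * U x y).
    rewrite exprSr mxE [U _ _]mxE; congr (_ + _).
    by apply: eq_bigr => z _; rewrite !mxE.
  rewrite (bigD1 x) //= [J x x]mxE eqxx addrC; congr (_ + _).
  have [xr|rx] := ltnP x.+1 r.+1.
    rewrite (bigD1 (Ordinal xr)) /=; last by rewrite -val_eqE /= gtn_eqF.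
    rewrite !mxE -val_eqE /= ltn_eqF // eqxx mul1r big1 ?addr0 // => z /andP[zx zx'].
    rewrite !mxE eq_sym (negPf zx) -[_ == _ :> nat]/(Ordinal xr == z) eq_sym (negPf zx').
    by rewrite mul0r.
  rewrite (expmx_eq0_le rx N0) mxE big1 // => z zx; rewrite !mxE eq_sym (negPf zx).
  by rewrite gtn_eqF ?mul0r // (leq_trans (ltn_ord z)).
- exact: Z2E.
- by apply: (@jordan_block _ a) => x y; rewrite mxE.
- by apply: IH; rewrite rW ltn_subrL.
Qed.

(** Primary decomposition at one eigenvalue [a]: either it splits the space properly, or [Z - a%:M]
    is nilpotent. *)
Lemma jordan_form n (Z : 'M[k]_n) : jordan_like Z.
Proof.
elim/ltn_ind: n Z => -[_ Z|n IH Z].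
  by exists 1%:M, (fun=> 0); split; [exact: unitmx1|by case|by case].
have [a ra] : exists a, root (char_poly Z) a.
  by apply/closed_rootP; rewrite size_char_poly.
have [m [q /implyP q0 pE]] := multiplicity_XsubC (char_poly Z) a.
have p0 : char_poly Z != 0 by rewrite monic_neq0 ?char_poly_monic.
have {q0} qa := q0 p0.
have cop : coprimep (('X - a%:P) ^+ m) q.
  by apply: coprimep_expl; rewrite coprimep_sym coprimep_XsubC.
set U := kermxpoly Z (('X - a%:P) ^+ m); set W := kermxpoly Z q.
have UW : (U :&: W = 0)%MS by apply: mxdirect_kermxpoly.
have UW1 : (U + W :=: 1)%MS.
  rewrite /U /W; apply: eqmx_trans (eqmx_sym (kermxpolyM _ cop)) _; rewrite mulrC -pE.
  by apply: kermxpoly_min; apply: mxminpoly_dvd_char.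
have rUW : (\rank U + \rank W)%N = n.+1.
  by rewrite -mxrank_disjoint_sum // UW1 mxrank1.
have stab p : (kermxpoly Z p *m Z <= kermxpoly Z p)%MS.
  exact: comm_mx_stable_kermxpoly.
have U0 : (0 < \rank U)%N.
  rewrite lt0n; apply/eqP => U0; move: rUW; rewrite U0 add0n => rW.
  have W1 : row_full W by rewrite /row_full rW.
  have : mxminpoly Z %| q.
    apply/mxminpoly_minP; apply/eqP; rewrite -[horner_mx _ _]mul1mx -/(kermxpoly _ _).
    by apply/eqP/sub_kermxP; rewrite sub1mx.
  by move=> /dvdpP[s qE]; move: qa; rewrite qE rootM root_mxminpoly ra orbT.
have [W0|W0] := posnP (\rank W); last first.
  have [Z1 Z1E] := stable_restr (stab (('X - a%:P) ^+ m)).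
  have [Z2 Z2E] := stable_restr (stab q).
  apply: (jordan_like_sum rUW _ Z1E Z2E).
  - apply: row_free_col_mx; [exact: row_base_free|exact: row_base_free|].
    by apply/eqP; rewrite -submx0 (cap_eqmx (eq_row_base _) (eq_row_base _)) UW.
  - by apply: IH; rewrite -[X in (_ < X)%N]rUW -[X in (X < _)%N]addn0 ltn_add2l.
  - by apply: IH; rewrite -[X in (_ < X)%N]rUW -[X in (X < _)%N]add0n ltn_add2r.
have Nm : (Z - a%:M) ^+ m = 0.
  have U1 : row_full U by rewrite /row_full -[X in _ == X]rUW W0 addn0.
  have : (1%:M <= U)%MS by rewrite sub1mx.
  move/sub_kermxP; rewrite mul1mx rmorphXn rmorphB /= horner_mx_X horner_mx_C.
  by [].
have ex : exists r, (Z - a%:M) ^+ r == 0 by exists m; apply/eqP.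
case: (ex_minnP ex) => -[|r] Nr rmin; first by move: Nr; rewrite expr0 oner_eq0.
apply: (@jordan_like_nilp _ _ a r); [by move=> s Z' sn; apply: IH|exact/eqP|].
by apply/negP => /rmin; rewrite ltnn.
Qed.

End Jordan.

(** * Terminal problems *)

Section Embed.
Variables (k : fieldType) (n : nat) (p : {set 'I_n}) (x0 : 'I_n) (px0 : x0 \in p).
Local Notation r := (enum_rank_in px0).

Definition embed_mx (B : 'M[k]_#|p|) : 'M[k]_n :=
  \matrix_(x, y) if (x \in p) && (y \in p) then B (r x) (r y) else (x == y)%:R.

Lemma embed_mxM B C : embed_mx B *m embed_mx C = embed_mx (B *m C).
Proof.
apply/matrixP => x y; rewrite mxE [RHS]mxE; have [xp|xp] := boolP (x \in p); last first.
  rewrite (bigD1 x) //= big1 ?addr0 => [|z zx]; first by rewrite !mxE (negPf xp) eqxx mul1r.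
  by rewrite !mxE (negPf xp) eq_sym (negPf zx) mul0r.
rewrite (bigID (mem p)) /= [X in _ + X]big1 ?addr0 => [|z zp]; last first.
  rewrite mxE xp (negPf zp) /=; case: eqP => [xz|_]; last by rewrite mul0r.
  by rewrite -xz xp in zp.
case: (boolP (y \in p)) => yp.
  rewrite mxE big_enum_val /=; apply: eq_bigr => i _.
  by rewrite !mxE xp yp !enum_valP /= enum_valK_in.
rewrite big1 => [|z zp]; first by case: eqP => // xy; rewrite -xy xp in yp.
rewrite [X in _ * X]mxE (negPf yp) andbF; case: eqP => [zy|_]; last by rewrite mulr0.
by rewrite -zy zp in yp.
Qed.

Lemma embed_mx1 : embed_mx 1%:M = 1%:M.
Proof.
apply/matrixP => x y; rewrite !mxE; case: ifP => // /andP[xp yp].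
suff -> : (enum_rank_in px0 x == enum_rank_in px0 y) = (x == y) by [].
apply/idP/idP => /eqP E; last by rewrite E.
by rewrite -(enum_rankK_in px0 xp) E enum_rankK_in.
Qed.

Lemma embed_mx_unit B : B \in unitmx -> embed_mx B \in unitmx.
Proof.
move=> uB; apply: (proj1 (mulmx1_unit (B := embed_mx (invmx B)) _)).
by rewrite embed_mxM mulmxV // embed_mx1.
Qed.

End Embed.

Definition stable_on (k : fieldType) n (p : {set 'I_n}) (Z : 'M[k]_n) :=
  forall x y, ~~ ((x \in p) && (y \in p)) -> Z x y = (x == y)%:R.

Lemma jordan_form_on (k : closedFieldType) n (p : {set 'I_n}) (Z : 'M[k]_n) :
  stable_on p Z -> exists (A : 'M[k]_n) (l : 'I_n -> k),
  [/\ A \in unitmx, stable_on p A, stable_on p (conj_mx A Z) &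
      (forall x y, conj_mx A Z x y != 0 -> l x = l y) /\
      forall x y, exists2 f, f \in [:: 0; 1; 'X] & conj_mx A Z x y = f.[l y]].
Proof.
move=> sZ; have delta (u : k) (x y : 'I_n) : exists2 f, f \in [:: 0; 1; 'X] & (x == y)%:R = f.[u].
  by case: (x == y); [exists 1|exists 0]; rewrite ?hornerC // !inE eqxx ?orbT.
have [p0|[x0 px0]] := set_0Vmem p.
  have -> : Z = 1%:M by apply/matrixP => x y; rewrite sZ ?p0 ?inE ?mxE.
  have s1 : stable_on p (1%:M : 'M[k]_n) by move=> x y _; rewrite mxE.
  exists 1%:M, (fun=> 0); rewrite conj_mx1; split=> //; first exact: unitmx1.
  by split=> // x y; rewrite mxE.
pose Zp := mxsub enum_val enum_val Z : 'M_#|p|.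
have [Ap [lp [uA lA eA]]] := jordan_form Zp.
have ZE : Z = embed_mx px0 Zp.
  apply/matrixP => x y; rewrite mxE; case: ifP => [/andP[xp yp]|/negbT/sZ//].
  by rewrite mxE !enum_rankK_in.
have st B : stable_on p (embed_mx px0 B) by move=> x y /negPf xy; rewrite mxE xy.
have cE : conj_mx (embed_mx px0 Ap) Z = embed_mx px0 (conj_mx Ap Zp).
  by apply: conj_mxE; rewrite ?embed_mx_unit // ZE !embed_mxM mul_conj_mx.
exists (embed_mx px0 Ap), (fun x => if x \in p then lp (enum_rank_in px0 x) else 0).
rewrite cE; split; [exact: embed_mx_unit|exact: st|exact: st|split=> x y; rewrite mxE].
  case: ifP => [/andP[-> ->]|_]; first exact: lA.
  by case: (eqVneq x y) => [->|]; rewrite ?eqxx.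
by case: ifP => [/andP[xp ->]|_].
Qed.

(** With trivial flags every class is one piece, and invariance under [m] is demanded of all
    entries. Discarded indices keep diagonal entry 1, so that a solution on the rest can be combined
    with one found for a removed part. *)
Definition cyclic_nice (k : fieldType) n (K : eqType) (kap : 'I_n -> K)
    (m : 'I_n -> 'I_n) (D : {set 'I_n}) (t : 'M[k]_n) (b : 'I_n -> bool) :=
  exists (A : 'M[k]_n) (l : 'I_n -> k),
    [/\ A \in unitmx, supp (kap_eq kap) A,
        forall x y, A (m x) (m y) = A x y, forall x, x \notin D -> A x x = 1 &
    [/\ forall x y, conj_mx A t x y != 0 -> l x = l y,
        forall x, l (m x) = l x &
        forall x y, y \in D -> b y -> exists2 p, p \in [:: 0; 1; 'X] & conj_mx A t x y = p.[l y]]].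

Section Remove.
Variables (k : fieldType) (n : nat) (K : eqType) (kap : 'I_n -> K).
Variables (m th : 'I_n -> 'I_n) (D : {set 'I_n}) (t : 'M[k]_n) (b : 'I_n -> bool).
Hypothesis Hp : problem kap (fun=> 0%N) m th D t b.
Variable R : {set 'I_n}.
Hypothesis Rkap : forall x y, kap x = kap y -> (x \in R) = (y \in R).
Hypothesis Rth : forall x, (th x \in R) = (x \in R).
Variable m2 : 'I_n -> 'I_n.
Hypothesis m2R : forall x, x \in R -> m2 x = x.
Hypothesis m2R' : forall x, (m2 x \in R) = (x \in R).
Hypothesis m2K : involutive m2.
Hypothesis m2kap : forall x y, x \notin R -> kap x = kap y -> kap (m2 x) = kap (m2 y).
Hypothesis m2free : forall x, x \in D -> x \notin R -> kap (m2 x) <> kap x.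
Hypothesis m2dead : forall x, x \notin D -> m2 x = x.

(** Indices of [R] become singleton classes on which the change of basis is the identity. Thus [D]
    shrinks, which feeds the induction, while the matrices keep their size. *)
Definition rem_kap (x : 'I_n) : (K + 'I_n)%type := if x \in R then inr x else inl (kap x).
Definition rem_th (x : 'I_n) := if x \in R then x else th x.
Definition rem_D := D :\: R.
Definition rem_t : 'M[k]_n := \matrix_(x, y) if x \in R then (x == y)%:R else t x y.

Lemma rem_kapP x y : rem_kap x = rem_kap y ->
  (x \in R) = (y \in R) /\ if x \in R then x == y else kap x == kap y.
Proof. by rewrite /rem_kap; case: ifP; case: ifP => // _ _ [->]. Qed.

Lemma rem_kap_kap x y : rem_kap x = rem_kap y -> kap x = kap y.
Proof. by case/rem_kapP => _; case: ifP => _ /eqP // ->. Qed.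

Lemma kap_rem_kap x y : x \notin R -> kap x = kap y -> rem_kap x = rem_kap y.
Proof. by move=> xR xy; rewrite /rem_kap -(Rkap xy) (negPf xR) xy. Qed.

Lemma links_R (u : 'M[k]_n) x y : links kap th u -> u x y != 0 -> (x \in R) = (y \in R).
Proof. by move=> lu /lu E; rewrite (Rkap E) Rth. Qed.

Lemma rem_tE x y : x \notin R -> rem_t x y = t x y.
Proof. by move=> xR; rewrite mxE (negPf xR). Qed.

Lemma rem_problem : problem rem_kap (fun=> 0%N) m2 rem_th rem_D rem_t b.
Proof.
have lt := pb_links Hp; split=> //.
- move=> x y /pieceP[/rem_kapP[xyR xy] _]; apply/pieceP; split=> //.
  have [xR|xR] := boolP (x \in R); first by move: xy; rewrite xR => /eqP->.
  rewrite (negPf xR) in xy; apply: kap_rem_kap; first by rewrite m2R'.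
  by apply: m2kap => //; apply/eqP.
- move=> x mx; apply/pieceP => -[/rem_kap_kap E _].
  have xR : x \notin R by apply: contra mx => /m2R->.
  have xD : x \in D by apply: contraR mx => /m2dead->.
  exact: (m2free xD xR (esym E)).
- by move=> x; rewrite !inE negb_and negbK => /orP[/m2R|/m2dead].
- move=> x y /rem_kapP[xyR]; rewrite /rem_th -xyR; case: ifP => [_ /eqP->//|/negbT xR /eqP xy].
  by apply: kap_rem_kap; rewrite ?Rth //; apply: (pb_thkap Hp).
- move=> x; rewrite {2}/rem_th; case: ifP => xR; rewrite /rem_th ?xR // Rth xR.
  by apply: kap_rem_kap; rewrite ?Rth ?xR // (pb_thth Hp).
- move=> x; rewrite !inE negb_and negbK /rem_th; case: (boolP (x \in R)) => //= xR xD.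
  by apply: kap_rem_kap; rewrite ?Rth // (pb_thdead Hp).
- by move=> x; rewrite !inE /rem_th => /andP[/negPf-> /(pb_bth Hp)].
- by move=> x y /rem_kap_kap/(pb_bkap Hp).
- move=> x y; rewrite !inE negb_and negbK => xD /rem_kapP[_].
  case: ifP xD => /= [_ _ /eqP //|_ xD /eqP]; exact: (pb_dead Hp).
- apply/matrixP => x y; rewrite mxE; have [xR|xR] := boolP (x \in R).
    rewrite (bigD1 x) //= mxE xR eqxx mul1r big1 ?addr0 ?mxE ?xR // => z zx.
    by rewrite mxE xR eq_sym (negPf zx) mul0r.
  rewrite -(pb_tt Hp) mxE; apply: eq_bigr => z _; rewrite rem_tE //.
  have [->|tz] := eqVneq (t x z) 0; first by rewrite !mul0r.
  by rewrite rem_tE // -(links_R lt tz).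
- move=> x y; rewrite mxE /rem_th; case: (boolP (x \in R)) => xR.
    by case: (eqVneq x y) => [->|]; rewrite ?eqxx.
  by move=> /lt E; apply/esym/kap_rem_kap; rewrite ?Rth.
- move=> x; rewrite !inE negb_and negbK mxE; case: ifP => /= [|_]; first by rewrite eqxx.
  exact: (pb_t1 Hp).
Qed.

Lemma rem_supp (A : 'M[k]_n) x y : supp (kap_eq rem_kap) A ->
  A x y != 0 -> (x \in R) = (y \in R) /\ kap x = kap y.
Proof. by move=> sA /sA/eqP E; split; [have [] := rem_kapP E|apply: rem_kap_kap]. Qed.

Lemma rem_suppR (A : 'M[k]_n) x y : supp (kap_eq rem_kap) A ->
  (forall z, z \notin rem_D -> A z z = 1) -> x \in R -> A x y = (x == y)%:R.
Proof.
move=> sA A1 xR; have [<-|xy] := eqVneq x y; first by rewrite A1 // !inE xR.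
apply/eqP/negPn/negP => /sA/eqP/rem_kapP[_]; rewrite xR => /eqP E.
by rewrite E eqxx in xy.
Qed.

End Remove.

Lemma stable_on_inv (k : fieldType) n (p : {set 'I_n}) (A : 'M[k]_n) :
  A \in unitmx -> stable_on p A -> stable_on p (invmx A).
Proof.
move=> uA sA x y xy; pose r : rel 'I_n := fun x y => (x \in p) == (y \in p).
have sr : supp r (invmx A).
  apply: supp_inv => [z|z u v|u v]; rewrite /r ?eqxx //; first by move=> /eqP->.
  have [/andP[-> ->] //|/sA->] := boolP ((u \in p) && (v \in p)).
  by case: (eqVneq u v) => [->|]; rewrite ?eqxx.
have [xp|xp] := boolP (x \in p).
  rewrite (supp0E sr); last by rewrite /r xp; move: xy; rewrite xp.
  by case: eqP => // E; move: xy; rewrite -E xp.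
have /matrixP/(_ x y) := mulmxV uA; rewrite mxE (bigD1 x) //= big1 ?addr0 => [|z zx].
  by rewrite sA ?(negPf xp) // eqxx mul1r mxE.
by rewrite sA ?(negPf xp) // eq_sym (negPf zx) mul0r.
Qed.

Lemma conj_problem (k : fieldType) n (K : eqType) (kap : 'I_n -> K) rho m th D (t A : 'M[k]_n) b :
  problem kap rho m th D t b -> A \in unitmx -> supp (chain_le kap rho) A ->
  problem kap rho m th D (conj_mx A t) b.
Proof.
move=> Hp uA sA; have [? ? ? ? ? ? ? ? ? ? tt lt t1] := Hp; split=> //.
- by rewrite -conj_mx_mul // tt conj_mx_one.
- exact: (conj_links (pb_thkap Hp) uA sA lt).
- by move=> x xD; rewrite (conj_dead Hp) // eqxx.
Qed.

Lemma chain_le0 n (K : eqType) (kap : 'I_n -> K) x y :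
  chain_le kap (fun=> 0%N) x y = kap_eq kap x y.
Proof. by rewrite /chain_le andbT. Qed.

Lemma supp_chain_le0 (k : fieldType) n (K : eqType) (kap : 'I_n -> K) (A : 'M[k]_n) :
  supp (kap_eq kap) A -> supp (chain_le kap (fun=> 0%N)) A.
Proof. by apply: sub_supp => x y; rewrite chain_le0. Qed.

Lemma conj_col (k : fieldType) n (A t C : 'M[k]_n) y : A \in unitmx ->
  (forall x, (A *m C) x y = (t *m A) x y) -> forall x, conj_mx A t x y = C x y.
Proof.
move=> uA E x; rewrite -[C](mulKmx uA) /conj_mx -mulmxA mxE [RHS]mxE.
by apply: eq_bigr => z _; rewrite E.
Qed.

Section Terminal.
Variables (k : closedFieldType) (n : nat) (K : eqType) (kap : 'I_n -> K).
Variables (m th : 'I_n -> 'I_n) (D : {set 'I_n}) (t : 'M[k]_n) (b : 'I_n -> bool).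
Hypothesis Hp : problem kap (fun=> 0%N) m th D t b.
Hypothesis mD : forall x, x \in D -> m x != x.
Hypothesis IH : forall (K' : eqType) (kap' : 'I_n -> K') m' th' (D' : {set 'I_n}) (t' : 'M[k]_n),
  (#|D'| < #|D|)%N -> problem kap' (fun=> 0%N) m' th' D' t' b ->
  (forall x, x \in D' -> m' x != x) -> cyclic_nice kap' m' D' t' b.
Variable x0 : 'I_n.
Hypotheses (x0D : x0 \in D) (bx0 : b x0).

Let mK := pb_mK Hp.
Let mkap x y : kap x = kap y -> kap (m x) = kap (m y).
Proof.
move=> xy; have pxy : piece kap (fun=> 0%N) x y by apply/pieceP.
by have /pieceP[] := pb_mpc Hp pxy.
Qed.
Let mlive x : x \in D -> kap (m x) <> kap x.
Proof. by move=> /mD/(pb_mfree Hp)/pieceP nE E; apply: nE. Qed.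
Let thkap := pb_thkap Hp.
Let lt := pb_links Hp.
Let kap_refl := kap_eq_refl kap.
Let kap_trans := @kap_eq_trans n K kap.

Let p := [set x | kap x == kap x0].

Let pkap x y : kap x = kap y -> (x \in p) = (y \in p).
Proof. by move=> xy; rewrite !inE xy. Qed.
Let pD x : x \in p -> x \in D.
Proof. by rewrite inE => /eqP/(pb_D Hp)->. Qed.

(* A cycle of length one, solved by the Jordan form of the monodromy. *)
Section SelfMatched.
Hypothesis mth : kap (m x0) = kap (th x0).

Let mthp x : x \in p -> kap (m x) = kap (th x).
Proof. by rewrite inE => /eqP xx0; rewrite (mkap xx0) mth; apply: thkap. Qed.
Let mthq x : m x \in p -> kap (th x) = kap (m x).
Proof. by move=> /mthp; rewrite mK => /thkap->; rewrite (pb_thth Hp). Qed.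
Let mp x : x \in p -> m x \notin p.
Proof.
move=> xp; apply/negP; rewrite inE => /eqP mx; apply: (mlive (pD xp)).
by rewrite mx; move: xp; rewrite inE => /eqP.
Qed.
Let mp' x : m x \in p -> x \notin p.
Proof. by move/mp; rewrite mK. Qed.

Let R := [set x | (x \in p) || (m x \in p)].

Let RE x : (x \in R) = (x \in p) || (m x \in p).
Proof. exact: in_set. Qed.

Let Rkap x y : kap x = kap y -> (x \in R) = (y \in R).
Proof. by move=> xy; rewrite !RE (pkap xy) (pkap (mkap xy)). Qed.
Let RthR x : x \in R -> th x \in R.
Proof.
rewrite RE => /orP[xp|xp]; rewrite RE.
  by rewrite (pkap (mkap (esym (mthp xp)))) mK xp orbT.
by rewrite (pkap (mthq xp)) xp.
Qed.
Let Rth x : (th x \in R) = (x \in R).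
Proof.
apply/idP/idP; last exact: RthR.
by move/RthR; rewrite (Rkap (pb_thth Hp x)).
Qed.
Let Rm x : (m x \in R) = (x \in R).
Proof. by rewrite !RE mK orbC. Qed.

Let Z : 'M[k]_n := \matrix_(x, y) if x \in p then t (m x) y else (x == y)%:R.

Let sZ : stable_on p Z.
Proof.
move=> x y xy; rewrite mxE; case: ifP => // xp; rewrite xp /= in xy.
case: eqP => [E|_]; first by rewrite -E xp in xy.
apply/eqP/negPn/negP => /lt E; move: xy; rewrite (pkap E).
by rewrite -(pkap (thkap (esym (mthp xp)))) (pkap (pb_thth Hp x)) xp.
Qed.

(** [t] and [m] join [p] to the same partner, so they compose to an endomorphism [Z] on [p]. The
    columns in [p] receive its Jordan form [J], those in the partner the inverse of [J]; the choice
    [bx0] puts the mark on the former. *)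
Lemma cyclic_self_matched : cyclic_nice kap m D t b.
Proof.
have [Af [lf [uAf sAf sJ [lJ eJ]]]] := jordan_form_on sZ.
set J := conj_mx Af Z in sJ lJ eJ.
(* Compatibility with [m] demands the same change of basis on [p] and on its partner. *)
pose dup (B : 'M[k]_n) : 'M[k]_n := \matrix_(x, y) if x \in p then B x y else B (m x) (m y).
have dupM B C : stable_on p B -> dup B *m dup C = dup (B *m C).
  move=> sB; apply/matrixP => x y; rewrite mxE [RHS]mxE; case: ifP => xp.
    rewrite mxE; apply: eq_bigr => z _; rewrite !mxE xp.
    case: ifP => // zp; rewrite (sB x z) ?xp ?zp //.
    by case: eqP => [E|_]; [rewrite -E xp in zp|rewrite !mul0r].
  rewrite mxE [RHS](reindex_inj (can_inj mK)); apply: eq_bigr => z _.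
  rewrite !mxE xp; case: ifP => // zp.
  rewrite sB ?(negPf (mp zp)) ?andbF // (inj_eq (can_inj mK)).
  by case: eqP => [E|_]; [rewrite -E xp in zp|rewrite !mul0r].
have dup1 : dup 1%:M = 1%:M.
  by apply/matrixP => x y; rewrite !mxE (inj_eq (can_inj mK)) if_same.
pose A1 := dup Af.
have uA1 : A1 \in unitmx.
  apply: (proj1 (mulmx1_unit (B := dup (invmx Af)) _)).
  by rewrite dupM // mulmxV.
have A1m x y : A1 (m x) (m y) = A1 x y.
  rewrite !mxE !mK; case: ifP => [mx|mx]; case: ifP => // xp.
    by rewrite (negPf (mp xp)) in mx.
  rewrite !sAf ?mx ?xp // (inj_eq (can_inj mK)) //.
have sAk x y : Af x y != 0 -> kap x = kap y.
  have [/andP[]|/sAf->] := boolP ((x \in p) && (y \in p)).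
    by rewrite !inE => /eqP-> /eqP->.
  by case: (eqVneq x y) => [->|]; rewrite ?eqxx.
have sA1 : supp (kap_eq kap) A1.
  move=> x y; rewrite mxE /kap_eq; case: ifP => _ /sAk; first by move=> ->.
  by move=> /mkap; rewrite !mK => ->.
pose T := conj_mx A1 t.
have HpT : problem kap (fun=> 0%N) m th D T b by apply: conj_problem => //; apply: supp_chain_le0.
have lT := pb_links HpT.
have tp x y : t x y != 0 -> (y \in p) = (m x \in p).
  move=> /lt E; rewrite (pkap E); apply/idP/idP => [tx|mx].
    have := mthp tx; rewrite (pb_thth Hp x) => /mkap; rewrite mK => {}E.
    by rewrite -(pkap E).
  by rewrite (pkap (mthq mx)).
have Tp x y : y \in p -> T x y = J (m x) y.
  move=> yp; pose C : 'M[k]_n := \matrix_(u, v) J (m u) v.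
  rewrite /T (@conj_col _ _ _ _ C) => [|//|{}x]; first by rewrite mxE.
  have [mx|mx] := boolP (m x \in p).
    transitivity ((Af *m J) (m x) y).
      rewrite mxE [RHS]mxE [RHS](reindex_inj (can_inj mK)); apply: eq_bigr => z _.
      by rewrite !mxE (negPf (mp' mx)).
    rewrite mul_conj_mx // mxE [RHS]mxE; apply: eq_bigr => z _; rewrite !mxE mx mK.
    case: ifP => // zp; have [->|/tp] := eqVneq (t x z) 0; first by rewrite !mul0r.
    by rewrite zp mx.
  rewrite mxE [RHS]mxE !big1 // => z _.
    have [->|/tp E] := eqVneq (t x z) 0; first by rewrite mul0r.
    rewrite (supp0E sA1) ?mulr0 //; apply/negP => /eqP/pkap.
    by rewrite yp E (negPf mx).
  have [->|/sA1/eqP/mkap/pkap E] := eqVneq (A1 x z) 0; first by rewrite mul0r.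
  rewrite [X in _ * X]mxE sJ; last by rewrite -E (negPf mx).
  by case: eqP => [Ey|_]; [rewrite -Ey -E (negPf mx) in yp|rewrite mulr0].
have uJ : J \in unitmx.
  have Z2 : Z *m (\matrix_(x, y) if x \in p then t x (m y) else (x == y)%:R) = 1%:M.
    apply/matrixP => x y; rewrite mxE; have [xp|xp] := boolP (x \in p).
      transitivity ((t *m t) (m x) (m y)).
        rewrite mxE; apply: eq_bigr => z _; rewrite !mxE xp.
        have [->|/tp] := eqVneq (t (m x) z) 0; first by rewrite !mul0r.
        by rewrite mK xp => ->.
      by rewrite (pb_tt Hp) !mxE (inj_eq (can_inj mK)).
    rewrite (bigD1 x) //= big1 ?addr0 => [|z zx]; first by rewrite !mxE (negPf xp) eqxx mul1r.
    by rewrite !mxE (negPf xp) eq_sym (negPf zx) mul0r.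
  have [uZ _] := mulmx1_unit Z2.
  by rewrite /J /conj_mx !unitmx_mul unitmx_inv uAf uZ.
have sJi := stable_on_inv uJ sJ.
have lJi : forall x y, invmx J x y != 0 -> lf x = lf y.
  move=> x y H; apply/eqP; apply: (supp_inv (r := fun x y => lf x == lf y) _ _ _ H) => //.
    by move=> u v z /eqP-> /eqP->.
  by move=> u v /lJ->.
have Tq x y : m y \in p -> T x y = invmx J x (m y).
  move=> myp; pose C : 'M[k]_n := \matrix_(u, v) J (m u) v.
  transitivity ((T *m C *m invmx J) x (m y)).
    rewrite -mulmxA; transitivity ((T *m perm_mat k m) x (m y)); first by rewrite mul_perm_mat mK.
    congr (fun_of_matrix _ x (m y)); congr (_ *m _); apply/matrixP => u v.
    transitivity ((J *m invmx J) (m u) v); first by rewrite mulmxV // !mxE (can2_eq mK mK).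
    by rewrite mxE [RHS]mxE; apply: eq_bigr => z _; rewrite !mxE.
  have TC u : u \in p -> (T *m C) x u = (x == u)%:R.
    move=> up; transitivity ((T *m T) x u); last by rewrite (pb_tt HpT) mxE.
    by rewrite mxE [RHS]mxE; apply: eq_bigr => z _; rewrite [X in _ * X]mxE -Tp.
  have i0 u : u \notin p -> invmx J u (m y) = 0.
    move=> up; rewrite sJi ?(negPf up) //; case: eqP => // E.
    by rewrite E myp in up.
  rewrite mxE; have [xp|xp] := boolP (x \in p).
    rewrite (bigD1 x) //= TC // eqxx mul1r big1 ?addr0 // => z zx.
    have [zp|/i0->] := boolP (z \in p); last by rewrite mulr0.
    by rewrite TC // eq_sym (negPf zx) mul0r.
  rewrite big1 ?i0 // => z _; have [zp|/i0->] := boolP (z \in p); last by rewrite mulr0.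
  by rewrite TC //; case: eqP => [E|]; [rewrite E zp in xp|rewrite mul0r].
pose m2 x := if x \in R then x else m x.
have m2K : involutive m2.
  by move=> x; rewrite {2}/m2; case: ifP => xR; rewrite /m2 ?xR // Rm xR.
have m2R x : x \in R -> m2 x = x by rewrite /m2 => ->.
have m2R' x : (m2 x \in R) = (x \in R) by rewrite /m2; case: ifP => // xR; rewrite Rm.
have m2kap x y : x \notin R -> kap x = kap y -> kap (m2 x) = kap (m2 y).
  by move=> xR xy; rewrite /m2 -(Rkap xy) (negPf xR); apply: mkap.
have m2free x : x \in D -> x \notin R -> kap (m2 x) <> kap x.
  by move=> xD xR; rewrite /m2 (negPf xR); apply: mlive.
have m2dead x : x \notin D -> m2 x = x.
  by rewrite /m2; case: ifP => // _; apply: (pb_mdead Hp).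
have Hp2 := rem_problem HpT Rkap Rth m2R m2R' m2K m2kap m2free m2dead.
have [||A2 [l2 [uA2 sA2 A2m A2d [l2t l2m l2e]]]] := IH _ Hp2.
- apply: proper_card; apply/properP; split; first exact: subsetDl.
  by exists x0 => //; rewrite !inE eqxx.
- by move=> x; rewrite inE => /andP[xR xD]; rewrite /m2 (negPf xR) mD.
set t2 := rem_t T R in l2t l2e Hp2.
have A2R x y : x \in R -> A2 x y = (x == y)%:R by move=> xR; exact: (rem_suppR y sA2 A2d xR).
have A2s x y : A2 x y != 0 -> (x \in R) = (y \in R) /\ kap x = kap y by move=> H; exact: (rem_supp sA2 H).
have lt2 : links (rem_kap kap R) (rem_th th R) (conj_mx A2 t2).
  by apply: (conj_links (pb_thkap Hp2) uA2 (supp_chain_le0 sA2) (pb_links Hp2)).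
have Rt2 x y : conj_mx A2 t2 x y != 0 -> (x \in R) = (y \in R).
  by move=> /lt2/rem_kapP[-> _]; rewrite /rem_th; case: ifP => // xR; rewrite Rth.
have RT x y : T x y != 0 -> (x \in R) = (y \in R).
  by move=> H; exact: (links_R Rkap Rth lT H).
pose T' : 'M[k]_n := \matrix_(x, y) if x \in R then T x y else conj_mx A2 t2 x y.
have ET : conj_mx (A1 *m A2) t = T'.
  rewrite conj_mxM //; apply: conj_mxE => //; apply/matrixP => x y.
  rewrite mxE [RHS]mxE; have [xR|xR] := boolP (x \in R).
    rewrite (bigD1 x) //= A2R // eqxx mul1r big1 ?addr0 => [|z zx]; last first.
      by rewrite A2R // eq_sym (negPf zx) mul0r.
    rewrite mxE xR (bigD1 y) //= big1 ?addr0 => [|z zy].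
      have [->|/RT] := eqVneq (T x y) 0; first by rewrite mul0r.
      by rewrite xR => yR; rewrite A2R // eqxx mulr1.
    have [->|/RT] := eqVneq (T x z) 0; first by rewrite mul0r.
    by rewrite xR => zR; rewrite A2R // (negPf zy) mulr0.
  transitivity ((A2 *m conj_mx A2 t2) x y).
    rewrite [RHS]mxE; apply: eq_bigr => z _.
    have [->|/A2s[zR _]] := eqVneq (A2 x z) 0; first by rewrite !mul0r.
    by rewrite [T' _ _]mxE -zR (negPf xR).
  by rewrite mul_conj_mx // mxE; apply: eq_bigr => z _; rewrite rem_tE.
pose l x := if x \in p then lf x else if m x \in p then lf (m x) else l2 x.
exists (A1 *m A2), l; split.
- by rewrite unitmx_mul uA1.
- apply: (suppM kap_trans) => // x y /A2s[_ E]; exact/eqP.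
- move=> x y; rewrite mxE [RHS]mxE (reindex_inj (can_inj mK)); apply: eq_bigr => z _.
  rewrite A1m; congr (_ * _); have [zR|zR] := boolP (z \in R).
    by rewrite !A2R ?Rm // (inj_eq (can_inj mK)).
  have [yR|yR] := boolP (y \in R); last by rewrite -[RHS]A2m /m2 (negPf zR) (negPf yR).
  rewrite [LHS](supp0E sA2) ?(supp0E sA2) //; apply/negP => /eqP/rem_kapP[+ _].
    by rewrite yR (negPf zR).
  by rewrite !Rm yR (negPf zR).
- move=> x xD; have xR : x \notin R.
    rewrite RE negb_or (pb_mdead Hp) // andbb; by apply: contra xD => /pD.
  rewrite mxE (bigD1 x) //= big1 ?addr0 => [|z zx].
    rewrite A2d ?mulr1; last by rewrite inE (negPf xD) andbF.
    move: xR; rewrite RE negb_or => /andP[xp mx].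
    by rewrite mxE (negPf xp) sAf ?eqxx // (negPf mx).
  have [->|/sA1/eqP/(pb_dead Hp xD) E] := eqVneq (A1 x z) 0; first by rewrite mul0r.
  by rewrite E eqxx in zx.
rewrite ET; split.
- move=> x y; rewrite mxE /l; case: ifP => xR.
    move=> TN; have := RT _ _ TN; rewrite xR RE => /esym/orP[yp|my].
      move: TN; rewrite Tp // yp => JN; rewrite -(lJ _ _ JN).
      have mx : m x \in p.
        move: JN; have [//|mx] := boolP (m x \in p); rewrite sJ ?(negPf mx) //.
        by case: (m x =P y) => [E _|_]; [rewrite E yp in mx|rewrite /= eqxx].
      by rewrite (negPf (mp' mx)) mx.
    move: TN; rewrite Tq // (negPf (mp' my)) my => JN; rewrite -(lJi _ _ JN).
    have [//|xp] := boolP (x \in p); move: JN; rewrite sJi ?(negPf xp) //.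
    by case: (x =P m y) => [E _|_]; [rewrite E my in xp|rewrite /= eqxx].
  move=> tN; have := Rt2 _ _ tN; have := l2t _ _ tN; move: xR; rewrite !RE.
  by move/norP => [/negPf-> /negPf->] E /esym/norP[/negPf-> /negPf->].
- move=> x; rewrite /l mK; have [xp|xp] := boolP (x \in p).
    by rewrite (negPf (mp xp)).
  case: ifP => // mx; rewrite -[RHS]l2m /m2 RE (negPf xp) mx //.
move=> x y yD yb; rewrite /l; have zero u : exists2 f, f \in [:: 0; 1; 'X] & 0 = f.[u] :> k.
  by exists 0; rewrite ?hornerC // inE eqxx.
have [yp|yp] := boolP (y \in p).
  rewrite mxE; case: ifP => xR; first by rewrite Tp.
  have [->//|/Rt2] := eqVneq (conj_mx A2 t2 x y) 0.
  by rewrite xR RE yp.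
have [my|my] := boolP (m y \in p).
  have := mthp my; rewrite mK => /(pb_bkap Hp); rewrite (pb_bth Hp) ?pD // yb.
  by move: (my); rewrite inE => /eqP/(pb_bkap Hp)->; rewrite bx0.
have yR : y \notin R by rewrite RE negb_or yp.
rewrite mxE; case: ifP => xR; last by apply: l2e => //; rewrite inE yR.
have [->//|/RT] := eqVneq (T x y) 0.
by rewrite xR (negPf yR).
Qed.

End SelfMatched.

(* The block of [t] between [p] and [q] is normalised to the bijection [w]; both
   classes are then removed and their partners matched through [w]. *)
Section Merge.
Hypothesis mth : kap (m x0) <> kap (th x0).
Variables (A0 : 'M[k]_n) (w : 'I_n -> 'I_n).
Hypotheses (ww : involutive w) (wth : forall x, kap (w x) = kap (th x)).

Let q := [set x | kap x == kap (th x0)].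
Let R := [set x | (x \in p) || (x \in q)].

Let RE x : (x \in R) = (x \in p) || (x \in q).
Proof. exact: in_set. Qed.
Let pE x : (x \in p) = (kap x == kap x0).
Proof. exact: in_set. Qed.
Let qE x : (x \in q) = (kap x == kap (th x0)).
Proof. exact: in_set. Qed.
Let thx0D : th x0 \in D.
Proof.
apply: contraT => /(pb_thdead Hp); rewrite (pb_thth Hp) => E.
by case: (pb_live Hp x0D).
Qed.
Let thp x : (th x \in p) = (x \in q).
Proof.
rewrite pE qE; apply/eqP/eqP => [/thkap|/thkap->]; last exact: (pb_thth Hp).
by rewrite (pb_thth Hp).
Qed.
Let qkap x y : kap x = kap y -> (x \in q) = (y \in q).
Proof. by move=> xy; rewrite !qE xy. Qed.
Let thq x : (th x \in q) = (x \in p).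
Proof. by rewrite -thp (pkap (pb_thth Hp x)). Qed.
Let wp x : (w x \in p) = (x \in q).
Proof. by rewrite (pkap (wth x)) thp. Qed.
Let wq x : (w x \in q) = (x \in p).
Proof. by rewrite (qkap (wth x)) thq. Qed.
Let Rw x : (w x \in R) = (x \in R).
Proof. by rewrite !RE wp wq orbC. Qed.
Let Rkap x y : kap x = kap y -> (x \in R) = (y \in R).
Proof. by move=> xy; rewrite !RE (pkap xy) (qkap xy). Qed.
Let Rth x : (th x \in R) = (x \in R).
Proof. by rewrite !RE thp thq orbC. Qed.
Let pq x : x \in q -> x \notin p.
Proof.
rewrite pE qE => /eqP->; apply/eqP => E; exact: (pb_live Hp x0D).
Qed.
Let mR x : x \in R -> m x \notin R.
Proof.
rewrite !RE !pE !qE => /orP[/eqP/mkap->|/eqP/mkap->]; rewrite negb_or; apply/andP; split; apply/eqP => //.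
- exact: mlive.
- by move=> /mkap; rewrite mK => /esym.
- exact: mlive.
Qed.
Let mR' x : m x \in R -> x \notin R.
Proof. by move/mR; rewrite mK. Qed.
Let qR x : x \in q -> x \in R. Proof. by rewrite RE orbC => ->. Qed.
Let mq x : x \in R -> m x \notin q.
Proof. by move=> /mR; apply: contra => /qR. Qed.

Let tq x y : t x y != 0 -> (y \in q) = (x \in p).
Proof. by move=> /lt/qkap->; rewrite thq. Qed.
Let tp x y : t x y != 0 -> (y \in p) = (x \in q).
Proof. by move=> /lt/pkap->; rewrite thp. Qed.

(** The columns in [q] absorb the block of [t], leaving [w]. The change is repeated on the partners
    of [q] to remain compatible with [m]. *)
Let A1 : 'M[k]_n := \matrix_(x, y)
  if y \in q then t x (w y) else if m y \in q then t (m x) (w (m y)) else (x == y)%:R.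

Let A1m x y : A1 (m x) (m y) = A1 x y.
Proof.
rewrite !mxE !mK (inj_eq (can_inj mK)); case: ifP => myq; case: ifP => // yq.
by have := mq (qR yq); rewrite myq.
Qed.

Let tw x y : t x (w y) != 0 -> kap x = kap y.
Proof.
move=> /lt; rewrite wth => /thkap; by rewrite !(pb_thth Hp).
Qed.

Let sA1 : supp (kap_eq kap) A1.
Proof.
move=> x y; rewrite mxE /kap_eq; case: ifP => _; first by move/tw->.
case: ifP => _; first by move/tw/mkap; rewrite !mK => ->.
by case: (eqVneq x y) => [->|]; rewrite ?eqxx.
Qed.

Let uA1 : A1 \in unitmx.
Proof.
pose B : 'M[k]_n := \matrix_(x, y)
  if y \in q then t (w x) y else if m y \in q then t (w (m x)) (m y) else (x == y)%:R.
apply: (proj1 (mulmx1_unit (B := B) _)); apply/matrixP => x y; rewrite mxE.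
have [yq|yq] := boolP (y \in q).
  transitivity ((t *m t) x y); last by rewrite (pb_tt Hp) mxE.
  rewrite mxE [RHS](reindex_inj (can_inj ww)); apply: eq_bigr => z _; rewrite !mxE yq.
  have [->|/tq] := eqVneq (t (w z) y) 0; first by rewrite !mulr0.
  by rewrite yq wp => <-.
have [myq|myq] := boolP (m y \in q).
  transitivity ((t *m t) (m x) (m y)); last by rewrite (pb_tt Hp) !mxE (inj_eq (can_inj mK)).
  rewrite mxE [RHS](reindex_inj (inj_comp (can_inj ww) (can_inj mK))); apply: eq_bigr => z _.
  rewrite !mxE (negPf yq) myq /=.
  have [->|/tq] := eqVneq (t (w (m z)) (m y)) 0; first by rewrite !mulr0.
  rewrite myq wp => /esym mz; rewrite mz; case: ifP => // zq.
  by have := mq (qR zq); rewrite mz.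
rewrite (bigD1 y) //= big1 ?addr0 => [|z zy]; rewrite !mxE (negPf yq) (negPf myq).
  by rewrite eqxx mulr1.
by rewrite (negPf zy) mulr0.
Qed.

Let t1 := conj_mx A1 t.

Let Hp1 : problem kap (fun=> 0%N) m th D t1 b.
Proof. by apply: conj_problem => //; apply: supp_chain_le0. Qed.

Let R1 x y : t1 x y != 0 -> (x \in R) = (y \in R).
Proof. by move=> H; exact: (links_R Rkap Rth (pb_links Hp1) H). Qed.

Let t1p z x : x \in p -> t1 z x = (z == w x)%:R.
Proof.
move=> xp; pose C : 'M[k]_n := \matrix_(u, v) (u == w v)%:R.
have xq : x \notin q by apply: contraL xp => /pq.
have xR : x \in R by rewrite RE xp.
rewrite /t1 (@conj_col _ _ _ _ C) => [|//|u]; first by rewrite mxE.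
transitivity (A1 u (w x)).
  rewrite mxE (bigD1 (w x)) //= [X in _ * X]mxE eqxx mulr1 big1 ?addr0 // => v vx.
  by rewrite [X in _ * X]mxE (negPf vx) mulr0.
rewrite mxE wq xp ww [RHS]mxE (bigD1 x) //= big1 ?addr0 => [|v vx].
  by rewrite [X in _ * X]mxE (negPf xq) (negPf (mq xR)) eqxx mulr1.
by rewrite [X in _ * X]mxE (negPf xq) (negPf (mq xR)) (negPf vx) mulr0.
Qed.

Let t1R z x : x \in R -> t1 z x = (z == w x)%:R.
Proof.
rewrite RE => /orP[|xq]; first exact: t1p.
have wxp : w x \in p by rewrite wp.
transitivity ((t1 *m t1) z (w x)); last by rewrite (pb_tt Hp1) mxE.
rewrite [RHS]mxE (bigD1 x) //= (t1p _ wxp) ww eqxx mulr1 big1 ?addr0 // => u ux.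
by rewrite (t1p _ wxp) ww (negPf ux) mulr0.
Qed.

Let m2 x := if x \in R then x else if m x \in R then m (w (m x)) else m x.

Let m2E x : m x \in R -> m2 x = m (w (m x)).
Proof. by move=> mx; rewrite /m2 (negPf (mR' mx)) mx. Qed.

Let m2E' x : x \notin R -> m x \notin R -> m2 x = m x.
Proof. by rewrite /m2 => /negPf-> /negPf->. Qed.

(** Following [m], [w], [m] through the removed classes contracts to a single matching, which
    shortens the cycle. A solution of the shorter problem extends back: indices of [R] take the
    coefficients and the label of their partners. *)
Lemma cyclic_merge : cyclic_nice kap m D t b.
Proof.
have m2R x : x \in R -> m2 x = x by rewrite /m2 => ->.
have m2R' x : (m2 x \in R) = (x \in R).
  have [/m2R->//|xR] := boolP (x \in R).
  have [mx|mx] := boolP (m x \in R); last by rewrite m2E' // (negPf mx).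
  by rewrite m2E // (negPf (mR _)) // Rw.
have m2K : involutive m2.
  move=> x; have [xR|xR] := boolP (x \in R); first by rewrite !m2R.
  have [mx|mx] := boolP (m x \in R); last by rewrite [m2 x]m2E' // m2E' ?mK.
  by rewrite [m2 x]m2E // m2E ?mK ?ww ?mK // Rw.
have m2kap x y : x \notin R -> kap x = kap y -> kap (m2 x) = kap (m2 y).
  move=> xR xy; have := Rkap (mkap xy); rewrite /m2 -(Rkap xy) (negPf xR) => <-.
  case: ifP => _; last exact: mkap.
  by apply: mkap; rewrite !wth; apply/thkap/mkap.
have m2free x : x \in D -> x \notin R -> kap (m2 x) <> kap x.
  move=> xD xR; have [mx|mx] := boolP (m x \in R); last by rewrite m2E' //; apply: mlive.
  rewrite m2E // => /mkap; rewrite mK wth; apply: (pb_live Hp).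
  apply: contraT => /(pb_mdead Hp); rewrite mK => E.
  by have := mD xD; rewrite -E eqxx.
have m2dead x : x \notin D -> m2 x = x.
  move=> xD; have xR : x \notin R.
    apply: contra xD; rewrite RE => /orP[/pD//|]; rewrite qE => /eqP/(pb_D Hp)->.
    exact: thx0D.
  by rewrite m2E' ?(pb_mdead Hp).
have Hp2 := rem_problem Hp1 Rkap Rth m2R m2R' m2K m2kap m2free m2dead.
have [||A2 [l2 [uA2 sA2 A2m A2d [l2t l2m l2e]]]] := IH _ Hp2.
- apply: proper_card; apply/properP; split; first exact: subsetDl.
  by exists x0 => //; rewrite inE RE pE eqxx.
- move=> x; rewrite inE => /andP[xR xD]; apply/eqP => E.
  by apply: (m2free _ xD xR); rewrite E.
set t2 := rem_t t1 R in l2t l2e Hp2.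
have A2R x y : x \in R -> A2 x y = (x == y)%:R.
  by move=> xR; exact: (rem_suppR y sA2 A2d xR).
have A2s x y : A2 x y != 0 -> (x \in R) = (y \in R) /\ kap x = kap y.
  by move=> H; exact: (rem_supp sA2 H).
have lt2 : links (rem_kap kap R) (rem_th th R) (conj_mx A2 t2).
  by apply: (conj_links (pb_thkap Hp2) uA2 (supp_chain_le0 sA2) (pb_links Hp2)).
have Rt2 x y : conj_mx A2 t2 x y != 0 -> (x \in R) = (y \in R).
  by move=> /lt2/rem_kapP[-> _]; rewrite /rem_th; case: ifP => // xR; rewrite Rth.
pose dup (M : 'M[k]_n) : 'M[k]_n := \matrix_(x, y) if x \in R then M (m x) (m y) else M x y.
have dupM M : dup A2 *m dup M = dup (A2 *m M).
  apply/matrixP => x y; rewrite mxE [RHS]mxE; case: ifP => xR.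
    rewrite mxE [RHS](reindex_inj (can_inj mK)); apply: eq_bigr => z _.
    rewrite !mxE xR; case: ifP => // zR.
    have [->|/sA2/eqP/rem_kap_kap E] := eqVneq (A2 (m x) (m z)) 0; first by rewrite !mul0r.
    by have := Rkap (mkap E); rewrite !mK zR xR.
  rewrite mxE; apply: eq_bigr => z _; rewrite !mxE xR.
  have [->|/A2s[]] := eqVneq (A2 x z) 0; first by rewrite !mul0r.
  by rewrite xR => <-.
pose B := dup A2.
have uB : B \in unitmx.
  apply: (proj1 (mulmx1_unit (B := dup (invmx A2)) _)).
  rewrite dupM mulmxV //; apply/matrixP => x y.
  by rewrite !mxE (inj_eq (can_inj mK)) if_same.
have sB x y : B x y != 0 -> kap x = kap y.
  rewrite mxE; case: ifP => _ /A2s[_] //.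
  by move=> /mkap; rewrite !mK.
have Bm x y : B (m x) (m y) = B x y.
  case: (kap x =P kap y) => [E|NE]; last first.
    transitivity (0 : k); [|apply/esym]; apply/eqP/negPn/negP => /sB; last by [].
    by move=> /mkap; rewrite !mK.
  have yR := Rkap E; have myR := Rkap (mkap E).
  rewrite !mxE !mK; have [xR|xR] := boolP (x \in R); first by rewrite (negPf (mR xR)).
  case: ifP => // /negbT mx; rewrite -[RHS]A2m !m2E' -?yR -?myR //.
pose T' : 'M[k]_n := \matrix_(x, y) if x \in R then (x == w y)%:R else conj_mx A2 t2 x y.
have ET : conj_mx (A1 *m B) t = T'.
  rewrite conj_mxM // -/t1; apply: conj_mxE => //; apply/matrixP => x y.
  rewrite mxE [RHS]mxE; have [xR|xR] := boolP (x \in R).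
    rewrite (bigD1 (w y)) //= big1 ?addr0 => [|z zy]; last first.
      have [->|/sB/Rkap zR] := eqVneq (B x z) 0; first by rewrite mul0r.
      by rewrite [X in _ * X]mxE -zR xR (negPf zy) mulr0.
    rewrite (bigD1 (w x)) //= big1 ?addr0 => [|z zx]; last first.
      have [->|t1z] := eqVneq (t1 x z) 0; first by rewrite mul0r.
      have zR : z \in R by rewrite -(R1 t1z).
      by rewrite t1R // -(inj_eq (can_inj ww)) ww eq_sym (negPf zx) mul0r.
    rewrite t1R ?Rw // ww eqxx mul1r; have [yR|yR] := boolP (y \in R); last first.
      rewrite [B (w x) y](supp0E (r := fun x y => (x \in R) == (y \in R))); last 2 first.
      - by move=> u v /sB/Rkap->.
      - by rewrite Rw xR (negPf yR).
      rewrite (supp0E (A := B) (r := fun x y => (x \in R) == (y \in R))) ?mul0r //.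
        by move=> u v /sB/Rkap->.
      by rewrite Rw xR (negPf yR).
    rewrite [X in _ * X]mxE Rw yR eqxx mulr1 !mxE Rw xR -[LHS]A2m.
    by rewrite !m2E ?mK ?ww ?Rw.
  transitivity ((A2 *m conj_mx A2 t2) x y).
    rewrite [RHS]mxE; apply: eq_bigr => z _; rewrite [B _ _]mxE (negPf xR).
    have [->|/A2s[zR _]] := eqVneq (A2 x z) 0; first by rewrite !mul0r.
    by rewrite [T' _ _]mxE -zR (negPf xR).
  rewrite mul_conj_mx // mxE; apply: eq_bigr => z _; rewrite rem_tE //.
  have [->|/R1 zR] := eqVneq (t1 x z) 0; first by rewrite !mul0r.
  by rewrite [B _ _]mxE -zR (negPf xR).
pose l x := if x \in R then l2 (m x) else l2 x.
exists (A1 *m B), l; split.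
- by rewrite unitmx_mul uA1.
- by apply: (suppM kap_trans) => // x y /sB E; apply/eqP.
- move=> x y; rewrite mxE [RHS]mxE (reindex_inj (can_inj mK)); apply: eq_bigr => z _.
  by rewrite A1m Bm.
- move=> x xD; have xR : x \notin R.
    by apply/negP => xR; have := mR xR; rewrite (pb_mdead Hp) // xR.
  rewrite mxE (bigD1 x) //= big1 ?addr0 => [|z zx].
    rewrite [B _ _]mxE (negPf xR) A2d ?mulr1; last by rewrite inE (negPf xD) andbF.
    have /negPf xq : x \notin q by apply: contra xR => /qR.
    by rewrite mxE (pb_mdead Hp) // eqxx xq.
  have [->|/sA1/eqP/(pb_dead Hp xD) E] := eqVneq (A1 x z) 0; first by rewrite mul0r.
  by rewrite E eqxx in zx.
rewrite ET; split.
- move=> x y; rewrite mxE /l; case: ifP => xR.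
    case: (x =P w y) => [E _|_]; last by rewrite /= eqxx.
    have yR : y \in R by rewrite -Rw -E.
    by rewrite yR E -l2m m2E ?mK ?Rw // ww.
  by move=> tN; have := Rt2 _ _ tN; rewrite xR => <-; apply: l2t.
- move=> x; rewrite /l mK; have [xR|xR] := boolP (x \in R).
    by rewrite (negPf (mR xR)).
  by case: ifP => // /negbT mx; rewrite -m2E' // l2m.
move=> x y yD yb; rewrite /l mxE; case: ifP => xR.
  by case: eqP => _; [exists 1|exists 0]; rewrite ?hornerC // !inE eqxx ?orbT.
case: ifP => yR; last by apply: l2e => //; rewrite inE yR.
have [->|/Rt2] := eqVneq (conj_mx A2 t2 x y) 0; last by rewrite xR yR.
by exists 0; rewrite ?hornerC // inE eqxx.
Qed.

End Merge.

End Terminal.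

(** * Normal forms of square-zero pairs *)

(** With trivial flags and everything matched, [m] and [th] arrange the classes in cycles. Longer
    cycles are shortened by merging, and a cycle of length one is solved outright; each time [D]
    loses indices. *)
Lemma cyclic_terminal (k : closedFieldType) n j (K : eqType) (kap : 'I_n -> K)
    m th (D : {set 'I_n}) (t : 'M[k]_n) b :
  (#|D| <= j)%N -> problem kap (fun=> 0%N) m th D t b ->
  (forall x, x \in D -> m x != x) -> cyclic_nice kap m D t b.
Proof.
elim: j K kap m th D t => [|j IHj] K kap m th D t Dj Hp mD.
  have D0 x : x \notin D by move: Dj; rewrite leqn0 cards_eq0 => /eqP->; rewrite inE.
  have -> : t = 1%:M by apply/matrixP => x y; rewrite (pb_dead_row Hp) // mxE.
  exists 1%:M, (fun=> 0); rewrite conj_mx1; split=> //; first exact: unitmx1.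
  - exact/supp1/kap_eq_refl.
  - by move=> x y; rewrite !mxE (inj_eq (can_inj (pb_mK Hp))).
  - by move=> x _; rewrite mxE eqxx.
  - by split=> // x y; rewrite (negPf (D0 y)).
have IH (K' : eqType) (kap' : 'I_n -> K') m' th' (D' : {set 'I_n}) (t' : 'M[k]_n) :
    (#|D'| < #|D|)%N -> problem kap' (fun=> 0%N) m' th' D' t' b ->
    (forall x, x \in D' -> m' x != x) -> cyclic_nice kap' m' D' t' b.
  by move=> D'D; apply: IHj; rewrite -ltnS (leq_trans D'D).
have [D0|[x xD]] := set_0Vmem D; first by apply: (IHj _ _ _ th) => //; rewrite D0 cards0.
(* Of the two classes of a space exactly one is marked, so the starting class can be taken on the
   marked side. *)
have [x0 x0D bx0] : exists2 x0, x0 \in D & b x0.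
  have [bx|bx] := boolP (b x); first by exists x.
  exists (th x); last by rewrite (pb_bth Hp).
  apply: contraT => /(pb_thdead Hp); rewrite (pb_thth Hp) => E.
  by case: (pb_live Hp xD).
case: (kap (m x0) =P kap (th x0)) => E; first exact: (cyclic_self_matched Hp mD IH x0D bx0 E).
have [A0 [w [_ _ ww _ wth]]] := bruhat (fun=> 0%N) (pb_thkap Hp) (pb_thth Hp) (pb_tt Hp) (pb_links Hp)
  (pb_live Hp) (pb_dead_rowcol Hp).
exact: (cyclic_merge Hp mD IH x0D E ww wth).
Qed.

Section Recursion.
Variables (k : closedFieldType) (n : nat).

(* A step refines [kap] and shrinks [D]; if it changes neither, all flags are
   trivial and every index is matched. *)
Definition kap_pairs (K : eqType) (kap : 'I_n -> K) : {set 'I_n * 'I_n} :=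
  [set xy | kap xy.1 == kap xy.2].

Lemma terminal_nice (K : eqType) (kap : 'I_n -> K) rho m th (D : {set 'I_n}) (t : 'M[k]_n) b :
  problem kap rho m th D t b -> (forall x, x \in D -> m x != x) ->
  (forall x y, kap x = kap y -> rho x = rho y) -> nice [:: 0; 1; 'X] kap rho m D t b.
Proof.
move=> Hp mD kr.
have pcE x y : piece kap (fun=> 0%N) x y = piece kap rho x y.
  apply/pieceP/pieceP => -[E _]; split=> //; exact: kr.
have Hp0 : problem kap (fun=> 0%N) m th D t b.
  have [? mpc mfree ? ? ? ? ? ? ? ? ? ?] := Hp; split=> // [x y|x]; rewrite !pcE.
    exact: mpc.
  exact: mfree.
have [A [l [uA sA mA _ ?]]] := cyclic_terminal (leqnn _) Hp0 mD.
exists A, l; split=> // x y /sA/eqP E; by rewrite /chain_le (kr _ _ E) E eqxx leqnn.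
Qed.

Lemma nice_mono (S S' : seq {poly k}) (K : eqType) (kap : 'I_n -> K) rho m (D : {set 'I_n}) (t : 'M[k]_n) b :
  {subset S <= S'} -> nice S kap rho m D t b -> nice S' kap rho m D t b.
Proof.
move=> SS' [A [l [? ? ? [? ? e]]]]; exists A, l; do 2?split=> //.
by move=> x y yD yb; have [p /SS' pS' ?] := e x y yD yb; exists p.
Qed.

Lemma nice_rec i : exists S : seq {poly k}, [/\ 0 \in S, 1 \in S &
  forall (K : eqType) (kap : 'I_n -> K) rho m th (D : {set 'I_n}) (t : 'M[k]_n) b,
  problem kap rho m th D t b -> (#|kap_pairs kap| + #|D| < i)%N -> nice S kap rho m D t b].
Proof.
elim: i => [|i [S [S0 S1 IH]]]; first by exists [:: 0; 1]; split; rewrite ?inE ?eqxx ?orbT.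
have [S' SS'] := sumprod_closure n S.
(* The first three polynomials serve the terminal case, [S'] a step that decreases the measure. The
   set is fixed before the problem is given. *)
exists ([:: 0; 1; 'X] ++ S'); split; rewrite ?mem_cat ?inE ?eqxx ?orbT //.
move=> K kap rho m th D t b Hp mu.
have [A0 [w [uA0 sA0 ww E0 wth]]] := bruhat rho (pb_thkap Hp) (pb_thth Hp) (pb_tt Hp)
  (pb_links Hp) (pb_live Hp) (pb_dead_rowcol Hp).
have [b' [b'pc b'm b'or]] := orientation Hp.
have Hp' := step_problem Hp uA0 sA0 ww wth b'pc b'm.
have Dsub : step_D m \subset D by apply/subsetP => x; apply: (step_D_sub Hp).
have Ksub : kap_pairs (step_kap kap rho m) \subset kap_pairs kap.
  by apply/subsetP => -[x y]; rewrite !inE => /eqP/step_kap_pc/pieceP[/eqP].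
have [lt|ge] := ltnP (#|kap_pairs (step_kap kap rho m)| + #|step_D m|)%N (#|kap_pairs kap| + #|D|)%N.
  apply: (@nice_mono S'); first by move=> p pS'; rewrite mem_cat pS' orbT.
  apply: (step_nice Hp uA0 sA0 ww E0 wth b'pc b'm b'or S0 S1 SS').
  by apply: IH Hp' _; rewrite -ltnS (leq_trans _ mu) // ltnS.
have ED : step_D m = D.
  apply/eqP; rewrite eqEcard Dsub -(leq_add2l #|kap_pairs kap|).
  by apply: leq_trans ge _; rewrite leq_add2r subset_leq_card.
have EK : kap_pairs (step_kap kap rho m) = kap_pairs kap.
  apply/eqP; rewrite eqEcard Ksub -(leq_add2r #|D|).
  by apply: leq_trans ge _; rewrite leq_add2l subset_leq_card.
apply: (@nice_mono [:: 0; 1; 'X]); first by move=> p pS; rewrite mem_cat pS.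
apply: (terminal_nice Hp) => [x|x y xy]; first by rewrite -ED inE.
have : (x, y) \in kap_pairs kap by rewrite inE xy.
by rewrite -EK inE => /eqP/step_kap_pc/pieceP[].
Qed.

Lemma problem_nice : exists S : seq {poly k}, [/\ 0 \in S &
  forall (K : eqType) (kap : 'I_n -> K) rho m th (D : {set 'I_n}) (t : 'M[k]_n) b,
  problem kap rho m th D t b -> nice S kap rho m D t b].
Proof.
have [S [S0 _ H]] := nice_rec (#|{: 'I_n * 'I_n}| + #|'I_n|).+1.
exists S; split=> // K kap rho m th D t b Hp; apply: (H _ _ _ _ _ _ _ _ Hp).
by rewrite ltnS leq_add // max_card.
Qed.

End Recursion.

Section Sides.
Variable d : nat.

Definition side (x : 'I_(d + d)) : bool := if split x is inl _ then false else true.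
Definition unside (x : 'I_(d + d)) : 'I_d := match split x with inl i | inr i => i end.
Definition in_side (i : bool) (x : 'I_d) : 'I_(d + d) := if i then rshift d x else lshift d x.
Definition swap_side (x : 'I_(d + d)) := in_side (~~ side x) (unside x).

Lemma side_in i x : side (in_side i x) = i.
Proof. by case: i; rewrite /side /in_side ?(unsplitK (inl x)) ?(unsplitK (inr x)). Qed.
Lemma unside_in i x : unside (in_side i x) = x.
Proof. by case: i; rewrite /unside /in_side ?(unsplitK (inl x)) ?(unsplitK (inr x)). Qed.
Lemma in_sideK x : in_side (side x) (unside x) = x.
Proof. by rewrite -[x]splitK /side /unside; case: (split x) => i; rewrite unsplitK. Qed.
Lemma swap_in i x : swap_side (in_side i x) = in_side (~~ i) x.
Proof. by rewrite /swap_side side_in unside_in. Qed.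
Lemma side_swap x : side (swap_side x) = ~~ side x.
Proof. by rewrite side_in. Qed.
Lemma swapK : involutive swap_side.
Proof. by move=> x; rewrite -[x]in_sideK !swap_in negbK. Qed.

Lemma sum_sides (R : nmodType) (F : 'I_(d + d) -> R) j :
  (forall x, side x != j -> F x = 0) -> \sum_x F x = \sum_x F (in_side j x).
Proof.
move=> F0; rewrite big_split_ord /=; case: j F0 => F0.
  by rewrite big1 ?add0r // => x _; rewrite F0 // (side_in false).
by rewrite addrC big1 ?add0r // => x _; rewrite F0 // (side_in true).
Qed.

End Sides.

Section SquareZeroPair.
Variables (k : closedFieldType) (d : nat).

Definition arrow_nice (S : seq {poly k}) (X : eqType) (g : 'I_d -> X) (a : bool -> bool -> 'M[k]_d) :=
  exists (B : 'M[k]_d) (l : 'I_d -> k),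
    [/\ B \in unitmx, forall x y, B x y != 0 -> g x = g y,
        forall j i x y, conj_mx B (a j i) x y != 0 -> l x = l y &
        forall j i x y, exists2 p, p \in S & conj_mx B (a j i) x y = p.[l y]].

Lemma arrow_normal_form : exists S : seq {poly k},
  forall (X : eqType) (g : 'I_d -> X) (a : bool -> bool -> 'M[k]_d),
  (forall j i, a j false *m a false i + a j true *m a true i = 0) ->
  (forall j i x y j' i' x' y', a j i x y != 0 -> a j' i' x' y' != 0 ->
     ((g x, j) == (g x', j')) = ((g y, i) == (g y', i'))) ->
  arrow_nice S g a.
Proof.
have [S [S0 main]] := problem_nice k (d + d).
exists S => X g a aa ga.
pose kap x := (g (unside x), side x).
pose N : 'M[k]_(d + d) := \matrix_(x, y) a (side x) (side y) (unside x) (unside y).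
have NE j i x y : N (in_side j x) (in_side i y) = a j i x y.
  by rewrite mxE !side_in !unside_in.
have NN : N *m N = 0.
  apply/matrixP => x y; pose a2 := a (side x) false *m a false (side y) + a (side x) true *m a true (side y).
  transitivity (a2 (unside x) (unside y)); last by rewrite /a2 aa !mxE.
  rewrite mxE big_split_ord [RHS]mxE; congr (_ + _); rewrite [RHS]mxE; apply: eq_bigr => z _.
    by rewrite -[lshift d z]/(in_side false z) !mxE !side_in !unside_in.
  by rewrite -[rshift d z]/(in_side true z) !mxE !side_in !unside_in.
have gN : graded kap N by move=> x y x' y'; rewrite !mxE; apply: ga.
have [A [m [top [uA sA mK topm alE]]]] := square_zero NN gN.
set al := conj_mx A N in alE.
have gal : graded kap al by apply: conj_graded.
(* Positions in the flag of the operator: 0 for its image, 1 for the homology inside the kernel, 2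
   for the vectors above the kernel. *)
pose rho x := if m x == x then 1%N else if top x then 2%N else 0%N.
have rho_m x : rho (m x) = (2 - rho x)%N.
  rewrite /rho mK [x == m x]eq_sym; have [//|mx] := eqVneq (m x) x.
  by rewrite topm //; case: (top x).
have rho1 x : (rho x == 1%N) = (m x == x).
  by rewrite /rho; case: ifP => // _; case: (top x).
have rho2 x : (rho x == 2%N) = (m x != x) && top x.
  by rewrite /rho; case: ifP => // _; case: (top x).
have rho_le x : (rho x <= 2)%N by rewrite /rho; case: ifP => // _; case: (top x).
have alP x : rho x = 2%N -> al (m x) x != 0.
  by move=> /eqP; rewrite rho2 alE mxE => ->; rewrite eqxx oner_neq0.
have mpc x y : piece kap rho x y -> piece kap rho (m x) (m y).
  move=> /pieceP[kxy rxy]; apply/pieceP; rewrite !rho_m rxy; split=> //.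
  have [r1|] := boolP (rho x == 1%N).
    have mx : m x = x by apply/eqP; rewrite -rho1.
    have my : m y = y by apply/eqP; rewrite -rho1 -rxy.
    by rewrite mx my.
  move=> nr1; have /orP[/eqP r2|/eqP r0] : (rho x == 2%N) || (rho x == 0%N).
    by move: nr1 (rho_le x); case: (rho x) => [|[|[|]]].
  - by apply/eqP; rewrite (gal _ _ _ _ (alP x r2) (alP y _)) -?rxy // kxy.
  - have m2 z : rho z = 0%N -> al z (m z) != 0 by move=> z0; rewrite -{1}[z]mK alP // rho_m z0.
    by apply/eqP; rewrite -(gal _ _ _ _ (m2 x r0) (m2 y _)) -?rxy // kxy.
have mfree x : m x != x -> ~~ piece kap rho x (m x).
  rewrite -rho1 => nr1; apply/pieceP => -[_]; rewrite rho_m => E.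
  by move: nr1 E (rho_le x); case: (rho x) => [|[|[|]]].
have swkap x y : kap x = kap y -> kap (swap_side x) = kap (swap_side y).
  by rewrite /kap !side_swap !unside_in => -[-> ->].
(* Both copies are the same space, and the swap is the identity between them, to be read in the
   bases adapted to the two flags. *)
pose W := perm_mat k (@swap_side d).
have uW : W *m W = 1%:M by apply: perm_mat_sq; apply: swapK.
have sA0 : supp (chain_le kap (fun=> 0%N)) A by apply: supp_chain_le0.
have Hp : problem kap rho m (@swap_side d) setT (conj_mx A W) (@side d).
  split=> //; try by move=> x; rewrite inE.
  - by move=> x; rewrite swapK.
  - by move=> x _; rewrite side_swap.
  - by move=> x y [].
  - by rewrite -conj_mx_mul // uW conj_mx_one.
  - apply: (conj_links swkap uA sA0) => x y; rewrite mxE.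
    by case: (x =P swap_side y) => [->|_]; rewrite /= ?eqxx // swapK.
have [A0 [w [uA0 sA0' ww E0 wth]]] := bruhat rho (pb_thkap Hp) (pb_thth Hp) (pb_tt Hp)
  (pb_links Hp) (pb_live Hp) (pb_dead_rowcol Hp).
(* This first step is not an instance of [step_nice]: here [t] shall become the permutation [w], so
   that both copies share one basis, and the matching shall be controlled, as it is the operator
   itself. The operator lives on the columns with [rho] equal to 2, hence this marking. *)
pose b' x := rho x == 2%N.
have b'pc x y : piece kap rho x y -> b' x = b' y by move=> /pieceP[_ E]; rewrite /b' E.
have b'm x : m x != x -> b' (m x) = ~~ b' x.
  rewrite -rho1 /b' rho_m; by move: (rho_le x); case: (rho x) => [|[|[|]]].
have Hp' := step_problem Hp uA0 sA0' ww wth b'pc b'm.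
have [A' [l [uA' sA' mA' [tl lm te]]]] := main _ _ _ _ _ _ _ _ Hp'.
have [A1 [uA1 sA1 A1W A1M]] := step_lift Hp uA0 sA0' ww E0 wth b'pc b'm uA' sA' mA'.
have lt' := conj_links (pb_thkap Hp') uA' sA' (pb_links Hp').
have [l1 [l1D l1w l1t]] := step_label Hp uA0 sA0' ww wth b'pc b'm lt' tl lm.
move: te lt' l1t; rewrite -A1M; set P := levi _ A1; set t2 := conj_mx P _ => te lt' l1t.
have uP : P \in unitmx by apply: levi_unit sA1 uA1; [exact: chain_le_refl|exact: chain_le_trans].
have t2r z y : rho y = 2%N -> t2 z y != 0 -> rho z = 0%N.
  move=> ry /lt'/step_kap_pc/pieceP[_]; rewrite ry rho_m.
  by case: (rho z) => [|[|]].
have PE x y : P x y = if piece kap rho x y then A1 x y else 0 by apply: levi_chainE.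
have sP x y : A1 x y != 0 -> rho x = rho y -> P x y = A1 x y.
  by move=> /sA1/andP[/eqP E _] E'; rewrite PE; case: pieceP => // -[].
(* The involution [t2] also contains the inverse maps from the image back to the top; the operator
   consists of the columns with [rho] equal to 2. *)
pose al' : 'M[k]_(d + d) := \matrix_(x, y) if rho y == 2%N then t2 x y else 0.
have A1al : A1 *m al' = al *m A1.
  apply/matrixP => x y; have -> : (al *m A1) x y = if rho (m x) == 2%N then A1 (m x) y else 0.
    rewrite mxE (bigD1 (m x)) //= alE mxE mK eqxx andbT big1 ?addr0 => [|z zx].
      by rewrite rho2 mK; case: ifP => _; rewrite ?mul1r ?mul0r.
    have xz : (x == m z) = false by apply: contraNF zx => /eqP->; rewrite mK.
    by rewrite mxE xz andbF mul0r.
  rewrite mxE; have [ry|ry] := boolP (rho y == 2%N); last first.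
    rewrite big1 => [|z _]; last by rewrite mxE (negPf ry) mulr0.
    case: eqP => // rmx; apply/esym/eqP/negPn/negP => /sA1/andP[_]; rewrite rmx => ly.
    by case/eqP: ry; apply/eqP; rewrite eqn_leq rho_le.
  transitivity ((P *m t2) x y).
    rewrite [RHS]mxE; apply: eq_bigr => z _; rewrite [al' _ _]mxE ry.
    have [->|/(t2r _ _ (eqP ry)) rz] := eqVneq (t2 z y) 0; first by rewrite !mulr0.
    have [A0'|A1n] := eqVneq (A1 x z) 0; first by rewrite A0' PE A0' if_same.
    rewrite -sP // rz; have /andP[_] := sA1 _ _ A1n.
    by rewrite rz leqn0 => /eqP.
  rewrite mul_conj_mx // perm_mat_mul // PE.
  case: eqP => [rmx|nrmx]; last first.
    by case: pieceP => // -[_ E]; case: nrmx; rewrite E; apply/eqP.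
  have [->|A1n] := eqVneq (A1 (m x) y) 0; first by rewrite if_same.
  by rewrite -PE sP // rmx (eqP ry).
pose Bt := A *m A1.
have uBt : Bt \in unitmx by rewrite unitmx_mul uA.
have Btal : Bt *m al' = N *m Bt by rewrite -mulmxA A1al mulmxA mul_conj_mx // mulmxA.
have Btw : Bt *m perm_mat k w = W *m Bt.
  by rewrite -A1W -mulmxA mul_conj_mx // mulmxA mul_conj_mx // mulmxA.
have kBt x y : Bt x y != 0 -> kap x = kap y.
  by move=> /mulmx_neq0[z /sA/eqP-> /sA1/andP[/eqP->]].
(* [u i s] is basis vector [s] as it appears in copy [i]. Since [w] matches the copies, both are
   described by the same matrix [B]. *)
pose u i s := if i then w (in_side false s) else in_side false s.
have side_w x : side (w x) = ~~ side x by have := wth x; rewrite -side_swap => -[].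
have side_u i s : side (u i s) = i.
  by case: i; rewrite /u ?side_w (side_in false).
pose B : 'M[k]_d := \matrix_(x, s) Bt (in_side false x) (in_side false s).
have BtE i x s : Bt (in_side i x) (u i s) = B x s.
  rewrite [RHS]mxE /u; case: i => //.
  have /matrixP/(_ (in_side true x) (in_side false s)) := Btw.
  by rewrite mul_perm_mat (perm_mat_mul (@swapK d)) swap_in.
have Bt0 x y : side x != side y -> Bt x y = 0.
  by apply: contraNeq => /kBt[_ ->].
have sum_u (F : 'I_(d + d) -> k) j :
    (forall x, side x != j -> F x = 0) -> \sum_x F x = \sum_x F (u j x).
  case: j => F0; last exact: (sum_sides F0).
  rewrite (reindex_inj (can_inj ww)) /=; apply: (@sum_sides _ _ _ false) => x sx.
  by rewrite F0 // side_w; case: (side x) sx.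
have uB : B \in unitmx.
  pose Bi : 'M[k]_d := \matrix_(x, s) invmx Bt (in_side false x) (in_side false s).
  have kBi x y : invmx Bt x y != 0 -> kap x = kap y.
    move=> H; apply/eqP; apply: (supp_inv (r := kap_eq kap) _ _ _ H).
    - exact: kap_eq_refl.
    - exact: kap_eq_trans.
    - by move=> p q /kBt E; apply/eqP.
  apply: (proj1 (mulmx1_unit (B := Bi) _)); apply/matrixP => x y.
  transitivity ((Bt *m invmx Bt) (in_side false x) (in_side false y)).
    rewrite mxE [RHS]mxE (@sum_sides _ _ _ false) => [|z sz]; last first.
      by rewrite Bt0 ?mul0r // (side_in false) eq_sym.
    by apply: eq_bigr => z _; rewrite [B _ _]mxE [Bi _ _]mxE.
  by rewrite mulmxV // !mxE /in_side (inj_eq (@lshift_inj _ _)).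
have conjE j i : conj_mx B (a j i) = \matrix_(x, s) al' (u j x) (u i s).
  apply: conj_mxE => //; apply/matrixP => x s.
  transitivity ((Bt *m al') (in_side j x) (u i s)).
    rewrite mxE [RHS]mxE (@sum_u _ j) => [|z sz]; last by rewrite Bt0 ?mul0r // side_in eq_sym.
    by apply: eq_bigr => z _; rewrite BtE [X in _ * X = _]mxE.
  rewrite Btal mxE [RHS]mxE (@sum_sides _ _ _ i) => [|z sz].
    by apply: eq_bigr => z _; rewrite BtE NE.
  by rewrite Bt0 ?mulr0 // side_u.
have lu i s : l1 (u i s) = l1 (in_side false s) by rewrite /u; case: i; rewrite ?l1w.
exists B, (fun s => l1 (in_side false s)); split=> //.
- by move=> x y; rewrite mxE => /kBt; rewrite /kap !unside_in => -[].
- move=> j i x y; rewrite conjE mxE [al' _ _]mxE; case: ifP => _; last by rewrite eqxx.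
  by move=> /l1t; rewrite !lu.
move=> j i x y; rewrite conjE mxE [al' _ _]mxE; case: ifP => ry; last first.
  by exists 0; rewrite ?horner0.
have uD : u i y \in step_D m by rewrite inE -rho1 (eqP ry).
have [p pS ->] := te (u j x) (u i y) uD ry.
by exists p => //; rewrite -l1D // lu.
Qed.

End SquareZeroPair.

From mathcomp Require Import finmap boolp classical_sets cardinality monalg.
Import Defs.

(** * Representations on a graded total space *)

Section Selection.
Variables (R : comNzRingType) (d : nat).

Definition sel_mx (P : {set 'I_d}) : 'M[R]_(#|P|, d) := \matrix_(i, s) (enum_val i == s)%:R.
Definition proj_on (P : {set 'I_d}) : 'M[R]_d := \matrix_(s, t) ((s == t) && (s \in P))%:R.

Lemma mul_sel n (P : {set 'I_d}) (A : 'M[R]_(d, n)) i t : (sel_mx P *m A) i t = A (enum_val i) t.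
Proof.
rewrite mxE (bigD1 (enum_val i)) //= mxE eqxx mul1r big1 ?addr0 // => s si.
by rewrite mxE eq_sym (negPf si) mul0r.
Qed.

Lemma mul_proj_on n (P : {set 'I_d}) (A : 'M[R]_(d, n)) s t :
  (proj_on P *m A) s t = if s \in P then A s t else 0.
Proof.
rewrite mxE (bigD1 s) //= mxE eqxx big1 ?addr0 => [|u us].
  by case: ifP => _; rewrite ?mul1r ?mul0r.
by rewrite mxE eq_sym (negPf us) mul0r.
Qed.

Lemma mulr_proj_on n (P : {set 'I_d}) (A : 'M[R]_(n, d)) s t :
  (A *m proj_on P) s t = if t \in P then A s t else 0.
Proof.
rewrite mxE (bigD1 t) //= mxE eqxx big1 ?addr0 => [|u us].
  by case: ifP => _; rewrite ?mulr1 ?mulr0.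
by rewrite mxE (negPf us) mulr0.
Qed.

Lemma selK (P : {set 'I_d}) : sel_mx P *m (sel_mx P)^T = 1%:M.
Proof. by apply/matrixP => i j; rewrite mul_sel !mxE (inj_eq enum_val_inj) eq_sym. Qed.

Lemma sel_disjoint (P Q : {set 'I_d}) : [disjoint P & Q] -> sel_mx P *m (sel_mx Q)^T = 0.
Proof.
move=> PQ; apply/matrixP => i j; rewrite mul_sel !mxE; case: eqP => // E.
by have := disjointFr PQ (enum_valP i); rewrite -E enum_valP.
Qed.

Lemma selTK (P : {set 'I_d}) : (sel_mx P)^T *m sel_mx P = proj_on P.
Proof.
apply/matrixP => s t; rewrite [RHS]mxE; have [sP|sP] := boolP (s \in P); last first.
  rewrite andbF mxE big1 // => i _; rewrite !mxE; case: eqP => [E|_]; last by rewrite mul0r.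
  by rewrite -E enum_valP in sP.
rewrite mxE (bigD1 (enum_rank_in sP s)) //= !mxE enum_rankK_in // eqxx mul1r andbT.
rewrite big1 ?addr0 // => i ni; rewrite !mxE; case: eqP => [E|_]; last by rewrite mul0r.
by case/eqP: ni; apply: enum_val_inj; rewrite enum_rankK_in.
Qed.

End Selection.

Section TotalRep.
Variables (k : fieldType) (O : finType) (A : lincat k O).
Variables (R : comNzRingType) (phi : {rmorphism k -> R}) (d : nat) (g : 'I_d -> O).

Definition fiber (L : {set 'I_d}) (x : O) : {set 'I_d} := [set s in L | g s == x].

(** All morphisms act on one space of dimension [d], extended by zero, so that every representation
    of total dimension [d] is given by matrices of one size, to be compared with finitely many
    patterns. Identities become projections. *)
Definition total_rep (r : forall x y, hom A x y -> 'M[R]_d) :=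
  [/\ forall x y a (f f' : hom A x y), r x y (a *: f + f') = phi a *: r x y f + r x y f',
      forall x, r x x (idm A x) = proj_on R (fiber [set: 'I_d]%SET x) &
      forall x y z (f' : hom A y z) (f : hom A x y), r x z (comp f' f) = r y z f' *m r x y f].

Definition stable_set (r : forall x y, hom A x y -> 'M[R]_d) (L : {set 'I_d}) :=
  forall x y (f : hom A x y) s t, r x y f s t != 0 -> (s \in L) = (t \in L).

Section SubRep.
Variables (r : forall x y, hom A x y -> 'M[R]_d) (L : {set 'I_d}).
Hypotheses (rr : total_rep r) (rL : stable_set r L).

Lemma total_supp x y (f : hom A x y) s t : r f s t != 0 -> g s = y /\ g t = x.
Proof.
have [_ r1 rM] := rr; move=> fst.
have E1 : r f = proj_on R (fiber [set: 'I_d]%SET y) *m r f by rewrite -r1 -rM comp1l.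
have E2 : r f = r f *m proj_on R (fiber [set: 'I_d]%SET x) by rewrite -r1 -rM comp1r.
split; apply/eqP.
  by move: fst; rewrite E1 mul_proj_on !inE; case: ifP => // _; rewrite eqxx.
by move: fst; rewrite E2 mulr_proj_on !inE; case: ifP => // _; rewrite eqxx.
Qed.

Lemma sub_absorb x y (f : hom A x y) :
  sel_mx R (fiber L y) *m r f *m proj_on R (fiber L x) = sel_mx R (fiber L y) *m r f.
Proof.
apply/matrixP => i t; rewrite mulr_proj_on; case: ifP => // tL; apply/esym.
rewrite mul_sel; apply/eqP/negPn/negP => H.
have [_ gt] := total_supp H; have := rL H; have := enum_valP i.
by rewrite inE => /andP[-> _] /esym tL'; rewrite inE tL' gt eqxx in tL.
Qed.

Definition sub_act x y (f : hom A x y) : 'M[R]_(#|fiber L y|, #|fiber L x|) :=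
  sel_mx R (fiber L y) *m r f *m (sel_mx R (fiber L x))^T.

Lemma sub_act_lin x y a (f f' : hom A x y) :
  sub_act (a *: f + f') = phi a *: sub_act f + sub_act f'.
Proof.
have [rl _ _] := rr.
by rewrite /sub_act rl mulmxDr mulmxDl -scalemxAr -scalemxAl.
Qed.

Lemma sub_act_id x : sub_act (idm A x) = 1%:M.
Proof.
have [_ r1 _] := rr; rewrite /sub_act r1 -[RHS](selK R (fiber L x)); congr (_ *m _).
apply/matrixP => i t; rewrite mulr_proj_on inE; case: ifP => //= gt.
rewrite mxE; case: eqP => // E; have := enum_valP i.
by rewrite E inE => /andP[_ gtx]; rewrite gtx inE in gt.
Qed.

Lemma sub_act_comp x y z (f' : hom A y z) (f : hom A x y) :
  sub_act (comp f' f) = sub_act f' *m sub_act f.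
Proof.
have [_ _ rM] := rr; rewrite /sub_act rM !mulmxA; congr (_ *m _).
by rewrite -[X in _ = X *m _]mulmxA selTK sub_absorb.
Qed.

Definition sub_rep : rep A phi :=
  @Rep _ _ A R phi (fun x => #|fiber L x|) sub_act sub_act_lin sub_act_id sub_act_comp.

End SubRep.

End TotalRep.

Lemma conj_proj_on (k : fieldType) (O : finType) d (g : 'I_d -> O) (B : 'M[k]_d) x :
  B \in unitmx -> (forall s t, B s t != 0 -> g s = g t) ->
  conj_mx B (proj_on k (fiber g [set: 'I_d]%SET x)) = proj_on k (fiber g [set: 'I_d]%SET x).
Proof.
move=> uB gB; apply: conj_mxE => //; apply/matrixP => s t; rewrite mulr_proj_on mul_proj_on !inE.
by have [->|/gB->//] := eqVneq (B s t) 0; rewrite !if_same.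
Qed.

Section Isorep.
Variables (k : fieldType) (O : finType) (A : lincat k O).

Lemma isorep_trans (U V W : frep A) : isorep U V -> isorep V W -> isorep U W.
Proof.
move=> [F [G [FG FA]]] [F' [G' [FG' FA']]].
exists (fun x => F' x *m F x), (fun x => G x *m G' x); split=> [x|x y f].
  have [FG1 GF1] := FG x; have [FG2 GF2] := FG' x; split.
    by rewrite mulmxA -[F' x *m _ *m _]mulmxA FG1 mulmx1.
  by rewrite mulmxA -[G x *m _ *m _]mulmxA GF2 mulmx1.
by rewrite -mulmxA FA mulmxA FA' mulmxA.
Qed.

Variables (d : nat) (g : 'I_d -> O).
Local Notation total := (total_rep (A := A) (idfun : {rmorphism k -> k}) g).

(* [V] seen in the coordinates of its total space [k^d], graded by [g]. *)
Definition realizes (V : frep A) (r : forall x y, hom A x y -> 'M[k]_d) :=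
  exists (io : forall x, 'M[k]_(d, dimv V x)) (pr : forall x, 'M[k]_(dimv V x, d)),
    [/\ forall x, pr x *m io x = 1%:M, forall x, io x *m pr x = proj_on k (fiber g [set: 'I_d]%SET x) &
        forall x y (f : hom A x y), r x y f = io y *m act V f *m pr x].

Lemma realizes_conj V r (B : 'M[k]_d) : B \in unitmx -> (forall s t, B s t != 0 -> g s = g t) ->
  total r -> realizes V r -> total (fun x y f => conj_mx B (r x y f)) /\
  realizes V (fun x y f => conj_mx B (r x y f)).
Proof.
move=> uB gB [rl r1 rM] [io [pr [pi ip rE]]].
split; first split.
- by move=> x y a f f'; rewrite rl /conj_mx mulmxDr mulmxDl -scalemxAr -scalemxAl.
- by move=> x; rewrite r1 conj_proj_on.
- by move=> x y z f' f; rewrite rM conj_mx_mul.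
exists (fun x => invmx B *m io x), (fun x => pr x *m B); split=> [x|x|x y f].
- by rewrite mulmxA mulmxK.
- by rewrite mulmxA -[_ *m _ *m pr x]mulmxA ip; apply: conj_proj_on.
- by rewrite rE /conj_mx !mulmxA.
Qed.

Lemma realizes_iso V r (rr : total r) (rT : stable_set r [set: 'I_d]%SET) :
  realizes V r -> isorep V (sub_rep rr rT).
Proof.
move=> [io [pr [pi ip rE]]].
exists (fun x => sel_mx k (fiber g [set: 'I_d]%SET x) *m io x),
       (fun x => pr x *m (sel_mx k (fiber g [set: 'I_d]%SET x))^T); split=> [x|x y f].
  split.
    rewrite mulmxA -[_ *m _ *m pr x]mulmxA ip -selTK mulmxA selK mul1mx selK //.
  rewrite mulmxA -[_ *m _ *m sel_mx k _]mulmxA selTK -ip !mulmxA. by rewrite pi mul1mx pi.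
rewrite /= /sub_act rE !mulmxA -[in RHS](mulmxA _ _ (sel_mx k _)) selTK -ip.
by rewrite -!mulmxA pi mulmx1 !mulmxA -[_ *m pr x *m io x]mulmxA pi mulmx1.
Qed.

Lemma realizes_dsum V r (L : {set 'I_d}) (rr : total r) (rL : stable_set r L)
    (rC : stable_set r (~: L)) :
  realizes V r -> isorep V (dsum (sub_rep rr rL) (sub_rep rr rC)).
Proof.
move=> [io [pr [pi ip rE]]].
have dis x : [disjoint fiber g L x & fiber g (~: L) x].
  by rewrite -setI_eq0; apply/eqP/setP => s; rewrite !inE; case: (s \in L); rewrite ?andbF.
have selP L' x : sel_mx k (fiber g L' x) *m proj_on k (fiber g [set: 'I_d]%SET x) = sel_mx k (fiber g L' x).
  apply/matrixP => i t; rewrite mulr_proj_on inE; case: ifP => //= gt.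
  rewrite mxE; case: eqP => // E; have := enum_valP i.
  by rewrite E inE => /andP[_ gtx]; rewrite gtx inE in gt.
have pio x : proj_on k (fiber g [set: 'I_d]%SET x) *m io x = io x.
  by rewrite -ip -mulmxA pi mulmx1.
have projD x : proj_on k (fiber g L x) + proj_on k (fiber g (~: L) x) = proj_on k (fiber g [set: 'I_d]%SET x).
  apply/matrixP => s t; rewrite !mxE !inE; case: (s \in L); case: (s == t) => //=;
    by rewrite ?addr0 ?add0r.
exists (fun x => col_mx (sel_mx k (fiber g L x) *m io x) (sel_mx k (fiber g (~: L) x) *m io x)),
  (fun x => row_mx (pr x *m (sel_mx k (fiber g L x))^T) (pr x *m (sel_mx k (fiber g (~: L) x))^T)).
split=> [x|x y f].
  split.
    have E L1 L2 : sel_mx k (fiber g L1 x) *m io x *m (pr x *m (sel_mx k (fiber g L2 x))^T) =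
        sel_mx k (fiber g L1 x) *m (sel_mx k (fiber g L2 x))^T.
      by rewrite mulmxA -[_ *m _ *m pr x]mulmxA ip selP.
    rewrite mul_col_row !E !selK !sel_disjoint //; first by rewrite -scalar_mx_block.
    by rewrite disjoint_sym.
  rewrite mul_row_col !mulmxA -![_ *m _^T *m _]mulmxA !selTK -mulmxDl -mulmxDr projD.
  by rewrite -ip mulmxA pi mul1mx pi.
rewrite /= /dsum_act mul_col_mx mul_block_col !mul0mx addr0 add0r /=.
have E L' (rL' : stable_set r L') : sub_act g r L' f *m (sel_mx k (fiber g L' x) *m io x) =
    sel_mx k (fiber g L' y) *m io y *m act V f.
  rewrite /sub_act mulmxA -[_ *m _^T *m _]mulmxA selTK (sub_absorb rr rL') rE.
  by rewrite !mulmxA -[_ *m pr x *m io x]mulmxA pi mulmx1.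
by rewrite !E.
Qed.

End Isorep.

Lemma realizes_exists (k : fieldType) (O : finType) (A : lincat k O) (V : frep A) d :
  rdim V = d -> exists (g : 'I_d -> O) r, total_rep (A := A) (idfun : {rmorphism k -> k}) g r /\ realizes g V r.
Proof.
move=> Vd; pose I := {x : O & 'I_(dimv V x)}.
have cI : #|{: I}| = d.
  rewrite card_tagged sumnE big_map big_enum -Vd; apply: eq_bigr => x _.
  by rewrite card_ord.
pose ph (s : 'I_d) : I := enum_val (cast_ord (esym cI) s).
pose ps (u : I) : 'I_d := cast_ord cI (enum_rank u).
have phK : cancel ph ps by move=> s; rewrite /ph /ps enum_valK cast_ordKV.
have psK : cancel ps ph by move=> u; rewrite /ph /ps cast_ordK enum_rankK.
pose g s := tag (ph s).
pose pr x : 'M[k]_(dimv V x, d) := \matrix_(i, s) (ph s == Tagged (fun x => 'I_(dimv V x)) i)%:R.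
pose io x : 'M[k]_(d, dimv V x) := (pr x)^T.
have pi0 x y : x != y -> pr x *m io y = 0.
  move=> xy; apply/matrixP => i j; rewrite mxE mxE big1 // => s _; rewrite !mxE.
  case: eqP => [->|_]; last by rewrite mul0r.
  by rewrite -tag_eqE /tag_eq /= (negPf xy) mulr0.
have pi x : pr x *m io x = 1%:M.
  apply/matrixP => i j; rewrite !mxE (bigD1 (ps (Tagged (fun x => 'I_(dimv V x)) i))) //= !mxE psK eqxx mul1r.
  rewrite eq_Tagged /= big1 ?addr0 // => s si; rewrite !mxE.
  case: eqP => [E|_]; last by rewrite mul0r.
  by rewrite -E phK eqxx in si.
have ip x : io x *m pr x = proj_on k (fiber g [set: 'I_d]%SET x).
  apply/matrixP => s t; rewrite [RHS]mxE !inE mxE.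
  have [E|ne] := eqVneq (g s) x; last first.
    rewrite /= andbF big1 // => i _; rewrite !mxE; case: eqP => [E|_]; last by rewrite mul0r.
    by rewrite /g E /= eqxx in ne.
  case: x / E; rewrite /= andbT (bigD1 (tagged (ph s))) //= !mxE.
  have -> : ph s == Tagged (fun x => 'I_(dimv V x)) (tagged (ph s)) by case: (ph s).
  rewrite mul1r big1 ?addr0 => [|i ni].
    have -> : Tagged (fun x => 'I_(dimv V x)) (tagged (ph s)) = ph s by case: (ph s).
    by rewrite (inj_eq (can_inj phK)) eq_sym.
  rewrite !mxE; case: eqP => [E|_]; last by rewrite mul0r.
  case/eqP: ni; move: E; rewrite /g; case: (ph s) i => x j i /=.
  by move/eqP; rewrite eq_Tagged => /eqP /= ->.
exists g, (fun x y f => io y *m act V f *m pr x); split; last by exists io, pr.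
split=> [x y a f f'|x|x y z f' f].
- by rewrite act_lin mulmxDr mulmxDl -scalemxAr -scalemxAl.
- by rewrite act_id mulmx1 ip.
- by rewrite act_comp !mulmxA -[_ *m pr y *m io y]mulmxA pi mulmx1.
Qed.

(** * A criterion for tameness *)

Section PolyExt.
Variables (k : closedFieldType) (La : k -> Prop).
Hypothesis infLa : ~ exists s : seq k, forall lam, La lam -> lam \in s.

Lemma poly_ext_infinite (p q : {poly k}) : (forall lam, La lam -> p.[lam] = q.[lam]) -> p = q.
Proof.
move=> pq; apply/eqP; rewrite -subr_eq0; apply: contrapT => /negP nz.
have [s ps] := closed_field_poly_normal (p - q).
apply: infLa; exists s => lam /pq E; have : root (p - q) lam by rewrite rootE !hornerE E subrr.
by rewrite ps rootZ ?lead_coef_eq0 // root_prod_XsubC.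
Qed.

Lemma mx_ext_infinite m n (P Q : 'M[{poly k}]_(m, n)) :
  (forall lam, La lam -> map_mx (horner_eval lam) P = map_mx (horner_eval lam) Q) -> P = Q.
Proof.
move=> PQ; apply/matrixP => i j; apply: poly_ext_infinite => lam /PQ/matrixP/(_ i j).
by rewrite !mxE.
Qed.

End PolyExt.

Section Criterion.
Variables (k : closedFieldType) (O : finType) (A : lincat k O).
Variables (Ga : finType) (gs gt : Ga -> O) (ge : forall c, hom A (gs c) (gt c)).

(** Stated as an induction principle, which avoids words in the generators. *)
Definition generates := forall Q : (forall x y, hom A x y -> Prop),
  (forall x y a (f f' : hom A x y), Q x y f -> Q x y f' -> Q x y (a *: f + f')) ->
  (forall x y, Q x y 0) -> (forall x, Q x x (idm A x)) ->
  (forall x y z (f' : hom A y z) (f : hom A x y), Q y z f' -> Q x y f -> Q x z (comp f' f)) ->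
  (forall c, Q (gs c) (gt c) (ge c)) -> forall x y f, Q x y f.

Hypothesis gen : generates.

Local Notation eval_mx lam := (map_mx (horner_eval (lam : k))).

Lemma rlin0 (R : comNzRingType) (phi : {rmorphism k -> R}) d (r : forall x y, hom A x y -> 'M[R]_d) x y :
  (forall a (f f' : hom A x y), r x y (a *: f + f') = phi a *: r x y f + r x y f') -> r x y 0 = 0.
Proof.
move=> rl; have := rl (-1) 0 0; rewrite scaler0 addr0 rmorphN rmorph1 scaleN1r addNr.
by [].
Qed.

Section Pattern.
Variables (d : nat) (g : 'I_d -> O) (c : Ga -> 'M[{poly k}]_d).
Local Notation total := (total_rep (A := A) (idfun : {rmorphism k -> k}) g).

Definition fits lam (r : forall x y, hom A x y -> 'M[k]_d) :=
  total r /\ forall e, r _ _ (ge e) = eval_mx lam (c e).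

Lemma fits_unique lam r r' : fits lam r -> fits lam r' -> forall x y f, r x y f = r' x y f.
Proof.
move=> [[rl r1 rM] re] [[rl' r1' rM'] re']; apply: gen.
- by move=> x y a f f' E E'; rewrite rl rl' E E'.
- by move=> x y; rewrite (rlin0 (rl x y)) (rlin0 (rl' x y)).
- by move=> x; rewrite r1 r1'.
- by move=> x y z f' f E E'; rewrite rM rM' E E'.
- by move=> e; rewrite re re'.
Qed.

Lemma stable_setT (R : comNzRingType) (r : forall x y, hom A x y -> 'M[R]_d) : stable_set r [set: 'I_d]%SET.
Proof. by move=> x y f s t _; rewrite !inE. Qed.

Lemma map_sel (P : {set 'I_d}) lam : eval_mx lam (sel_mx {poly k} P) = sel_mx k P.
Proof. by apply/matrixP => i s; rewrite !mxE rmorph_nat. Qed.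

(* If the pattern fits for infinitely many values of the parameter, then all
   relations hold identically over k[X]; otherwise finitely many modules remain. *)
Lemma pattern_cover : exists n (N : 'I_n -> polyrep A) m (E : 'I_m -> frep A),
  forall lam r (rr : total r) (rT : stable_set r [set: 'I_d]%SET), fits lam r ->
    (exists i, isorep (sub_rep rr rT) (specialize (N i) lam)) \/
    (exists j, isorep (sub_rep rr rT) (E j)).
Proof.
pose La lam := exists r, fits lam r.
have [[s sP]|inf] := pselect (exists s : seq k, forall lam, La lam -> lam \in s).
  (* Only finitely many parameters fit. One representation is kept for each, and [fits_unique] shows
     that it is the only one. *)
  pose s' := [seq lam <- s | `[< La lam >]].
  have LaE (j : 'I_(size s')) : La (tnth (in_tuple s') j).
    by have := mem_tnth j (in_tuple s'); rewrite mem_filter => /andP[/asboolP].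
  pose rj j := projT1 (cid (LaE j)).
  have rjP j : fits (tnth (in_tuple s') j) (rj j) := projT2 (cid (LaE j)).
  have n0 (T : Type) : 'I_0 -> T by case.
  exists 0, (n0 _), (size s'), (fun j => sub_rep (proj1 (rjP j)) (@stable_setT _ (rj j))).
  move=> lam r rr rT fr; right.
  have ls : lam \in s' by rewrite mem_filter sP ?andbT; [apply/asboolP; exists r|exists r].
  have /(tnthP (in_tuple s'))[j lE] : lam \in in_tuple s' by [].
  exists j; have rE := fits_unique fr; rewrite lE in rE.
  exists (fun x => 1%:M), (fun x => 1%:M); split=> [x|x y f]; first by rewrite mulmx1.
  by rewrite mul1mx mulmx1 /= /sub_act (rE _ (rjP j)).
(* The polynomial matrix of a morphism is built along its generation. Its values at infinitely many
   parameters are prescribed, so it does not depend on how the morphism was generated. *)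
have H x y (f : hom A x y) : exists F : 'M[{poly k}]_d, forall lam r, fits lam r -> eval_mx lam F = r x y f.
  move: x y f; apply: gen.
  - move=> x y a f f' [F FE] [F' FE']; exists (a%:P *: F + F') => lam r fr.
    have [[rl _ _] _] := fr.
    by rewrite map_mxD map_mxZ (FE _ _ fr) (FE' _ _ fr) rl /= /horner_eval hornerC.
  - move=> x y; exists 0 => lam r [[rl _ _] _].
    by rewrite map_mx0 (rlin0 (rl x y)).
  - move=> x; exists (proj_on _ (fiber g [set: 'I_d]%SET x)) => lam r [[_ r1 _] _].
    by rewrite r1; apply/matrixP => i j; rewrite !mxE rmorph_nat.
  - move=> x y z f' f [F' FE'] [F FE]; exists (F' *m F) => lam r fr.
    have [[_ _ rM] _] := fr.
    by rewrite map_mxM (FE _ _ fr) (FE' _ _ fr) rM.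
  - by move=> e; exists (c e) => lam r [_ ->].
pose F x y f := projT1 (cid (H x y f)).
have FE x y f lam r : fits lam r -> eval_mx lam (F x y f) = r x y f := projT2 (cid (H x y f)) lam r.
have FF : total_rep (A := A) (polyC : {rmorphism k -> {poly k}}) g F.
  split.
  - move=> x y a f f'; apply: (mx_ext_infinite inf) => lam [r fr].
    have [[rl _ _] _] := fr.
    by rewrite map_mxD map_mxZ !(FE _ _ _ _ _ fr) rl /= /horner_eval hornerC.
  - move=> x; apply: (mx_ext_infinite inf) => lam [r fr].
    have [[_ r1 _] _] := fr; rewrite (FE _ _ _ _ _ fr) r1.
    by apply/matrixP => i j; rewrite !mxE rmorph_nat.
  - move=> x y z f' f; apply: (mx_ext_infinite inf) => lam [r fr].
    have [[_ _ rM] _] := fr.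
    by rewrite map_mxM !(FE _ _ _ _ _ fr) rM.
have n0 (T : Type) : 'I_0 -> T by case.
exists 1, (fun=> sub_rep FF (@stable_setT _ F)), 0, (n0 _) => lam r rr rT fr; left.
exists ord0, (fun x => 1%:M), (fun x => 1%:M); split=> [x|x y f]; first by rewrite mulmx1.
rewrite mul1mx mulmx1 /= /spec_act /= /sub_act !map_mxM -map_trmx !map_sel.
by rewrite (FE _ _ _ _ _ fr).
Qed.

End Pattern.

Hypothesis normal : forall d, exists S : seq {poly k},
  forall (g : 'I_d -> O) r, total_rep (A := A) (idfun : {rmorphism k -> k}) g r ->
  exists (B : 'M[k]_d) (l : 'I_d -> k), [/\ B \in unitmx, forall s t, B s t != 0 -> g s = g t,
    forall e s t, conj_mx B (r _ _ (ge e)) s t != 0 -> l s = l t &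
    forall e s t, exists2 p, p \in S & conj_mx B (r _ _ (ge e)) s t = p.[l t]].

Lemma label_stable d (r : forall x y, hom A x y -> 'M[k]_d) (l : 'I_d -> k) (L : {set 'I_d}) g :
  total_rep (A := A) (idfun : {rmorphism k -> k}) g r ->
  (forall s t, l s = l t -> (s \in L) = (t \in L)) ->
  (forall e s t, r _ _ (ge e) s t != 0 -> l s = l t) -> stable_set r L.
Proof.
move=> [rl r1 rM] lL re x y f s t fst; apply: lL; move: fst; move: s t.
move: x y f; apply: gen.
- move=> x y a f f' E E' s t; rewrite rl !mxE; have [->|/E//] := eqVneq (r x y f s t) 0.
  by rewrite mulr0 add0r => /E'.
- by move=> x y s t; rewrite (rlin0 (rl x y)) mxE eqxx.
- move=> x s t; rewrite r1 mxE; case: (s =P t) => [->//|_]; by rewrite /= eqxx.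
- by move=> x y z f' f E E' s t; rewrite rM => /mulmx_neq0[u /E-> /E'->].
- exact: re.
Qed.

Lemma tame_criterion : tame A.
Proof.
move=> d; have [S HS] := normal d.
(* A pattern fixes the grading of the coordinates and a polynomial of [S] for every entry of every
   generator; for given [d] there are finitely many patterns. *)
pose Pt := ({ffun 'I_d -> O} * {ffun Ga * 'I_d * 'I_d -> 'I_(size S)})%type.
pose cP (P : Pt) (e : Ga) : 'M[{poly k}]_d := \matrix_(s, t) S`_(P.2 (e, s, t)).
pose gP (P : Pt) (s : 'I_d) : O := P.1 s.
pose D := {n & 'I_n -> polyrep A} : Type; pose D' := {m & 'I_m -> frep A} : Type.
have cover (P : Pt) : exists x : D * D',
    forall lam r (rr : total_rep (A := A) (idfun : {rmorphism k -> k}) (gP P) r) (rT : stable_set r [set: 'I_d]%SET),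
    fits (gP P) (cP P) lam r ->
    (exists i, isorep (sub_rep rr rT) (specialize (projT2 x.1 i) lam)) \/
    (exists j, isorep (sub_rep rr rT) (projT2 x.2 j)).
  have [n [N [m [E H]]]] := pattern_cover (gP P) (cP P).
  by exists (existT _ n N, existT _ m E).
have [X XP] := choice cover.
pose I := {P : Pt & 'I_(projT1 (X P).1)}; pose J := {P : Pt & 'I_(projT1 (X P).2)}.
pose NI (i : I) := projT2 (X (tag i)).1 (tagged i).
pose EJ (j : J) := projT2 (X (tag j)).2 (tagged j).
exists #|{: I}|, (fun i => NI (enum_val i)), #|{: J}|, (fun j => EJ (enum_val j)).
move=> V [V0 Vind] Vd.
have [g [r0 [tr0 rV0]]] := realizes_exists Vd.
have [B [l [uB gB lB eB]]] := HS g r0 tr0.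
pose r x y f := conj_mx B (r0 x y f).
have [tr rV] := realizes_conj uB gB tr0 rV0.
rewrite -/r in tr rV.
have d0 : (0 < d)%N by rewrite -Vd.
pose s0 := Ordinal d0; pose L := [set s | l s == l s0].
have lL s t : l s = l t -> (s \in L) = (t \in L) by move=> E; rewrite !inE E.
have rL : stable_set r L by apply: label_stable tr lL lB.
have rC : stable_set r (~: L).
  by apply: (label_stable tr _ lB) => s t E; rewrite !finset.in_setC (lL _ _ E).
(* Labels split the representation into two summands, and the one containing [s0] is nonzero. *)
have one s : l s = l s0.
  have [E|E] := Vind _ _ (realizes_dsum tr rL rC rV).
    move/eqP: E; rewrite /rdim sum_nat_eq0 => /forallP/(_ (g s0)) /=.
    by rewrite cards_eq0 => /eqP/setP/(_ s0); rewrite !inE !eqxx.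
  apply/eqP; apply: contraT => sL.
  move/eqP: E; rewrite /rdim sum_nat_eq0 => /forallP/(_ (g s)) /=.
  by rewrite cards_eq0 => /eqP/setP/(_ s); rewrite !inE (negPf sL) eqxx.
have ex (x : Ga * 'I_d * 'I_d) : exists i : 'I_(size S),
    r _ _ (ge x.1.1) x.1.2 x.2 = (S`_i).[l s0].
  have [p pS E] := eB x.1.1 x.1.2 x.2; rewrite one in E.
  have iS : (index p S < size S)%N by rewrite index_mem.
  by exists (Ordinal iS); rewrite /= nth_index.
have [ix ixP] := fin_all_exists ex.
pose P : Pt := ([ffun s => g s], [ffun x => ix x]).
have gE : gP P = g by apply: funext => s; rewrite /gP ffunE.
have fr : fits g (cP P) (l s0) r.
  split=> // e; apply/matrixP => s t; have := ixP (e, s, t); rewrite /= => ->.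
  by rewrite [RHS]mxE mxE /= ffunE.
move: (XP P (l s0) r); rewrite gE => /(_ tr (@stable_setT _ _ r) fr).
have Viso := realizes_iso tr (@stable_setT _ _ r) rV.
case=> [[i iP]|[j jP]]; [left|right].
  exists (enum_rank (Tagged (fun P => 'I_(projT1 (X P).1)) i)), (l s0).
  by rewrite enum_rankK; apply: isorep_trans Viso iP.
exists (enum_rank (Tagged (fun P => 'I_(projT1 (X P).2)) j)).
by rewrite enum_rankK; apply: isorep_trans Viso jP.
Qed.

End Criterion.

(** * Slots at the vertices *)

(** For the arrows [u] into a vertex and [v] out of it, [Z] says that a composite is zero. With two
    arrows on each side, the hypotheses make one of the two perfect matchings consist of zero
    composites, and its pairs share the slots. *)
Lemma slot_choice (E : eqType) (Z : E -> E -> Prop) (u v : seq E) :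
  uniq u -> uniq v -> (size u <= 2)%N -> (size v <= 2)%N ->
  (forall a b c, a \in u -> b \in v -> c \in v -> b != c -> Z a b \/ Z a c) ->
  (forall a b c, a \in u -> b \in u -> c \in v -> a != b -> Z a c \/ Z b c) ->
  exists p q : E -> bool, [/\ {in u &, injective p}, {in v &, injective q} &
    forall a b, a \in u -> b \in v -> p a = q b -> Z a b].
Proof.
case: u => [|a1 [|a2 [|]]] // + + _.
- case: v => [|b1 [|b2 [|]]] // _ + _ _ _.
  + by exists xpred0, xpred0.
  + by exists xpred0, xpred0; split=> // x y; rewrite !inE => /eqP-> /eqP->.
  + rewrite /= inE andbT => b12; exists xpred0, (pred1 b1); split=> // x y.
    by rewrite !inE /= => /orP[]/eqP-> /orP[]/eqP-> //; rewrite eqxx eq_sym (negPf b12).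
- case: v => [|b1 [|b2 [|]]] // _ + _ h1 h2.
  + exists xpred0, xpred0; split=> // x y; by rewrite !inE => /eqP-> /eqP->.
  + exists xpred0, xpredT; split=> // x y; rewrite !inE => /eqP-> /eqP->//.
  + rewrite /= inE andbT => b12.
    have [Z1|Z2] : Z a1 b1 \/ Z a1 b2 by apply: h1; rewrite ?inE ?eqxx ?orbT.
      exists xpredT, (pred1 b1); split=> // x y; rewrite !inE /=.
      - by move=> /eqP-> /eqP->.
      - by move=> /orP[]/eqP-> /orP[]/eqP-> //; rewrite eqxx eq_sym (negPf b12).
      - by move=> /eqP-> /orP[]/eqP-> //; rewrite eq_sym (negPf b12).
    exists xpredT, (pred1 b2); split=> // x y; rewrite !inE /=.
    - by move=> /eqP-> /eqP->.
    - by move=> /orP[]/eqP-> /orP[]/eqP-> //; rewrite eqxx (negPf b12).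
    - by move=> /eqP-> /orP[]/eqP-> //; rewrite (negPf b12).
rewrite /= inE andbT => a12.
have pI c : c \in [:: a1; a2] -> {in [:: a1; a2] &, injective (pred1 c)}.
  rewrite !inE => /orP[]/eqP-> x y; rewrite !inE /= => /orP[]/eqP-> /orP[]/eqP-> //;
    by rewrite eqxx ?(negPf a12) // eq_sym (negPf a12).
case: v => [|b1 [|b2 [|]]] // + _ h1 h2.
- by exists (pred1 a1), xpred0; split=> //; apply: pI; rewrite inE eqxx.
- move=> _; have [Z1|Z2] : Z a1 b1 \/ Z a2 b1 by apply: h2; rewrite ?inE ?eqxx ?orbT.
    exists (pred1 a1), xpredT; split; first by apply: pI; rewrite inE eqxx.
      by move=> x y; rewrite !inE => /eqP-> /eqP->.
    by move=> x y; rewrite !inE /= => /orP[]/eqP-> /eqP-> //; rewrite eq_sym (negPf a12).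
  exists (pred1 a2), xpredT; split; first by apply: pI; rewrite !inE eqxx orbT.
    by move=> x y; rewrite !inE => /eqP-> /eqP->.
  by move=> x y; rewrite !inE /= => /orP[]/eqP-> /eqP-> //; rewrite (negPf a12).
rewrite /= inE andbT => b12.
have qI c : c \in [:: b1; b2] -> {in [:: b1; b2] &, injective (pred1 c)}.
  rewrite !inE => /orP[]/eqP-> x y; rewrite !inE /= => /orP[]/eqP-> /orP[]/eqP-> //;
    by rewrite eqxx ?(negPf b12) // eq_sym (negPf b12).
have [[Z11 Z22]|nZ] := pselect (Z a1 b1 /\ Z a2 b2).
  exists (pred1 a1), (pred1 b1); split; [by apply: pI; rewrite inE eqxx|by apply: qI; rewrite inE eqxx|].
  move=> x y; rewrite !inE /= => /orP[]/eqP-> /orP[]/eqP-> //; rewrite !eqxx ?(eq_sym b2) ?(negPf b12) //.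
  by rewrite eq_sym (negPf a12).
have [Z12 Z21] : Z a1 b2 /\ Z a2 b1.
  have A11 : Z a1 b1 \/ Z a1 b2 by apply: h1; rewrite ?inE ?eqxx ?orbT.
  have A22 : Z a2 b1 \/ Z a2 b2 by apply: h1; rewrite ?inE ?eqxx ?orbT.
  have B11 : Z a1 b1 \/ Z a2 b1 by apply: h2; rewrite ?inE ?eqxx ?orbT.
  have B22 : Z a1 b2 \/ Z a2 b2 by apply: h2; rewrite ?inE ?eqxx ?orbT.
  by split; tauto.
exists (pred1 a1), (pred1 b2); split; [by apply: pI; rewrite inE eqxx|by apply: qI; rewrite !inE eqxx orbT|].
move=> x y; rewrite !inE /= => /orP[]/eqP-> /orP[]/eqP-> //; rewrite !eqxx ?(negPf b12) //.
by rewrite eq_sym (negPf a12).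
Qed.

Section Slots.
Variables (k : fieldType) (disp : Order.disp_t) (T : thread_quiver disp).
Hypothesis hT : biserial_quiver T.
Variable I : ideal (path_cat k T).
Hypotheses (sb1 : SB1 at_least_one I) (sb2 : SB2 at_least_one I).

Definition slots (si so : arrow T -> bool) :=
  [/\ forall a b, tgt a = tgt b -> si a = si b -> a = b,
      forall a b, src a = src b -> so a = so b -> a = b &
      forall a b (e : tgt a = src b), si a = so b -> subfamily (quadI (k := k) e) I].

Lemma slots_exist : exists si so, slots si so.
Proof.
(* Quantifying over [e] turns the condition into a relation on all pairs of arrows; proofs of [e]
   are unique. *)
pose Z (a b : arrow T) := forall e : tgt a = src b, subfamily (quadI (k := k) e) I.
have ZI a b (e : tgt a = src b) : subfamily (quadI (k := k) e) I -> Z a b.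
  by move=> H e'; rewrite (eq_irrelevance e' e).
have loc (x : vertex T) : exists pq : (arrow T -> bool) * (arrow T -> bool),
    [/\ forall a b, tgt a = x -> tgt b = x -> pq.1 a = pq.1 b -> a = b,
        forall a b, src a = x -> src b = x -> pq.2 a = pq.2 b -> a = b &
        forall a b, tgt a = x -> src b = x -> pq.1 a = pq.2 b -> Z a b].
  pose u := enum [pred a : arrow T | tgt a == x]; pose v := enum [pred a : arrow T | src a == x].
  have uE a : (a \in u) = (tgt a == x) by rewrite mem_enum.
  have vE a : (a \in v) = (src a == x) by rewrite mem_enum.
  have [sv su] := hT x.
  have [||||||p [q [pI qI pq]]] := @slot_choice _ Z u v.
  - exact: enum_uniq.
  - exact: enum_uniq.
  - by rewrite -cardE.
  - by rewrite -cardE.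
  - move=> a b c; rewrite uE !vE => /eqP ax /eqP bx /eqP cx bc.
    have eb : tgt a = src b by rewrite ax. have ec : tgt a = src c by rewrite ax.
    by case: (sb1 eb ec (elimN eqP bc)) => /ZI; [left|right].
  - move=> a b c; rewrite !uE vE => /eqP ax /eqP bx /eqP cx ab.
    have ea : tgt a = src c by rewrite ax. have eb : tgt b = src c by rewrite bx.
    by case: (sb2 ea eb (elimN eqP ab)) => /ZI; [left|right].
  exists (p, q); split=> a b ax bx /=.
  - by apply: pI; rewrite uE; apply/eqP.
  - by apply: qI; rewrite vE; apply/eqP.
  - by apply: pq; rewrite ?uE ?vE; apply/eqP.
have [f fP] := choice loc.
exists (fun a => (f (tgt a)).1 a), (fun b => (f (src b)).2 b); split.
- by move=> a b e; have [h _ _] := fP (tgt b); rewrite e; apply: h.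
- by move=> a b e; have [_ h _] := fP (src b); rewrite e; apply: h.
- by move=> a b e; have [_ _ h] := fP (src b); rewrite e => /(h a b e erefl).
Qed.

End Slots.

(** * Generators of the path category *)

Lemma existT_inj (J : eqType) (P : J -> Type) j (x y : P j) :
  existT P j x = existT P j y -> x = y.
Proof. by move=> E; rewrite -[RHS](projT2_eq E) (eq_irrelevance (projT1_eq E) erefl). Qed.

Lemma malg_span (k : fieldType) (B : choiceType) (P : {malg k[B]} -> Prop) :
  (forall a f g, P f -> P g -> P (a *: f + g)) -> P 0 -> (forall b, P << b >>) ->
  forall f, P f.
Proof.
move=> Plin P0 PU f; rewrite [f]monalgE; elim/big_ind: _ => [//|x y Px Py|b _].
  by rewrite -[x]scale1r; apply: Plin.
have -> : << f@_b *g b >> = f@_b *: << b >> + 0 :> {malg k[B]}.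
  by apply/malgP => c; rewrite addr0 mcoeffZ !mcoeffU mulrnAr mulr1.
exact: Plin.
Qed.

Section BarOrder.
Variables (disp : Order.disp_t) (T : thread_quiver disp) (a : arrow T).
Implicit Types x y z : bar a.

Lemma ble_total x y : ble x y || ble y x.
Proof. by case: x y => [|x|] [|y|] //=; apply: le_total. Qed.

Lemma ble_anti x y : ble x y -> ble y x -> x = y.
Proof.
case: x y => [|x|] [|y|] //= xy yx; congr bmid.
by apply: le_anti; rewrite xy.
Qed.

Lemma pt_inj : injective (@pt _ T a).
Proof. by move=> x y [] /eqP; rewrite -tag_eqE /tag_eq /= eqxx tagged_asE => /eqP. Qed.

Lemma bobj_mid_inj (x y : bar a) (u : thread a) : x = bmid u -> bobj x = bobj y -> x = y.
Proof.
by move=> ->; case: y => //= v E; congr bmid; apply: pt_inj.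
Qed.

End BarOrder.

Section Generators.
Variables (k : closedFieldType) (disp : Order.disp_t) (T : thread_quiver disp).
Local Notation C := (path_cat k T).
Variables (si so : arrow T -> bool).
Hypothesis si_inj : forall a b, tgt a = tgt b -> si a = si b -> a = b.
Hypothesis so_inj : forall a b, src a = src b -> so a = so b -> a = b.
Variable M : {fset obj T}.
Hypothesis MV : forall x : vertex T, vtx x \in M.

(** Neighbouring sample points on one thread. Working in [bar a] instead of the objects keeps the
    two ends of a loop apart. *)
Definition consecutive (a : arrow T) (x y : bar a) :=
  [/\ bobj x \in M, bobj y \in M, ~~ ble y x &
      forall z : bar a, bobj z \in M -> ~~ ble z x -> ble y z].

Record gen := Gen { gen_arrow : arrow T; gen_src : bar gen_arrow; gen_tgt : bar gen_arrow;
  gen_le : ble gen_src gen_tgt; gen_consec : consecutive gen_src gen_tgt }.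

(** At an interior point the outgoing generator gets slot [true] and the incoming one slot [false].
    The slots differ, so no zero relation is claimed there. *)
Definition out_slot (a : arrow T) (x : bar a) := if x is bmin then so a else true.
Definition in_slot (a : arrow T) (x : bar a) := if x is bmax then si a else false.

Lemma gen_src_max (c : gen) : gen_src c <> bmax _.
Proof. by case: c => a x y xy [_ _ + _] /= E; rewrite E ble_max. Qed.
Lemma gen_tgt_min (c : gen) : gen_tgt c <> bmin _.
Proof. by case: c => a x y xy [_ _ + _] /= E; rewrite E. Qed.

Lemma bobj_out (a a' : arrow T) (x : bar a) (x' : bar a') : x <> bmax _ -> x' <> bmax _ ->
  bobj x = bobj x' -> out_slot x = out_slot x' -> existT _ a x = existT _ a' x'.
Proof.
case: x x' => [|x|] [|x'|] //= _ _.
  by move=> [sa] /(so_inj sa) E; case: a' / E sa.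
move=> E _; have [aa'] := E; case: a' / aa' x' E => x' E.
by rewrite (pt_inj E).
Qed.

Lemma bobj_in (a a' : arrow T) (x : bar a) (x' : bar a') : x <> bmin _ -> x' <> bmin _ ->
  bobj x = bobj x' -> in_slot x = in_slot x' -> existT _ a x = existT _ a' x'.
Proof.
case: x x' => [|x|] [|x'|] //= _ _.
  move=> E _; have [aa'] := E; case: a' / aa' x' E => x' E.
  by rewrite (pt_inj E).
by move=> [ta] /(si_inj ta) E; case: a' / E ta.
Qed.

Lemma gen_eq a (x y : bar a) xy c xy' c' : @Gen a x y xy c = @Gen a x y xy' c'.
Proof. by rewrite (bool_irrelevance xy xy') (Prop_irrelevance c c'). Qed.

Lemma gen_out_inj (c c' : gen) : bobj (gen_src c) = bobj (gen_src c') ->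
  out_slot (gen_src c) = out_slot (gen_src c') -> c = c'.
Proof.
move=> E S; have := bobj_out (@gen_src_max c) (@gen_src_max c') E S.
move: c c' {E S} => [a x y xy co] [a' x' y' xy' co'] /= E.
case: (E) => aa'; case: a' / aa' x' y' E xy' co' => x' y' E xy' co'.
have xx' : x = x' by exact: existT_inj E.
case: x' / xx' {E} xy' co' => xy' co'.
have yy' : y = y'.
  have [_ yM yx ymin] := co; have [_ yM' yx' ymin'] := co'.
  by apply: ble_anti; [apply: ymin|apply: ymin'].
by case: y' / yy' xy' co' => xy' co' _; apply: gen_eq.
Qed.

Lemma gen_in_inj (c c' : gen) : bobj (gen_tgt c) = bobj (gen_tgt c') ->
  in_slot (gen_tgt c) = in_slot (gen_tgt c') -> c = c'.
Proof.
move=> E S; have := bobj_in (@gen_tgt_min c) (@gen_tgt_min c') E S.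
move: c c' {E S} => [a x y xy co] [a' x' y' xy' co'] /= E.
case: (E) => aa'; case: a' / aa' x' y' E xy' co' => x' y' E xy' co'.
have yy' : y = y' by exact: existT_inj E.
case: y' / yy' {E} xy' co' => xy' co'.
have xx' : x = x'.
  have [xM _ yx ymin] := co; have [xM' _ yx' ymin'] := co'.
  apply: ble_anti; apply: contraT => nle.
    by have := ymin' _ xM nle; rewrite (negPf yx).
  by have := ymin _ xM' nle; rewrite (negPf yx').
by case: x' / xx' xy' co' => xy' co' _; apply: gen_eq.
Qed.

Section Generation.
Variable Q : forall u v, u \in M -> v \in M -> hom C u v -> Prop.
Hypothesis Qlin : forall u v hu hv a (f f' : hom C u v),
  @Q u v hu hv f -> @Q u v hu hv f' -> @Q u v hu hv (a *: f + f').
Hypothesis Q0 : forall u v hu hv, @Q u v hu hv 0.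
Hypothesis Qid : forall u hu, @Q u u hu hu (idm C u).
Hypothesis Qcomp : forall u v w hu hv hw (f' : hom C v w) (f : hom C u v),
  @Q v w hv hw f' -> @Q u v hu hv f -> @Q u w hu hw (comp f' f).
Hypothesis Qgen : forall (c : gen) hu hv,
  @Q (bobj (gen_src c)) (bobj (gen_tgt c)) hu hv (eta k (gen_le c)).

Let between a (x y : bar a) (w : M) :=
  exists z : bar a, [/\ bobj z = val w, ~~ ble z x & ~~ ble y z].
Let nb a (x y : bar a) := #|[pred w : M | `[< between x y w >]]|.

(** Induction on the number of sample points strictly between [x] and [y]; if there are none, the
    morphism is an identity or a generator. *)
Lemma Q_eta a (x y : bar a) (xy : ble x y) hu hv : @Q (bobj x) (bobj y) hu hv (eta k xy).
Proof.
move En : (nb x y) => n; elim/ltn_ind: n x y xy hu hv En => n IH x y xy hu hv En.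
have [yx|yx] := boolP (ble y x).
  have E := ble_anti xy yx; case: y / E xy hv {yx En} => xx hv.
  by rewrite eta_id (bool_irrelevance hv hu); apply: Qid.
have [[w [z [zw zx yz]]]|none] := pselect (exists w, between x y w); last first.
  have co : consecutive x y.
    split=> // z zM zx; apply: contraT => yz; case: none.
    by exists [` zM]%fset, z.
  exact: (@Qgen (Gen xy co)).
have zM : bobj z \in M by rewrite zw; apply: valP.
have xz : ble x z by have := ble_total x z; rewrite (negPf zx) orbF.
have zy : ble z y by have := ble_total z y; rewrite (negPf yz) orbF.
(* A point strictly between two others is interior, hence determined by its object even on a
   loop. *)
have [u zu] : exists u, z = bmid u.
  by move: zx yz xz zy; case: (z) => [|u|]; [|exists u|rewrite ble_max].
have less (x' y' : bar a) : (forall t, between x' y' t -> between x y t) ->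
    (ble z x' || ble y' z) -> (nb x' y' < n)%N.
  move=> sub nz; rewrite -En; apply: proper_card; apply/properP; split.
    by apply/fintype.subsetP => t; rewrite !inE; apply: sub.
  exists w; first by rewrite inE; exists z.
  apply/negP; rewrite inE => -[z' [z'w z'x yz']].
  have zz' : z = z' by apply: (bobj_mid_inj zu); rewrite zw.
  by move: nz; rewrite zz' (negPf z'x) (negPf yz').
rewrite -(eta_comp k xz zy xy); apply: (Qcomp (hv := zM)).
  apply: (IH (nb z y)) => //; apply: less; last by rewrite ble_refl.
  move=> t [z' [z't z'z yz']]; exists z'; split=> //.
  by apply: contra z'z => z'x; apply: ble_trans xz.
apply: (IH (nb x z)) => //; apply: less; last by rewrite ble_refl orbT.
move=> t [z' [z't z'x zz']]; exists z'; split=> //.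
by apply: contra zz' => yz'; apply: ble_trans yz'.
Qed.

Lemma Q_path (p : seq (arrow T)) (x y : vertex T) (xy : qpath x p y) hu hv :
  @Q (vtx x) (vtx y) hu hv (<< exist _ (Some p) xy : plike (vtx x) (vtx y) >> : {malg k[plike (vtx x) (vtx y)]}).
Proof.
elim: p x xy hu => [|a p IH] x xy hu.
  have E := eqP (xy : x == y); case: y / E xy hv => xx hv.
  have -> : << exist _ (Some [::]) xx : plike (vtx x) (vtx x) >> = idm C (vtx x).
    by rewrite /=; congr (<< _ >>); apply: val_inj.
  by rewrite (bool_irrelevance hv hu); apply: Qid.
have /andP[/eqP sa pa] : (src a == x) && qpath (tgt a) p y := xy.
case: x / sa xy hu => xy hu.
have -> : << exist _ (Some (a :: p)) xy : plike (vtx (src a)) (vtx y) >> =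
   comp (<< exist _ (Some p) pa : plike (vtx (tgt a)) (vtx y) >> : hom C (vtx (tgt a)) (vtx y))
        (eta k (ble_max (bmin a))).
  by rewrite /= path_compU; congr (<< _ >>); apply: val_inj.
by apply: (Qcomp (hv := MV _)); [apply: IH|exact: (Q_eta (ble_max (bmin a)))].
Qed.

Lemma Q_exit (u : obj T) (p : plike u (vtx (obj_exit u))) hu hv : val p = Some [::] ->
  @Q u (vtx (obj_exit u)) hu hv (<< p >> : {malg k[plike u (vtx (obj_exit u))]}).
Proof.
case: u p hu hv => [x|[a x]] p hu hv pE.
  have -> : << p >> = idm C (vtx x) by rewrite /=; congr (<< _ >>); apply: val_inj.
  by rewrite (bool_irrelevance hv hu); apply: Qid.
have -> : << p >> = eta k (ble_max (bmid x)) by congr (<< _ >>); apply: val_inj.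
exact: (Q_eta (ble_max (bmid x))).
Qed.

Lemma Q_entry (v : obj T) (p : plike (vtx (obj_entry v)) v) hu hv : val p = Some [::] ->
  @Q (vtx (obj_entry v)) v hu hv (<< p >> : {malg k[plike (vtx (obj_entry v)) v]}).
Proof.
case: v p hu hv => [x|[a x]] p hu hv pE.
  have -> : << p >> = idm C (vtx x) by rewrite /=; congr (<< _ >>); apply: val_inj.
  by rewrite (bool_irrelevance hv hu); apply: Qid.
have -> : << p >> = eta k (ble_min (bmid x)) by congr (<< _ >>); apply: val_inj.
exact: (Q_eta (ble_min (bmid x))).
Qed.

(** An element that is not an [eta] inside one thread factors through vertices, which belong to the
    sample by [MV]. *)
Lemma Q_plike u v (p : plike u v) hu hv : @Q u v hu hv (<< p >> : {malg k[plike u v]}).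
Proof.
case: p => -[p|] pv; last first.
  case: u v pv hu hv => [x|[a x]] [y|[b y]] // pv hu hv.
  have ab : a = b by have := pv; rewrite /= => /andP[/eqP].
  case: b / ab y pv hv => y pv hv.
  have xy : ble (bmid x) (bmid y) by have := pv; rewrite /= tagged_asE => /andP[].
  have -> : << exist _ None pv : plike (pt x) (pt y) >> = eta k xy by congr (<< _ >>); apply: val_inj.
  exact: (Q_eta xy).
have e1 : plike_valid u (vtx (obj_exit u)) (Some [::]) by exact: eqxx.
have e2 : plike_valid (vtx (obj_entry v)) v (Some [::]) by exact: eqxx.
have -> : << exist _ (Some p) pv : plike u v >> =
   comp (<< exist _ (Some [::]) e2 : plike (vtx (obj_entry v)) v >> : hom C _ _)
     (comp (<< exist _ (Some p) pv : plike (vtx (obj_exit u)) (vtx (obj_entry v)) >> : hom C _ _)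
       (<< exist _ (Some [::]) e1 : plike u (vtx (obj_exit u)) >> : hom C _ _)).
  by rewrite /= !path_compU; congr (<< _ >>); apply: val_inj; rewrite /= cats0.
apply: (Qcomp (hv := MV _)); first exact: Q_entry.
by apply: (Qcomp (hv := MV _)); [apply: Q_path|apply: Q_exit].
Qed.

Lemma Q_all u v hu hv (f : hom C u v) : @Q u v hu hv f.
Proof.
apply: (malg_span (P := @Q u v hu hv)) => [a f1 f2||p]; [exact: Qlin|exact: Q0|exact: Q_plike].
Qed.

End Generation.

End Generators.

(** * From a sample with slots to square-zero operators *)

Section Assembly.
Variables (k : closedFieldType) (disp : Order.disp_t) (T : thread_quiver disp).
Local Notation C := (path_cat k T).
Variables (J : ideal C) (M : {fset obj T}) (si so : arrow T -> bool).
Hypothesis sl : slots J si so.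
Hypothesis MV : forall x : vertex T, vtx x \in M.

Let si_inj : forall a b, tgt a = tgt b -> si a = si b -> a = b.
Proof. by case: sl. Qed.
Let so_inj : forall a b, src a = src b -> so a = so b -> a = b.
Proof. by case: sl. Qed.

Local Notation A := (full_subcat (quot_cat J) M).

Definition gen_srcM (c : gen M) : bobj (gen_src c) \in M := let: And4 h _ _ _ := gen_consec c in h.
Definition gen_tgtM (c : gen M) : bobj (gen_tgt c) \in M := let: And4 _ h _ _ := gen_consec c in h.

Definition gen_hom (c : gen M) : hom A [` gen_srcM c]%fset [` gen_tgtM c]%fset :=
  quot_pi J (eta k (gen_le c)).

(** A generator is determined by the slot it leaves, so objects with slots index all generators by a
    finite type. *)
Definition pick_gen (e : M * bool) : option (gen M) :=
  if pselect (exists c : gen M, bobj (gen_src c) = val e.1 /\ out_slot so (gen_src c) = e.2) is left h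
  then Some (projT1 (cid h)) else None.

Lemma pick_genP e c : pick_gen e = Some c ->
  bobj (gen_src c) = val e.1 /\ out_slot so (gen_src c) = e.2.
Proof.
by rewrite /pick_gen; case: pselect => // h [<-]; apply: (projT2 (cid h)).
Qed.

Lemma pick_gen_src c : pick_gen ([` gen_srcM c]%fset, out_slot so (gen_src c)) = Some c.
Proof.
rewrite /pick_gen; case: pselect => [h|[]]; last by exists c.
have [E S] := projT2 (cid h); congr Some.
exact: (gen_out_inj so_inj E S).
Qed.

(* A slot without outgoing arrow carries the zero endomorphism. *)
Definition gen_data (u : M) (o : option (gen M)) : {s : M & {t : M & hom A s t}} :=
  match o with
  | Some c => existT (fun s => {t : M & hom A s t}) [` gen_srcM c]%fset
                (existT (fun t => hom A [` gen_srcM c]%fset t) [` gen_tgtM c]%fset (gen_hom c))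
  | None => existT (fun s => {t : M & hom A s t}) u (existT (fun t => hom A u t) u 0)
  end.

Definition gsrc (e : M * bool) : M := projT1 (gen_data e.1 (pick_gen e)).
Definition gtgt (e : M * bool) : M := projT1 (projT2 (gen_data e.1 (pick_gen e))).
Definition garr (e : M * bool) : hom A (gsrc e) (gtgt e) := projT2 (projT2 (gen_data e.1 (pick_gen e))).
Definition gslot (e : M * bool) : option bool := omap (fun c => in_slot si (gen_tgt c)) (pick_gen e).

Lemma gsrcE e : gsrc e = e.1.
Proof.
rewrite /gsrc; case E: (pick_gen e) => [c|//] /=.
by apply: val_inj => /=; have [] := pick_genP E.
Qed.

Lemma gtgtE e c : pick_gen e = Some c -> val (gtgt e) = bobj (gen_tgt c).
Proof. by rewrite /gtgt => ->. Qed.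

Lemma garr_generates : generates garr.
Proof.
move=> Q Qlin Q0 Qid Qcomp Qg.
pose Q' u v (hu : u \in M) (hv : v \in M) (h : hom C u v) :=
  Q [` hu]%fset [` hv]%fset (quot_pi J h).
have H : forall u v hu hv (h : hom C u v), Q' u v hu hv h.
  apply: (@Q_all k disp T M MV Q').
  - by move=> u v hu hv a f f' Qf Qf'; rewrite /Q' quot_pi_lin; apply: Qlin.
  - move=> u v hu hv; rewrite /Q'.
    have -> : quot_pi J (0 : hom C u v) = 0 by rewrite -(subrr 0) quot_piB subrr.
    exact: (Q0 [` hu]%fset [` hv]%fset).
  - by move=> u hu; apply: (Qid [` hu]%fset).
  - move=> u v w hu hv hw f' f Qf' Qf; rewrite /Q' quot_pi_comp.
    exact: (Qcomp [` hu]%fset [` hv]%fset [` hw]%fset).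
  move=> c hu hv; rewrite /Q'.
  have := Qg ([` gen_srcM c]%fset, out_slot so (gen_src c)).
  rewrite /garr /gsrc /gtgt pick_gen_src /= /gen_hom.
  by rewrite (bool_irrelevance (gen_srcM c) hu) (bool_irrelevance (gen_tgtM c) hv).
move=> [u hu] [v hv] f; rewrite -(quot_reprK f); exact: (H u v hu hv (quot_repr f)).
Qed.

Section Normal.
Variables (d : nat) (g : 'I_d -> M) (r : forall x y : M, hom A x y -> 'M[k]_d).
Hypothesis rr : total_rep (A := A) (idfun : {rmorphism k -> k}) g r.

Lemma r_cast (z1 z2 : vertex T) (e : z1 = z2) v (h : hom C (vtx z1) v) h1 h2 hv :
  r (x := [` h2]%fset) (y := [` hv]%fset) (quot_pi J (ecast z (hom C (vtx z) v) e h)) =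
  r (x := [` h1]%fset) (y := [` hv]%fset) (quot_pi J h).
Proof. by case: z2 / e h2 => h2; rewrite (bool_irrelevance h2 h1). Qed.

Lemma gen_hom_zero (c c' : gen M) : bobj (gen_tgt c) = bobj (gen_src c') ->
  in_slot si (gen_tgt c) = out_slot so (gen_src c') -> r (gen_hom c') *m r (gen_hom c) = 0.
Proof.
have [rl _ rM] := rr.
have := @gen_src_max _ _ _ c; have := @gen_tgt_min _ _ _ c.
have := @gen_src_max _ _ _ c'; have := @gen_tgt_min _ _ _ c'; rewrite /gen_hom.
move: (gen_srcM c) (gen_tgtM c) (gen_srcM c') (gen_tgtM c').
case: c c' => [a x y xy co] [b x' y' xy' co'] /= hx hy hx' hy' ny' nx' ny nx.
(* Only a composition at a vertex survives: two interior ends have slots [false] and [true], and an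
   interior point is never a vertex. *)
case: y xy co hy ny => [|v|] xy co hy ny //=; case: x' xy' co' hx' nx' => [|v'|] xy' co' hx' nx' //=.
move=> [e] s; have [_ _ /(_ a b e s) qI] := sl.
pose q := comp (ecast z (hom C (vtx z) (bobj y')) (esym e) (eta k (ble_min y'))) (eta k (ble_max x)).
have Jq : J _ _ q by apply: qI; apply: QuadI.
have : r (x := [` hx]%fset) (y := [` hy']%fset) (quot_pi J q) = 0.
  have -> : quot_pi J q = quot_pi J 0 by apply/quot_piP; rewrite subr0.
  have -> : quot_pi J (0 : hom C (bobj x) (bobj y')) = 0 by rewrite -(subrr 0) quot_piB subrr.
  exact: (rlin0 (rl [` hx]%fset [` hy']%fset)).
rewrite /q quot_pi_comp (rM [` hx]%fset [` hy]%fset [` hy']%fset) (r_cast _ _ hx').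
by rewrite (bool_irrelevance (ble_min y') xy') (bool_irrelevance (ble_max x) xy).
Qed.

Lemma garr_gen e c : pick_gen e = Some c -> r (garr e) = r (gen_hom c).
Proof. by rewrite /garr /gsrc /gtgt => ->. Qed.

Lemma garr_none e : pick_gen e = None -> r (garr e) = 0.
Proof.
have [rl _ _] := rr; rewrite /garr /gsrc /gtgt => -> /=.
exact: (rlin0 (rl e.1 e.1)).
Qed.

Definition slot_mx (j i : bool) : 'M[k]_d :=
  \matrix_(t, s) if gslot (g s, i) == Some j then r (garr (g s, i)) t s else 0.

Lemma garr_supp e t s : r (garr e) t s != 0 -> g t = gtgt e /\ g s = e.1.
Proof. by move=> /(total_supp rr) [-> ->]; rewrite gsrcE. Qed.

(** Each summand vanishes separately: arrows composed through slot [l] of an object enter and leave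
    by the same slot. *)
Lemma slot_mx_sq j i : slot_mx j false *m slot_mx false i + slot_mx j true *m slot_mx true i = 0.
Proof.
have E l t s : (slot_mx j l *m slot_mx l i) t s = 0.
  rewrite mxE; set e := (g s, i); have [el|el] := boolP (gslot e == Some l); last first.
    by rewrite big1 // => u _; rewrite [X in _ * X]mxE (negPf el) mulr0.
  case Ec : (pick_gen e) => [c|]; last by move: el; rewrite /gslot Ec.
  pose e1 := (gtgt e, l).
  have [e1j|e1j] := boolP (gslot e1 == Some j); last first.
    rewrite big1 // => u _; rewrite !mxE el.
    have [->|/garr_supp[gu _]] := eqVneq (r (garr e) u s) 0; first by rewrite mulr0.
    by rewrite gu (negPf e1j) mul0r.
  transitivity ((r (garr e1) *m r (garr e)) t s).
    rewrite mxE; apply: eq_bigr => u _; rewrite !mxE el.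
    have [->|/garr_supp[gu _]] := eqVneq (r (garr e) u s) 0; first by rewrite !mulr0.
    by rewrite gu e1j.
  case Ec1 : (pick_gen e1) => [c1|]; last by rewrite garr_none // mul0mx mxE.
  have [E1 E2] := pick_genP Ec1.
  rewrite (garr_gen Ec1) (garr_gen Ec) gen_hom_zero ?mxE //.
    by rewrite E1 /= (gtgtE Ec).
  by move: el; rewrite /gslot Ec E2 /= => /eqP[].
by apply/matrixP => t s; rewrite mxE !E mxE addr0.
Qed.

(** At most one generator enters and at most one leaves a slot, so source slot and target slot of an
    arrow determine each other. *)
Lemma slot_mx_graded j i x y j' i' x' y' : slot_mx j i x y != 0 -> slot_mx j' i' x' y' != 0 ->
  ((g x, j) == (g x', j')) = ((g y, i) == (g y', i')).
Proof.
rewrite !mxE; case: ifP => [/eqP sj|_]; last by rewrite eqxx.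
move=> /garr_supp[gx _]; case: ifP => [/eqP sj'|_]; last by rewrite eqxx.
move=> /garr_supp[gx' _]; apply/eqP/eqP => [[gxx jj]|E]; last first.
  by rewrite gx gx' E; congr pair; rewrite E sj' in sj; case: sj.
move: sj sj'; rewrite /gslot.
case Ec : (pick_gen (g y, i)) => [c|] //; case Ec' : (pick_gen (g y', i')) => [c'|] //= [sj] [sj'].
have cc' : c = c'.
  apply: (gen_in_inj si_inj); last by rewrite sj sj'.
  by rewrite -(gtgtE Ec) -(gtgtE Ec') -gx -gx' gxx.
rewrite -cc' in Ec'; have [/= E1 <-] := pick_genP Ec; have [/= E2 <-] := pick_genP Ec'.
by congr pair; apply: val_inj; rewrite /= -E1 -E2.
Qed.

Lemma garr_slot_mx e j : gslot e = Some j ->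
  r (garr e) = slot_mx j e.2 *m proj_on k (fiber g [set: 'I_d]%SET e.1).
Proof.
move=> ej; apply/matrixP => t s; rewrite mulr_proj_on !inE /=.
have [gs|gs] := eqVneq (g s) e.1; last first.
  by apply/eqP; apply: contraR gs => /garr_supp[_ ->].
by rewrite mxE gs -surjective_pairing ej eqxx.
Qed.

End Normal.

Lemma garr_normal d : exists S : seq {poly k},
  forall (g : 'I_d -> M) r, total_rep (A := A) (idfun : {rmorphism k -> k}) g r ->
  exists (B : 'M[k]_d) (l : 'I_d -> k), [/\ B \in unitmx, forall s t, B s t != 0 -> g s = g t,
    forall e s t, conj_mx B (r _ _ (garr e)) s t != 0 -> l s = l t &
    forall e s t, exists2 p, p \in S & conj_mx B (r _ _ (garr e)) s t = p.[l t]].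
Proof.
have [S HS] := arrow_normal_form k d.
exists (0 :: S) => g r rr.
have [B [l [uB gB lB eB]]] := HS M g (slot_mx g r) (slot_mx_sq rr) (slot_mx_graded rr).
exists B, l; split=> //.
  move=> e s t; case Es: (gslot e) => [j|].
    rewrite (garr_slot_mx rr Es).
    rewrite conj_mx_mul // => /mulmx_neq0[u /lB ->].
    rewrite conj_proj_on //.
    by rewrite mxE; case: (u =P t) => [->|_]; rewrite /= ?eqxx.
  have En : pick_gen e = None by move: Es; rewrite /gslot; case: (pick_gen e).
  by rewrite (garr_none rr En) /conj_mx mulmx0 mul0mx mxE eqxx.
move=> e s t; case Es: (gslot e) => [j|]; last first.
  have En : pick_gen e = None by move: Es; rewrite /gslot; case: (pick_gen e).
  rewrite (garr_none rr En) /conj_mx mulmx0 mul0mx mxE.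
  by exists 0; rewrite ?horner0 // inE eqxx.
rewrite (garr_slot_mx rr Es) conj_mx_mul // conj_proj_on //.
rewrite mulr_proj_on; case: ifP => _; last by exists 0; rewrite ?horner0 // inE eqxx.
by have [p pS ->] := eB j e.2 s t; exists p; rewrite // inE pS orbT.
Qed.

Lemma assembly_tame : tame A.
Proof. exact: (tame_criterion garr_generates garr_normal). Qed.

End Assembly.

(** * Passing to the completion of the ideal *)

Section Completion.
Variables (k : fieldType) (disp : Order.disp_t) (T : thread_quiver disp).
Local Notation C := (path_cat k T).

(** Every morphism is equivalent to itself through identities. Hence the zero relations behind the
    slots persist in the completion. *)
Lemma sub_completion (cells : set (set (obj T))) (I : ideal C) :
  valid_partition cells -> subfamily I (completion cells I).
Proof.
move=> [[cov _ _] _ _] x y f If J SJ; apply: SJ; exists x, y, f; split=> //.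
have cell (u : obj T) : exists2 X : set (obj T), cells X & X u.
  have : (cover cells id) u by rewrite cov.
  by case=> X cX Xu; exists X.
have [X cX Xx] := cell x; have [Y cY Yy] := cell y.
exists X, Y; split=> //; exists x, y, (obj_le_refl x), (obj_le_refl x), (obj_le_refl y), (obj_le_refl y).
by [].
Qed.

Lemma vtx_sample (cells : set (set (obj T))) (M : {fset obj T}) (x : vertex T) :
  valid_partition cells -> sample cells M -> vtx x \in M.
Proof.
move=> [_ cv _] sM; have [w [[wM Ew] _]] := sM _ (cv x).
by rewrite -Ew.
Qed.

End Completion.

Lemma slots_sub (k : fieldType) (disp : Order.disp_t) (T : thread_quiver disp)
    (I J : ideal (path_cat k T)) si so : subfamily I J -> slots I si so -> slots J si so.
Proof.
move=> IJ [h1 h2 h3]; split=> // a b e s u v f q.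
by apply: IJ; apply: (h3 a b e s).
Qed.

Theorem proposition6p10 (k : closedFieldType) (d : Order.disp_t)
    (T : thread_quiver d) (hT : biserial_quiver T) (I : ideal (path_cat k T)) :
  special_biserial I \/ gentle I \/ string_category I -> virtually_tame I.
Proof.
move=> H; have [sb1 sb2] : SB1 at_least_one I /\ SB2 at_least_one I.
  have sub P Q : exactly_one P Q -> at_least_one P Q by case=> -[? ?]; [left|right].
  case: H => [[_ h1 h2]|[[_ h1 h2 _]|[[_ h1 h2] _]]] //.
  by split=> a b c ea eb n; apply: sub; [apply: h1|apply: h2].
move=> cells M vc sM; have [si [so sl]] := slots_exist hT sb1 sb2.
apply: assembly_tame (slots_sub (sub_completion vc) sl) _ => x.
exact: vtx_sample vc sM.
Qed.
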